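(* Let $t>0$ be such that $t$ is not the ordinate of any nontrivial zero of the Riemann zeta-function (i.e. there is no zero $\beta+i\gamma$ of $\zeta(s)$ with $0<\beta<1$ and $\gamma=t$). Then $$Z(t)=(-1)^{N(t)+1}\,\bigl|\zeta(\tfrac12+it)\bigr|.$$
   Context: $\zeta(s)$ is the Riemann zeta-function, $\zeta(s)=\sum_{n\ge1}n^{-s}$ for $\Re s>1$, extended by analytic continuation; it satisfies $\zeta(s)=\chi(s)\zeta(1-s)$ with $\chi(s)=\frac{\Gamma(\frac12(1-s))}{\Gamma(\frac12 s)}\pi^{s-1/2}$. Hardy's function is $Z(t)=\zeta(\tfrac12+it)\,e^{i\theta(t)}$ for real $t$, where $e^{i\theta(t)}=(\chi(\tfrac12+it))^{-1/2}=\pi^{-it/2}\frac{\Gamma(\frac14+\frac12 it)}{|\Gamma(\frac14+\frac12 it)|}$ and $\theta(t)=\Im\{\log\Gamma(\tfrac14+\tfrac12 it)\}-\tfrac12 t\log\pi\in\mathbb{R}$ (with $\log\Gamma$ the branch continuous on the vertical line, real for $t=0$); $Z(t)$ is a real-valued, even, smooth function with $|Z(t)|=|\zeta(\frac12+it)|$. For $T>0$, $N(T)=\sum_{0<\gamma\le T}1$ denotes the number of nontrivial zeros $\rho=\beta+i\gamma$ of $\zeta(s)$ (with $0<\beta<1$) satisfying $0<\gamma\le T$, each zero counted according to its multiplicity. *)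

(* Defs.v *)
From Stdlib Require Import Reals List ClassicalEpsilon.
From Coquelicot Require Import Coquelicot.
Open Scope R_scope.
Open Scope C_scope.

Definition Cexp (z : C) : C :=
  (exp (Re z) * cos (Im z), exp (Re z) * sin (Im z))%R.

(* [x] raised to the complex power [s], with the real logarithm of [x]; it is
   only used for [0 < x]. *)
Definition Rcpow (x : R) (s : C) : C := Cexp (s * RtoC (ln x)).

Definition analytic_at (f : C -> C) (z : C) : Prop :=
  exists (a : nat -> C) (r : R),
    (0 < r)%R /\
    forall w : C, (Cmod (w - z) < r)%R ->
      @is_pseries C_AbsRing C_NormedModule a (w - z) (f w).

Definition zero_of_order (f : C -> C) (z : C) (m : nat) : Prop :=
  exists g : C -> C,
    analytic_at g z /\ g z <> RtoC 0 /\
    exists r : R, (0 < r)%R /\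
      forall w : C, (Cmod (w - z) < r)%R -> f w = (w - z) ^ m * g w.

Definition is_Riemann_zeta (f : C -> C) : Prop :=
  (forall s : C, s <> RtoC 1 -> analytic_at f s) /\
  (forall s : C, (1 < Re s)%R ->
     @is_series C_AbsRing C_NormedModule
       (fun n => Rcpow (INR (S n)) (- s)) (f s)).

(* By the identity theorem [is_Riemann_zeta] determines its argument everywhere
   except at the pole [1], where the value of [zeta] is unspecified. *)
Definition zeta : C -> C :=
  epsilon (inhabits (fun _ : C => RtoC 0)) is_Riemann_zeta.

(* Euler's integral, which converges for [0 < Re s]; only such arguments
   are used. *)
Definition CGamma (s : C) : C :=
  @RInt_gen C_R_CompleteNormedModule
    (fun x : R => Rcpow x (s - RtoC 1) * RtoC (exp (- x)))
    (at_right 0) (Rbar_locally p_infty).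

(* The unimodular factor [exp (i theta(t))], [theta] being the
   Riemann-Siegel theta function. *)
Definition exp_i_theta (t : R) : C :=
  Rcpow PI (- (Ci * RtoC t / RtoC 2)) *
  (CGamma ((1 / 4)%R, (t / 2)%R) /
   RtoC (Cmod (CGamma ((1 / 4)%R, (t / 2)%R)))).

Definition hardyZ (t : R) : C := zeta ((1 / 2)%R, t) * exp_i_theta t.

Definition nontrivial_zero (rho : C) : Prop :=
  (0 < Re rho < 1)%R /\ zeta rho = RtoC 0.

Definition is_zero_count (T : R) (n : nat) : Prop :=
  exists (l : list C) (m : C -> nat),
    NoDup l /\
    (forall rho : C,
       In rho l <-> nontrivial_zero rho /\ (0 < Im rho <= T)%R) /\
    (forall rho : C, In rho l -> zero_of_order zeta rho (m rho)) /\
    n = list_sum (map m l).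

(* The relation [is_zero_count T] holds for exactly one [n], because the zeros
   in question are finitely many and have well-defined orders. *)
Definition zeroN (T : R) : nat := epsilon (inhabits O) (is_zero_count T).

(* Main.v *)
Require Import Defs.
From Stdlib Require Import Reals ZArith Lra Lia List Factorial Classical ClassicalEpsilon Permutation.
From Coquelicot Require Import Coquelicot.

(** The function [xi(u) = pi^(-s/2) Gamma(s/2) zeta(s)], [s = 1/2 + iu], is real by the functional
    equation and differs from [hardyZ u] by a positive factor. It is negative at [u = 0], and at a zero
    of order [m] it changes sign by [(-1)^m]; zeros off the line come in pairs [rho], [1 - conj rho] of
    the same height and order, so the total sign change up to [t] is [(-1)^(N(t))].

    Existence of zeta: [zeta(s) = 1/(s-1) + 1/2 + s/12 - s(s+1) int_1^oo P(x) x^(-s-2) dx] with [P] the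
    periodic second Bernoulli polynomial (halved); since [P] has mean zero, repeated integration by parts
    continues the integral to an entire function.

    Functional equation: in the strip [zeta(s)] is the limit of [sum_(n<=N) n^(-s) - N^(1-s)/(1-s)], and
    [pi^(-s/2) Gamma(s/2)] times this partial expression is the Mellin transform of
    [sum_(n<=N) exp(-pi n^2 x) - int_0^N exp(-pi y^2 x) dy], which is within [exp(-pi N^2 x)] of
    [omega(x) = sum_(n>=1) exp(-pi n^2 x) - 1/(2 sqrt x)]. So the completed zeta function is the Mellin
    transform of [omega], and its symmetry is Jacobi's identity [omega(1/x) = sqrt x omega(x)], obtained
    by Polya's method: sum the binomial expansion of [(2 + 2 cos)^m] over roots of unity and let
    [m] tend to infinity. *)

(** As [zeta] and [zeroN] are defined by choice, nothing can be said of them before witnesses are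
    constructed. Of the gamma factor only continuity and nonvanishing are established. Hence orders
    of zeros are compared through the growth [|w - z|^m] of absolute values, which also suits the
    antiholomorphic map [rho -> 1 - conj rho], and sign changes are read from a factorisation
    [(u - c)^m k(u)] with [k] merely continuous. Nonvanishing is proved on Euler's integral: the
    recurrence carries a zero far to the right, where the Gamma density is too concentrated for the
    oscillating factor to cancel it. The sign at [u = 0] comes from [zeta(1/2) <= -1]: the
    expressions [sum_(n<=N) n^(-1/2) - 2 sqrt N] start at [-1] and decrease. This negative start is
    the extra [1] in the exponent [N(t) + 1], and it excludes a zero at height [0], which the count
    would miss. The Gaussian integral is not evaluated beforehand: its value falls out of the theta
    identity. *)

Notation is_Cpseries := (@is_pseries C_AbsRing C_NormedModule).
Notation is_Cseries := (@is_series C_AbsRing C_NormedModule).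

(** * Preliminaries on complex numbers and limits *)

Lemma pow_n_Cpow (z : C) (n : nat) : @pow_n C_Ring z n = (z ^ n)%C.
Proof. induction n as [|n IH]; simpl; [reflexivity|now rewrite IH]. Qed.

Lemma Ceq (z w : C) : fst z = fst w -> snd z = snd w -> z = w.
Proof. destruct z, w; simpl; intros -> ->; reflexivity. Qed.

Lemma RtoC_neq_0 (x : R) : x <> 0 -> RtoC x <> 0%C.
Proof. intros H E; apply H; injection E; auto. Qed.

Lemma Cminus_neq_0 (z w : C) : z <> w -> (z - w)%C <> 0%C.
Proof. intros H E; apply H; replace z with ((z - w) + w)%C by ring; rewrite E; ring. Qed.

Lemma Cmod_le_abs (z : C) : Cmod z <= Rabs (Re z) + Rabs (Im z).
Proof.
  replace z with (RtoC (Re z) + Ci * RtoC (Im z))%C at 1 by (destruct z; apply Ceq; simpl; unfold Re, Im; simpl; ring).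
  eapply Rle_trans; [apply Cmod_triangle|].
  rewrite Cmod_mult, Cmod_Ci, !Cmod_R; lra.
Qed.

Lemma Cmod_Im_le (z : C) : Rabs (Im z) <= Cmod z.
Proof. eapply Rle_trans; [apply Rmax_r|apply Rmax_Cmod]. Qed.

Lemma Cmod_sub_comm (z w : C) : Cmod (z - w) = Cmod (w - z).
Proof. rewrite <- Cmod_opp; f_equal; ring. Qed.

Lemma Cmod_triangle_sub (z w u : C) : Cmod (z - w) <= Cmod (z - u) + Cmod (u - w).
Proof. replace (z - w)%C with ((z - u) + (u - w))%C by ring; apply Cmod_triangle. Qed.

Lemma Cmod_ge_sub (z w : C) : Cmod z - Cmod w <= Cmod (z - w).
Proof.
  pose proof (Cmod_triangle (z - w) w) as H.
  replace (z - w + w)%C with z in H by ring; lra.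
Qed.

(** The uniform structure of [C] is that of a product, with squares as balls; the factor [sqrt 2]
    compares these with the discs of [Cmod]. *)
Lemma filterlim_C_iff {T : Type} (F : (T -> Prop) -> Prop) {FF : Filter F} (f : T -> C) (l : C) :
  filterlim f F (locally l) <-> forall eps, 0 < eps -> F (fun x => Cmod (f x - l) < eps).
Proof.
  split.
  - intros H eps Heps.
    pose proof (sqrt_lt_R0 2 ltac:(lra)) as Hs.
    assert (Hp : 0 < eps / sqrt 2) by (apply Rdiv_lt_0_compat; auto).
    specialize (H (fun y => Cmod (y - l) < eps)).
    apply H; exists (mkposreal _ Hp); intros y Hy.
    apply (C_NormedModule_mixin_compat2 l y (mkposreal _ Hp)) in Hy.
    simpl in Hy; replace (sqrt 2 * (eps / sqrt 2)) with eps in Hy by (field; lra).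
    exact Hy.
  - intros H P [d Hd].
    specialize (H d (cond_pos d)); revert H; unfold filtermap; apply filter_imp.
    intros x Hx; apply Hd; apply C_NormedModule_mixin_compat1; exact Hx.
Qed.

Lemma eventually_C_lim_unique (u : nat -> C) (l l' : C) :
  filterlim u eventually (locally l) -> filterlim u eventually (locally l') -> l = l'.
Proof. intros H1 H2; apply (filterlim_locally_unique (F := eventually) u l l' H1 H2). Qed.

Lemma Clim_Cmod_le (u : nat -> C) (l : C) (M : R) :
  filterlim u eventually (locally l) -> (forall n, Cmod (u n) <= M) -> Cmod l <= M.
Proof.
  intros H HM; apply Rnot_lt_le; intros Hlt.
  rewrite filterlim_C_iff in H by apply eventually_filter.
  destruct (H (Cmod l - M) ltac:(lra)) as [N HN].
  specialize (HN N (Nat.le_refl _)); specialize (HM N).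
  pose proof (Cmod_ge_sub l (u N)); rewrite Cmod_sub_comm in HN; lra.
Qed.

(** * Power series, orders of zeros and the identity theorem *)

Definition Clim_at (f : C -> C) (z l : C) : Prop :=
  forall eps, 0 < eps -> exists d, 0 < d /\
    forall w, Cmod (w - z) < d -> Cmod (f w - l) < eps.

(** A term is the difference of two consecutive partial sums, and convergent partial sums are
    bounded. *)
Lemma pseries_terms_bounded (a : nat -> C) (w l : C) :
  is_Cpseries a w l -> exists M, forall k, Cmod (a k) * Cmod w ^ k <= M.
Proof.
  intros H.
  destruct (filterlim_bounded (K := C_AbsRing) (V := C_NormedModule)
    (sum_n (fun k => scal (pow_n w k) (a k)))) as [M HM].
  { exists l; exact H. }
  exists (M + M); intros k.
  rewrite <- Cmod_pow, Rmult_comm, <- Cmod_mult, <- pow_n_Cpow.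
  pose proof (Rle_trans _ _ _ (Cmod_ge_0 _) (HM 0%nat)) as HM0.
  destruct k as [|k].
  - specialize (HM 0%nat); rewrite sum_O in HM; eapply Rle_trans; [exact HM|lra].
  - pose proof (HM k) as H1; pose proof (HM (S k)) as H2.
    rewrite sum_Sn in H2.
    change (Cmod (sum_n (fun k => scal (pow_n w k) (a k)) k) <= M) in H1.
    change (Cmod (sum_n (fun k => scal (pow_n w k) (a k)) k + pow_n w (S k) * a (S k)) <= M) in H2.
    set (x := sum_n _ _) in *; set (y := (_ * a (S k))%C) in *.
    replace y with ((x + y) - x)%C by ring.
    pose proof (Cmod_ge_sub (x + y) x).
    pose proof (Cmod_triangle (x + y) (- x)); rewrite Cmod_opp in H3.
    change (Cmod (x + y + - x) <= M + M); lra.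
Qed.

Lemma Cmod_sum_n_le (u : nat -> C) (v : nat -> R) (n : nat) :
  (forall k, Cmod (u k) <= v k) -> Cmod (@sum_n C_Ring u n) <= sum_n v n.
Proof.
  intros H; induction n as [|n IH].
  - rewrite !sum_O; apply H.
  - rewrite !sum_Sn; eapply Rle_trans; [apply Cmod_triangle|apply Rplus_le_compat; auto].
Qed.

Lemma sum_geom_tail_le (t M : R) (n : nat) :
  0 <= t <= 1 / 2 -> 0 <= M ->
  sum_n (fun k => match k with O => 0 | S _ => M * t ^ k end) n <= 2 * M * t.
Proof.
  intros Ht HM.
  (* The subtracted term makes the bound inductive: the step leaves a surplus
     [M t^(n+1) (1 - 2t) >= 0]. *)
  assert (H : sum_n (fun k => match k with O => 0 | S _ => M * t ^ k end) n
              <= 2 * M * t - 2 * M * t ^ (S n)).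
  { induction n as [|n IH].
    - rewrite sum_O; simpl; lra.
    - rewrite sum_Sn; unfold plus; simpl in *.
      assert (0 <= M * (t * t ^ n) * (1 - 2 * t)).
      { apply Rmult_le_pos; [apply Rmult_le_pos; auto; apply Rmult_le_pos; [lra|apply pow_le; lra]|lra]. }
      nra. }
  assert (0 <= M * t ^ S n) by (apply Rmult_le_pos; auto; apply pow_le; lra).
  lra.
Qed.

(** Bounded terms at radius [p = r / 2] majorise the series at [w] by a geometric one of ratio
    [|w| / p], which is at most [1/2] once [|w| < p / 2]. *)
Lemma pseries_first_order (a : nat -> C) (r : R) (f : C -> C) :
  0 < r -> (forall w, Cmod w < r -> is_Cpseries a w (f w)) ->
  exists K d, 0 < d /\ forall w, Cmod w < d -> Cmod (f w - a 0%nat) <= K * Cmod w.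
Proof.
  intros Hr H.
  set (p := r / 2).
  assert (Hp : Cmod (RtoC p) = p) by (rewrite Cmod_R; apply Rabs_right; unfold p; lra).
  destruct (pseries_terms_bounded a (RtoC p) (f (RtoC p))) as [M HM].
  { apply H; rewrite Hp; unfold p; lra. }
  rewrite Hp in HM.
  assert (HM0 : 0 <= M).
  { eapply Rle_trans; [|apply (HM 0%nat)]; simpl; rewrite Rmult_1_r; apply Cmod_ge_0. }
  assert (p0 : 0 < p) by (unfold p; lra).
  exists (2 * M / p), (p / 2); split; [lra|].
  intros w Hw.
  assert (Hs := H w ltac:(unfold p in Hw; lra)).
  set (t := Cmod w / p).
  assert (Ht : 0 <= t <= 1 / 2).
  { pose proof (Cmod_ge_0 w); unfold t; split.
    - apply Rmult_le_pos; auto; left; apply Rinv_0_lt_compat; auto.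
    - apply Rle_div_l; lra. }
  replace (2 * M / p * Cmod w) with (2 * M * t) by (unfold t; field; lra).
  set (u := fun k => scal (pow_n w k) (a k) : C) in *.
  apply (Clim_Cmod_le (fun n => sum_n u n - a 0%nat)%C).
  - apply filterlim_C_iff; [apply eventually_filter|].
    intros eps He.
    assert (Hs' : filterlim (sum_n u) eventually (locally (f w))) by exact Hs.
    rewrite filterlim_C_iff in Hs' by apply eventually_filter.
    generalize (Hs' eps He); apply filter_imp; intros n Hn.
    replace (sum_n u n - a 0%nat - (f w - a 0%nat))%C with (sum_n u n - f w)%C; auto.
    simpl; ring.
  - intros n.
    replace (sum_n u n - a 0%nat)%C
      with (@sum_n C_Ring (fun k => match k with O => RtoC 0 | S _ => u k end) n).
    + eapply Rle_trans; [apply Cmod_sum_n_le with (v := fun k => match k with O => 0 | S _ => M * t ^ k end)|].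
      * intros [|k]; [rewrite Cmod_0; lra|].
        unfold u.
        change (Cmod (pow_n w (S k) * a (S k)) <= M * t ^ S k).
        rewrite pow_n_Cpow, Cmod_mult, Cmod_pow.
        replace (Cmod w) with (t * p) by (unfold t; field; lra).
        rewrite Rpow_mult_distr.
        pose proof (HM (S k)).
        pose proof (pow_le t (S k) ltac:(lra)).
        replace (t ^ S k * p ^ S k * Cmod (a (S k))) with (t ^ S k * (Cmod (a (S k)) * p ^ S k)) by ring.
        rewrite (Rmult_comm M); apply Rmult_le_compat_l; auto.
      * apply sum_geom_tail_le; auto.
    + induction n as [|n IH].
      * rewrite !sum_O; unfold u; simpl.
        change (RtoC 0 = 1 * a 0%nat - a 0%nat)%C; ring.
      * rewrite !sum_Sn, IH.
        change ((sum_n u n - a 0%nat) + u (S n) = (sum_n u n + u (S n)) - a 0%nat)%C; ring.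
Qed.

Lemma analytic_at_lipschitz (f : C -> C) (z : C) : analytic_at f z ->
  exists K d, 0 < d /\ forall w, Cmod (w - z) < d -> Cmod (f w - f z) <= K * Cmod (w - z).
Proof.
  intros (a & r & Hr & H).
  destruct (pseries_first_order a r (fun w => f (w + z)%C) Hr) as (K & d & Hd & Hb).
  { intros w Hw; replace w with (w + z - z)%C at 1 by ring; apply H.
    replace (w + z - z)%C with w by ring; auto. }
  exists K, d; split; auto; intros w Hw.
  assert (Ha : a 0%nat = f z).
  { pose proof (H z ltac:(replace (z - z)%C with (RtoC 0) by ring; rewrite Cmod_0; lra)) as H0.
    replace (z - z)%C with (RtoC 0) in H0 by ring.
    apply (eventually_C_lim_unique (sum_n (fun k => scal (pow_n (RtoC 0 : C_AbsRing) k) (a k)))); auto.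
    apply (is_pseries_0 (K := C_AbsRing) (V := C_NormedModule) a). }
  specialize (Hb (w - z)%C Hw); rewrite Ha in Hb.
  replace (w - z + z)%C with w in Hb by ring; auto.
Qed.

Lemma analytic_at_cont (f : C -> C) (z : C) : analytic_at f z -> Clim_at f z (f z).
Proof.
  intros H; destruct (analytic_at_lipschitz f z H) as (K & d & Hd & HK).
  intros eps He.
  exists (Rmin d (eps / (Rabs K + 1))).
  pose proof (Rabs_pos K); split.
  - apply Rmin_glb_lt; auto; apply Rdiv_lt_0_compat; lra.
  - intros w Hw.
    assert (H1 := Rlt_le_trans _ _ _ Hw (Rmin_l _ _)).
    assert (H2 := Rlt_le_trans _ _ _ Hw (Rmin_r _ _)).
    eapply Rle_lt_trans; [apply HK; auto|].
    apply Rlt_div_r in H2; [|lra].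
    pose proof (Cmod_ge_0 (w - z)); pose proof (Rle_abs K); nra.
Qed.

Lemma analytic_at_ext_loc (f g : C -> C) (z : C) (r : R) : 0 < r ->
  (forall w, Cmod (w - z) < r -> f w = g w) -> analytic_at f z -> analytic_at g z.
Proof.
  intros Hr He (a & r' & Hr' & H).
  exists a, (Rmin r r'); split; [apply Rmin_glb_lt; auto|].
  intros w Hw; rewrite <- He.
  - apply H; eapply Rlt_le_trans; [exact Hw|apply Rmin_r].
  - eapply Rlt_le_trans; [exact Hw|apply Rmin_l].
Qed.

Definition locally_zero (f : C -> C) (z : C) : Prop :=
  exists r, 0 < r /\ forall w, Cmod (w - z) < r -> f w = 0%C.

Lemma least_nonzero (a : nat -> C) :
  (forall k, a k = 0%C) \/ exists m, a m <> 0%C /\ forall k, (k < m)%nat -> a k = 0%C.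
Proof.
  destruct (classic (exists m, a m <> 0%C)) as [[m Hm]|H].
  - right; revert Hm; induction m as [m IH] using (well_founded_induction Wf_nat.lt_wf); intros Hm.
    destruct (classic (exists k, (k < m)%nat /\ a k <> 0%C)) as [(k & Hk & Ha)|H].
    + apply (IH k); auto.
    + exists m; split; auto; intros k Hk; apply NNPP; intros Ha; apply H; exists k; auto.
  - left; intros k; apply NNPP; intros Ha; apply H; exists k; auto.
Qed.

(** If [a m] is the first nonzero coefficient, the cofactor is [f w / (w - z)^m], completed by [a m]
    at [z]; its expansion is the shifted sequence [a (m + k)]. *)
Lemma analytic_dichotomy (f : C -> C) (z : C) : analytic_at f z ->
  locally_zero f z \/ exists m, zero_of_order f z m.
Proof.
  intros (a & r & Hr & H).
  destruct (least_nonzero a) as [H0|(m & Hm & Hlt)].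
  - left; exists r; split; auto; intros w Hw.
    apply (eventually_C_lim_unique (sum_n (fun k => scal (pow_n ((w - z)%C : C_AbsRing) k) (a k)))).
    + apply H; auto.
    + apply (filterlim_ext (fun _ => RtoC 0)); [|apply filterlim_const].
      intros n; induction n as [|n IH].
      * rewrite sum_O, H0; change (RtoC 0 = pow_n ((w - z)%C : C_Ring) 0 * 0)%C; ring.
      * rewrite sum_Sn, <- IH, H0; change (RtoC 0 = 0 + pow_n ((w - z)%C : C_Ring) (S n) * 0)%C; ring.
  - right; exists m.
    set (g := fun w => match excluded_middle_informative (w = z) with
                       | left _ => a m | right _ => (f w / (w - z) ^ m)%C end).
    exists g; split; [|split].
    + exists (fun k => a (m + k)%nat), r; split; auto; intros w Hw.
      unfold g; destruct (excluded_middle_informative (w = z)) as [->|Hwz].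
      * replace (z - z)%C with (RtoC 0) by ring.
        generalize (is_pseries_0 (K := C_AbsRing) (V := C_NormedModule) (fun k => a (m + k)%nat)).
        rewrite Nat.add_0_r; auto.
      (* The shift lemma for power series asks for [0 < m]. *)
      * destruct (Nat.eq_dec m 0) as [->|Hm0].
        { replace (f w / (w - z) ^ 0)%C with (f w) by (simpl; field); apply H; auto. }
        assert (Hw0 := Cminus_neq_0 _ _ Hwz).
        pose proof (@is_pseries_decr_n C_AbsRing C_NormedModule a m (w - z)%C (/ (w - z))%C (f w)) as HH.
        assert (E : scal (pow_n ((/ (w - z))%C : C_AbsRing) m)
           (plus (f w : C_NormedModule) (opp (sum_n (fun k => scal (pow_n ((w - z)%C : C_AbsRing) k) (a k : C_NormedModule)) (m - 1))))
           = (f w / (w - z) ^ m)%C).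
        { rewrite (sum_n_ext_loc _ (fun _ => RtoC 0 : C_NormedModule)).
          - replace (sum_n (fun _ => RtoC 0 : C_NormedModule) (m - 1)) with (RtoC 0 : C_NormedModule).
            + change (pow_n ((/ (w - z))%C : C_Ring) m * (f w + - 0) = f w / (w - z) ^ m)%C.
              rewrite pow_n_Cpow, Cpow_inv by auto; field; apply Cpow_nz; auto.
            + generalize (m - 1)%nat; intros k; induction k as [|k IH]; [now rewrite sum_O|].
              rewrite sum_Sn, <- IH; change (RtoC 0 = 0 + 0)%C; ring.
          - intros k Hk; rewrite Hlt by lia.
            change (pow_n ((w - z)%C : C_Ring) k * 0 = 0)%C; ring. }
        rewrite <- E; apply HH; [|lia|apply H; auto].
        change (/ (w - z) * (w - z) = 1)%C; field; auto.
    + unfold g; destruct (excluded_middle_informative (z = z)); [auto|congruence].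
    + exists r; split; auto; intros w Hw; unfold g.
      destruct (excluded_middle_informative (w = z)) as [->|Hwz].
      * replace (z - z)%C with (RtoC 0) by ring.
        assert (Hz : f z = a 0%nat).
        { apply (eventually_C_lim_unique (sum_n (fun k => scal (pow_n (RtoC 0 : C_AbsRing) k) (a k)))).
          - replace (RtoC 0) with (z - z)%C by ring; apply H; auto.
          - apply (is_pseries_0 (K := C_AbsRing) (V := C_NormedModule) a). }
        rewrite Hz; destruct m as [|m]; [simpl; ring|].
        rewrite (Hlt 0%nat) by lia; simpl; ring.
      * field; apply Cpow_nz, Cminus_neq_0; auto.
Qed.

(** Near [z] the cofactor stays between half and twice the modulus of its value at [z]. Orders can
    then be compared through moduli alone. *)
Lemma zero_of_order_growth (f : C -> C) (z : C) (m : nat) : zero_of_order f z m ->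
  exists c K d, 0 < c /\ 0 < d /\ forall w, Cmod (w - z) < d ->
    c * Cmod (w - z) ^ m <= Cmod (f w) <= K * Cmod (w - z) ^ m.
Proof.
  intros (g & Hg & Hgz & r & Hr & H).
  assert (Hp : 0 < Cmod (g z)) by (apply Cmod_gt_0; auto).
  destruct (analytic_at_cont g z Hg (Cmod (g z) / 2) ltac:(lra)) as (d & Hd & Hc).
  exists (Cmod (g z) / 2), (2 * Cmod (g z)), (Rmin r d).
  split; [lra|split; [apply Rmin_glb_lt; auto|]].
  intros w Hw.
  rewrite H by (eapply Rlt_le_trans; [exact Hw|apply Rmin_l]).
  assert (Hcw := Hc w ltac:(eapply Rlt_le_trans; [exact Hw|apply Rmin_r])).
  rewrite Cmod_mult, Cmod_pow.
  pose proof (Cmod_ge_sub (g w) (g z)); pose proof (Cmod_ge_sub (g z) (g w)).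
  rewrite Cmod_sub_comm in H1.
  pose proof (pow_le (Cmod (w - z)) m (Cmod_ge_0 _)).
  split; rewrite (Rmult_comm _ (Cmod (w - z) ^ m)); apply Rmult_le_compat_l; lra.
Qed.

Lemma zero_of_order_isolated (f : C -> C) (z : C) (m : nat) : zero_of_order f z m ->
  exists d, 0 < d /\ forall w, Cmod (w - z) < d -> w <> z -> f w <> 0%C.
Proof.
  intros H; destruct (zero_of_order_growth f z m H) as (c & K & d & Hc & Hd & Hg).
  exists d; split; auto; intros w Hw Hwz E.
  destruct (Hg w Hw) as [H1 _]; rewrite E, Cmod_0 in H1.
  assert (0 < Cmod (w - z) ^ m) by (apply pow_lt, Cmod_gt_0, Cminus_neq_0; auto).
  nra.
Qed.

(** If [m < n], dividing by [x^m] leaves [c <= K x] for all small [x < 1], which fails near [0]. *)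
Lemma growth_exponent_le (m n : nat) (c K d : R) : 0 < c -> 0 < d ->
  (forall x, 0 < x < d -> c * x ^ m <= K * x ^ n) -> (n <= m)%nat.
Proof.
  intros Hc Hd H; apply Nat.nlt_ge; intros Hlt.
  (* Chosen so that [K x <= c / 2]. *)
  set (x := Rmin (d / 2) (c / (2 * (Rabs K + 1)))).
  pose proof (Rabs_pos K); pose proof (Rle_abs K).
  assert (Hx : 0 < x) by (unfold x; apply Rmin_glb_lt; [lra|apply Rdiv_lt_0_compat; lra]).
  assert (Hx1 : x <= d / 2) by apply Rmin_l.
  assert (Hx2 : x <= c / (2 * (Rabs K + 1))) by apply Rmin_r.
  apply Rle_div_r in Hx2; [|lra].
  assert (Hle1 : forall y, 0 < y -> y < d -> y < 1 -> c <= K * y).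
  { intros y Hy1 Hy2 Hy3; specialize (H y (conj Hy1 Hy2)).
    replace n with (m + (n - m))%nat in H by lia; rewrite pow_add in H.
    assert (Hy : y ^ (n - m) <= y).
    { destruct (n - m)%nat as [|k] eqn:E; [lia|].
      assert (y ^ k <= 1) by (rewrite <- (pow1 k); apply pow_incr; lra).
      simpl; nra. }
    assert (Hpm : 0 < y ^ m) by (apply pow_lt; auto).
    assert (Hpn : 0 < y ^ (n - m)) by (apply pow_lt; auto).
    assert (c <= K * y ^ (n - m)).
    { apply Rmult_le_reg_r with (y ^ m); auto; nra. }
    assert (0 < K) by (destruct (Rle_lt_dec K 0); auto; nra).
    nra. }
  (* The cap [1/2] ensures [y < 1], so that [y^(n-m) <= y]. *)
  set (y := Rmin x (1 / 2)).
  assert (Hy : 0 < y) by (unfold y; apply Rmin_glb_lt; lra).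
  assert (y <= x) by apply Rmin_l. assert (y <= 1 / 2) by apply Rmin_r.
  specialize (Hle1 y Hy ltac:(lra) ltac:(lra)).
  nra.
Qed.

(** Only distances and moduli enter, so [phi] may be antiholomorphic: it is used with the identity
    and with the reflection in the critical line. *)
Lemma zero_of_order_transfer (f g : C -> C) (z1 z2 : C) (phi : C -> C) (m n : nat) (c d K : R) :
  0 < c -> 0 < d ->
  (forall w, Cmod (phi w - z2) = Cmod (w - z1)) ->
  (forall w, Cmod (w - z1) < d -> c * Cmod (f w) <= Cmod (g (phi w)) <= K * Cmod (f w)) ->
  zero_of_order f z1 m -> zero_of_order g z2 n -> m = n.
Proof.
  intros Hc Hd Hphi Hfg Hf Hg.
  destruct (zero_of_order_growth f z1 m Hf) as (c1 & K1 & d1 & Hc1 & Hd1 & H1).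
  destruct (zero_of_order_growth g z2 n Hg) as (c2 & K2 & d2 & Hc2 & Hd2 & H2).
  set (e := Rmin d (Rmin d1 d2)).
  assert (He : 0 < e) by (unfold e; repeat apply Rmin_glb_lt; auto).
  assert (Hed : e <= d) by apply Rmin_l.
  assert (He1 : e <= d1) by (eapply Rle_trans; [apply Rmin_r|apply Rmin_l]).
  assert (He2 : e <= d2) by (eapply Rle_trans; [apply Rmin_r|apply Rmin_r]).
  assert (Hpt : forall x, 0 < x < e -> exists w, Cmod (w - z1) = x).
  { intros x Hx; exists (z1 + RtoC x)%C.
    replace (z1 + RtoC x - z1)%C with (RtoC x) by ring; rewrite Cmod_R; apply Rabs_right; lra. }
  apply Nat.le_antisymm.
  - apply (growth_exponent_le n m c2 (Rabs K * Rabs K1) e); auto.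
    intros x Hx; destruct (Hpt x Hx) as [w Hw].
    specialize (H1 w ltac:(lra)); specialize (Hfg w ltac:(lra)).
    specialize (H2 (phi w)); rewrite Hphi in H2; specialize (H2 ltac:(lra)).
    rewrite Hw in *.
    pose proof (Cmod_ge_0 (f w)); pose proof (pow_le x m ltac:(lra)).
    pose proof (Rle_abs K); pose proof (Rle_abs K1); pose proof (Rabs_pos K).
    assert (K * Cmod (f w) <= Rabs K * (Rabs K1 * x ^ m)).
    { apply Rle_trans with (Rabs K * Cmod (f w)); [nra|].
      apply Rmult_le_compat_l; auto; apply Rle_trans with (K1 * x ^ m); [lra|nra]. }
    lra.
  - apply (growth_exponent_le m n (c * c1) K2 e); auto; [nra|].
    intros x Hx; destruct (Hpt x Hx) as [w Hw].
    specialize (H1 w ltac:(lra)); specialize (Hfg w ltac:(lra)).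
    specialize (H2 (phi w)); rewrite Hphi in H2; specialize (H2 ltac:(lra)).
    rewrite Hw in *.
    assert (c * (c1 * x ^ m) <= c * Cmod (f w)) by (apply Rmult_le_compat_l; lra).
    lra.
Qed.

Lemma zero_of_order_unique (f : C -> C) (z : C) (m n : nat) :
  zero_of_order f z m -> zero_of_order f z n -> m = n.
Proof.
  apply (zero_of_order_transfer f f z z (fun w => w) m n 1 1 1); try lra; auto.
  intros w _; lra.
Qed.

Lemma analytic_at_plus (f g : C -> C) (z : C) :
  analytic_at f z -> analytic_at g z -> analytic_at (fun w => f w + g w)%C z.
Proof.
  intros (a & r & Hr & H) (b & r' & Hr' & H').
  exists (PS_plus (K := C_AbsRing) (V := C_NormedModule) a b), (Rmin r r'); split; [apply Rmin_glb_lt; auto|].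
  intros w Hw.
  apply (is_pseries_plus (K := C_AbsRing) (V := C_NormedModule)).
  - apply H; eapply Rlt_le_trans; [exact Hw|apply Rmin_l].
  - apply H'; eapply Rlt_le_trans; [exact Hw|apply Rmin_r].
Qed.

Lemma analytic_at_scal (f : C -> C) (k z : C) :
  analytic_at f z -> analytic_at (fun w => k * f w)%C z.
Proof.
  intros (a & r & Hr & H).
  exists (PS_scal (K := C_AbsRing) (V := C_NormedModule) k a), r; split; auto.
  intros w Hw.
  apply (is_pseries_scal (K := C_AbsRing) (V := C_NormedModule)); auto.
  apply Cmult_comm.
Qed.

Lemma analytic_at_ext (f g : C -> C) (z : C) :
  (forall w, f w = g w) -> analytic_at f z -> analytic_at g z.
Proof. intros H; apply (analytic_at_ext_loc f g z 1); auto; lra. Qed.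

Lemma analytic_at_minus (f g : C -> C) (z : C) :
  analytic_at f z -> analytic_at g z -> analytic_at (fun w => f w - g w)%C z.
Proof.
  intros Hf Hg; apply (analytic_at_ext (fun w => f w + (- (1)) * g w)%C); [intros w; ring|].
  apply analytic_at_plus, analytic_at_scal; auto.
Qed.

(** Writing [w + c = (w - z) + (z + c)] reduces the product to a shift of coefficients and a scalar
    multiple, without Cauchy products. *)
Lemma analytic_at_mult_linear (f : C -> C) (c z : C) :
  analytic_at f z -> analytic_at (fun w => (w + c) * f w)%C z.
Proof.
  intros Hf.
  apply (analytic_at_ext (fun w => (w - z) * f w + (z + c) * f w)%C); [intros w; ring|].
  apply analytic_at_plus; [|apply analytic_at_scal; auto].
  destruct Hf as (a & r & Hr & H).
  exists (PS_incr_1 (K := C_AbsRing) (V := C_NormedModule) a), r; split; auto.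
  intros w Hw.
  apply (is_pseries_incr_1 (K := C_AbsRing) (V := C_NormedModule)); auto.
Qed.

Lemma analytic_at_const (k z : C) : analytic_at (fun _ => k) z.
Proof.
  exists (fun n => match n with O => k | S _ => RtoC 0 end), 1; split; [lra|]; intros w _.
  apply (filterlim_ext (fun _ => k)); [|apply filterlim_const].
  intros n; induction n as [|n IH].
  - rewrite sum_O; change (k = pow_n ((w - z)%C : C_Ring) 0 * k)%C; simpl; change (k = 1 * k)%C; ring.
  - rewrite sum_Sn, <- IH; change (k = k + pow_n ((w - z)%C : C_Ring) (S n) * 0)%C; ring.
Qed.

Lemma analytic_at_translate (f : C -> C) (c z : C) :
  analytic_at f (z + c)%C -> analytic_at (fun w => f (w + c)%C) z.
Proof.
  intros (a & r & Hr & H); exists a, r; split; auto; intros w Hw.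
  replace (w - z)%C with (w + c - (z + c))%C by ring; apply H.
  replace (w + c - (z + c))%C with (w - z)%C by ring; auto.
Qed.

Lemma Cgeom_series (q : C) : Cmod q < 1 -> is_Cseries (fun n => (q ^ n)%C) (/ (1 - q))%C.
Proof.
  intros Hq.
  assert (Hq1 : (1 - q)%C <> 0%C).
  { intros E; assert (q = 1)%C by (replace q with (1 - (1 - q))%C by ring; rewrite E; ring).
    subst; rewrite Cmod_1 in Hq; lra. }
  apply (filterlim_C_iff eventually); intros eps He.
  assert (Hp : 0 < Cmod (1 - q)) by (apply Cmod_gt_0; auto).
  destruct (pow_lt_1_zero (Cmod q) ltac:(rewrite Rabs_right; [auto|apply Rle_ge, Cmod_ge_0])
    (eps * Cmod (1 - q)) ltac:(nra)) as [N HN].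
  exists N; intros n Hn.
  assert (E : (@sum_n C_Ring (fun n => q ^ n) n = (1 - q ^ (S n)) / (1 - q))%C).
  { clear -Hq1; induction n as [|n IH].
    - rewrite sum_O; simpl; field; auto.
    - rewrite sum_Sn, IH; change ((1 - q ^ S n) / (1 - q) + q ^ S n = (1 - q ^ S (S n)) / (1 - q))%C.
      simpl; field; auto. }
  change (Cmod (@sum_n C_Ring (fun n => (q ^ n)%C) n - / (1 - q)) < eps).
  rewrite E.
  replace ((1 - q ^ S n) / (1 - q) - / (1 - q))%C with (- (q ^ S n) / (1 - q))%C by (field; auto).
  rewrite Cmod_div, Cmod_opp, Cmod_pow by auto.
  apply Rlt_div_l; auto.
  eapply Rle_lt_trans; [apply Rle_abs|apply HN; lia].
Qed.

(** Geometric series in [q = - (w - z) / (z - c)], convergent in the disc reaching to the pole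
    [c]. *)
Lemma analytic_at_inv (c z : C) : z <> c -> analytic_at (fun w => / (w - c))%C z.
Proof.
  intros Hz; assert (Hzc := Cminus_neq_0 _ _ Hz).
  exists (fun k => (/ (z - c) * (- / (z - c)) ^ k)%C), (Cmod (z - c)).
  split; [apply Cmod_gt_0; auto|].
  intros w Hw.
  set (q := (- / (z - c) * (w - z))%C).
  assert (Hq : Cmod q < 1).
  { unfold q; rewrite Cmod_mult, Cmod_opp, Cmod_inv by auto.
    rewrite Rmult_comm; apply Rlt_div_l; [apply Cmod_gt_0; auto|lra]. }
  assert (Hwc : (w - c)%C <> 0%C).
  { intros E; assert (E' : (w - z = - (z - c))%C) by (replace w with (w - c + c)%C by ring; rewrite E; ring).
    rewrite E', Cmod_opp in Hw; lra. }
  assert (Hq1 : (1 - q)%C <> 0%C).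
  { replace (1 - q)%C with ((w - c) / (z - c))%C by (unfold q; field; auto).
    intros E; apply Hwc; replace (w - c)%C with ((w - c) / (z - c) * (z - c))%C by (field; auto).
    rewrite E; ring. }
  replace (/ (w - c))%C with (/ (z - c) * / (1 - q))%C.
  - apply (is_series_ext (K := C_AbsRing) (V := C_NormedModule)
      (fun n => scal (/ (z - c) : C_AbsRing)%C (q ^ n : C_NormedModule)%C)).
    + intros n; change (/ (z - c) * q ^ n = pow_n ((w - z)%C : C_Ring) n * (/ (z - c) * (- / (z - c)) ^ n))%C.
      rewrite (pow_n_Cpow (w - z) n); unfold q; rewrite Cpow_mult_l; ring.
    + apply (is_series_scal (K := C_AbsRing) (V := C_NormedModule)), Cgeom_series; auto.
  - unfold q; field; auto.
Qed.

(** Continuation along the segment: let [m] be the supremum of the parameters up to which [h]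
    vanishes locally. A zero of finite order at [g m] would be isolated, against the vanishing just
    before [m]; so [h] vanishes near [g m], and [m < 1] is impossible. *)
Lemma locally_zero_segment (h : C -> C) (z0 z1 : C) :
  (forall tau, 0 <= tau <= 1 -> analytic_at h (z0 + RtoC tau * (z1 - z0))%C) ->
  locally_zero h z0 -> locally_zero h z1.
Proof.
  intros Ha H0.
  destruct (classic (z0 = z1)) as [<-|Hne]; auto.
  set (L := Cmod (z1 - z0)).
  assert (HL : 0 < L) by (apply Cmod_gt_0, Cminus_neq_0; auto).
  set (g := fun tau : R => (z0 + RtoC tau * (z1 - z0))%C) in *.
  assert (Hd : forall s t, Cmod (g s - g t) = Rabs (s - t) * L).
  { intros s t; unfold g, L; rewrite <- (Cmod_R (s - t)), <- Cmod_mult, RtoC_minus; f_equal; ring. }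
  set (E := fun tau => 0 <= tau <= 1 /\ forall s, 0 <= s <= tau -> locally_zero h (g s)).
  assert (Hg0 : g 0 = z0) by (unfold g; ring).
  assert (Hg1 : g 1 = z1) by (unfold g; ring).
  assert (HE0 : E 0).
  { split; [lra|]; intros s Hs; replace s with 0 by lra; rewrite Hg0; auto. }
  destruct (completeness E) as [m [Hub Hlub]].
  { exists 1; intros x [Hx _]; lra. }
  { exists 0; auto. }
  assert (Hm : 0 <= m <= 1).
  { split; [apply Hub; auto|apply Hlub; intros x [Hx _]; lra]. }
  assert (Hbelow : forall s, 0 <= s < m -> locally_zero h (g s)).
  { intros s Hs; apply NNPP; intros Hn.
    assert (m <= s); [|lra].
    apply Hlub; intros x [Hx Hx']; apply Rnot_lt_le; intros Hlt; apply Hn, Hx'; lra. }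
  assert (Hz : locally_zero h (g m)).
  { destruct (analytic_dichotomy h (g m) (Ha m Hm)) as [|[k Hk]]; auto.
    destruct (Req_dec m 0) as [->|Hm0]; [rewrite Hg0; auto|].
    destruct (zero_of_order_isolated _ _ _ Hk) as (d & Hdp & Hiso).
    (* A point before [m] on the segment, at distance at most [d / 2] from [g m]. *)
    set (s := m - Rmin m (d / (2 * L))).
    assert (Hmin : 0 < Rmin m (d / (2 * L))).
    { apply Rmin_glb_lt; [lra|apply Rdiv_lt_0_compat; lra]. }
    pose proof (Rmin_l m (d / (2 * L))); pose proof (Rmin_r m (d / (2 * L))) as Hr.
    apply Rle_div_r in Hr; [|lra].
    destruct (Hbelow s ltac:(unfold s; lra)) as (r & Hrp & Hr0).
    exfalso; apply (Hiso (g s)).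
    - rewrite Hd; unfold s; rewrite Rabs_left by lra; lra.
    - intros Eq; assert (Hc : Cmod (g s - g m) = 0).
      { rewrite Eq; replace (g m - g m)%C with (RtoC 0) by ring; apply Cmod_0. }
      rewrite Hd in Hc; unfold s in Hc; rewrite Rabs_left in Hc by lra; nra.
    - apply Hr0; replace (g s - g s)%C with (RtoC 0) by ring; rewrite Cmod_0; auto. }
  destruct (Req_dec m 1) as [->|Hm1]; [rewrite <- Hg1; auto|].
  exfalso.
  destruct Hz as (r & Hr & Hr0).
  set (e := Rmin (1 - m) (r / (2 * L))).
  assert (He : 0 < e) by (unfold e; apply Rmin_glb_lt; [lra|apply Rdiv_lt_0_compat; lra]).
  assert (He1 : e <= 1 - m) by apply Rmin_l.
  assert (He2 : e <= r / (2 * L)) by apply Rmin_r.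
  apply Rle_div_r in He2; [|lra].
  assert (E (m + e)); [|pose proof (Hub _ H); lra].
  split; [lra|]; intros s Hs.
  destruct (Rlt_le_dec s m) as [Hsm|Hsm]; [apply Hbelow; lra|].
  exists (r / 2); split; [lra|]; intros w Hw; apply Hr0.
  eapply Rle_lt_trans; [apply (Cmod_triangle_sub w (g m) (g s))|].
  rewrite Hd, Rabs_right by lra; nra.
Qed.

Definition agree_near (f g : C -> C) (z : C) : Prop := locally_zero (fun w => f w - g w)%C z.

Lemma agree_near_eq (f g : C -> C) (z : C) : agree_near f g z -> f z = g z.
Proof.
  intros (r & Hr & H).
  replace (f z) with ((f z - g z) + g z)%C by ring; rewrite H; [ring|].
  replace (z - z)%C with (RtoC 0) by ring; rewrite Cmod_0; auto.
Qed.

Lemma identity_segment (f g : C -> C) (z0 z1 : C) :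
  (forall tau, 0 <= tau <= 1 -> analytic_at f (z0 + RtoC tau * (z1 - z0))%C /\
                              analytic_at g (z0 + RtoC tau * (z1 - z0))%C) ->
  agree_near f g z0 -> agree_near f g z1.
Proof.
  intros H; apply locally_zero_segment; intros tau Ht; apply analytic_at_minus; apply H; auto.
Qed.

Lemma agree_near_half_plane (f g : C -> C) (a : R) (z : C) :
  (forall w, a < Re w -> f w = g w) -> a < Re z -> agree_near f g z.
Proof.
  intros H Hz; exists (Re z - a); split; [lra|]; intros w Hw.
  rewrite H; [ring|].
  pose proof (re_le_Cmod (w - z)) as H1.
  assert (Re (w - z) = Re w - Re z) as E by reflexivity.
  rewrite E in H1; apply Rabs_le_between in H1; lra.
Qed.

Lemma identity_half_plane (f g : C -> C) (a b : R) :
  (forall s, a < Re s -> analytic_at f s) -> (forall s, a < Re s -> analytic_at g s) ->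
  (forall s, b < Re s -> f s = g s) -> forall s, a < Re s -> f s = g s.
Proof.
  intros Hf Hg Heq s Hs; apply agree_near_eq.
  set (c := Rmax a b + 1).
  pose proof (Rmax_l a b); pose proof (Rmax_r a b).
  apply (identity_segment f g (RtoC c)).
  - intros tau Ht.
    assert (a < Re (RtoC c + RtoC tau * (s - RtoC c))%C).
    { replace (Re (RtoC c + RtoC tau * (s - RtoC c))%C) with ((1 - tau) * c + tau * Re s)
        by (unfold Re; simpl; ring).
      destruct (Req_dec tau 0) as [->|]; [unfold c; lra|].
      apply Rlt_le_trans with ((1 - tau) * a + tau * Re s); [nra|].
      apply Rplus_le_compat_r, Rmult_le_compat_l; unfold c; lra. }
    split; auto.
  - apply (agree_near_half_plane f g b); auto; simpl; unfold c; lra.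
Qed.

(** The plane without [1] is reached by segments avoiding [1]: horizontally from [2 + i Im s] when
    [s] is not real, then vertically down from [Re s + i] to a real [s]. *)
Lemma zeta_identity (f g : C -> C) :
  (forall s, s <> RtoC 1 -> analytic_at f s) -> (forall s, s <> RtoC 1 -> analytic_at g s) ->
  (forall s, 1 < Re s -> f s = g s) -> forall s, s <> RtoC 1 -> agree_near f g s.
Proof.
  intros Hf Hg Heq.
  assert (Hstep : forall z0 z1,
     (forall tau, 0 <= tau <= 1 -> (z0 + RtoC tau * (z1 - z0))%C <> RtoC 1) ->
     agree_near f g z0 -> agree_near f g z1).
  { intros z0 z1 H; apply identity_segment; intros tau Ht; split; auto. }
  assert (Hup : forall s, Im s <> 0 -> agree_near f g s).
  { intros s Hs; apply (Hstep (2, Im s)).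
    - intros tau Ht E; apply Hs.
      apply (f_equal snd) in E; simpl in E; unfold Im in *; lra.
    - apply (agree_near_half_plane f g 1); auto; simpl; lra. }
  intros s Hs.
  destruct (Req_dec (Im s) 0) as [Hi|]; [|auto].
  apply (Hstep (Re s, 1)); [|apply Hup; simpl; lra].
  intros tau Ht E; apply Hs; apply Ceq.
  - apply (f_equal fst) in E; unfold Re, Im in *; simpl in *; rewrite <- E; ring_simplify; auto.
  - auto.
Qed.

(** * Complex-valued integrals of a real variable *)

Notation CV := C_R_CompleteNormedModule.
Notation is_derive_RC := (@is_derive R_AbsRing CV).
Notation continuous_RC := (@continuous R_UniformSpace CV).
Notation is_CInt_gen := (@is_RInt_gen CV).

Ltac continuous_by_derive :=
  apply (ex_derive_continuous (K := R_AbsRing) (V := R_NormedModule)); auto_derive.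

Lemma is_derive_C (f : R -> C) (x : R) (l : C) :
  is_derive (fun t => fst (f t)) x (fst l) -> is_derive (fun t => snd (f t)) x (snd l) ->
  is_derive_RC f x l.
Proof.
  intros H1 H2.
  apply (is_derive_ext (K := R_AbsRing) (V := CV)
    (fun t => plus (scal (fst (f t)) ((1, 0) : CV)) (scal (snd (f t)) ((0, 1) : CV)))).
  - intros t; apply Ceq; unfold plus, scal; simpl; unfold plus, scal; simpl; unfold mult; simpl; ring.
  - assert (E : l = plus (scal (fst l) ((1, 0) : CV)) (scal (snd l) ((0, 1) : CV))).
    { apply Ceq; unfold plus, scal; simpl; unfold plus, scal; simpl; unfold mult; simpl; ring. }
    rewrite E; apply (is_derive_plus (K := R_AbsRing) (V := CV)).
    + apply (is_derive_scal_l (K := R_AbsRing) (V := CV)); auto.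
    + apply (is_derive_scal_l (K := R_AbsRing) (V := CV)); auto.
Qed.

Lemma continuous_C (f : R -> C) (x : R) :
  continuous (fun t => fst (f t)) x -> continuous (fun t => snd (f t)) x -> continuous_RC f x.
Proof.
  intros H1 H2.
  apply (proj2 (filterlim_locally (U := CV) f (f x))); intros eps.
  generalize (proj1 (filterlim_locally _ _) H1 eps) (proj1 (filterlim_locally _ _) H2 eps).
  intros A B; generalize (filter_and _ _ A B); apply filter_imp; intros t [Ha Hb]; split; auto.
Qed.

Lemma continuous_RC_const (c : C) (x : R) : continuous_RC (fun _ => c) x.
Proof. apply (continuous_const (V := CV)). Qed.

Lemma is_derive_RC_const (c : C) (x : R) : is_derive_RC (fun _ => c) x (RtoC 0).
Proof. apply (is_derive_const (K := R_AbsRing) (V := CV)). Qed.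

Lemma continuous_RC_plus (f g : R -> C) (x : R) :
  continuous_RC f x -> continuous_RC g x -> continuous_RC (fun t => f t + g t)%C x.
Proof. apply (continuous_plus (V := CV)). Qed.

Lemma continuous_RC_minus (f g : R -> C) (x : R) :
  continuous_RC f x -> continuous_RC g x -> continuous_RC (fun t => f t - g t)%C x.
Proof. apply (continuous_minus (V := CV)). Qed.

Lemma continuous_C_fst (f : R -> C) (x : R) : continuous_RC f x -> continuous (fun t => fst (f t)) x.
Proof.
  intros H; apply (proj2 (filterlim_locally _ _)); intros eps.
  generalize (proj1 (filterlim_locally (U := CV) f (f x)) H eps); apply filter_imp; intros t [Ha Hb]; auto.
Qed.

Lemma continuous_C_snd (f : R -> C) (x : R) : continuous_RC f x -> continuous (fun t => snd (f t)) x.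
Proof.
  intros H; apply (proj2 (filterlim_locally _ _)); intros eps.
  generalize (proj1 (filterlim_locally (U := CV) f (f x)) H eps); apply filter_imp; intros t [Ha Hb]; auto.
Qed.

Lemma continuous_RtoC (f : R -> R) (x : R) : continuous f x -> continuous_RC (fun t => RtoC (f t)) x.
Proof. intros H; apply continuous_C; simpl; auto; apply continuous_const. Qed.

Lemma continuous_Cmult (f g : R -> C) (x : R) :
  continuous_RC f x -> continuous_RC g x -> continuous_RC (fun t => f t * g t)%C x.
Proof.
  intros Hf Hg; apply continuous_C; simpl.
  - apply (continuous_minus (V := R_NormedModule));
      apply (continuous_mult (K := R_AbsRing)); apply continuous_C_fst || apply continuous_C_snd; auto.
  - apply (continuous_plus (V := R_NormedModule));
      apply (continuous_mult (K := R_AbsRing)); apply continuous_C_fst || apply continuous_C_snd; auto.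
Qed.

Lemma is_derive_RtoC (f : R -> R) (x l : R) :
  is_derive f x l -> is_derive_RC (fun t => RtoC (f t)) x (RtoC l).
Proof. intros H; apply is_derive_C; simpl; auto; apply (is_derive_const (V := R_NormedModule)). Qed.

Lemma is_derive_C_fst (f : R -> C) (x : R) (l : C) :
  is_derive_RC f x l -> is_derive (fun t => fst (f t)) x (fst l).
Proof.
  intros H; apply (filterdiff_ext_lin _ (fun y : R => fst (scal y (l : CV)))); [|intros y; reflexivity].
  apply (filterdiff_comp (U := R_NormedModule) (V := CV) (W := R_NormedModule) f
    (fun z : CV => fst z) (fun y => scal y (l : CV)) (fun z : CV => fst z)); [exact H|].
  apply (filterdiff_linear (U := CV) (V := R_NormedModule)), (is_linear_fst (U := R_NormedModule) (V := R_NormedModule)).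
Qed.

Lemma is_derive_C_snd (f : R -> C) (x : R) (l : C) :
  is_derive_RC f x l -> is_derive (fun t => snd (f t)) x (snd l).
Proof.
  intros H; apply (filterdiff_ext_lin _ (fun y : R => snd (scal y (l : CV)))); [|intros y; reflexivity].
  apply (filterdiff_comp (U := R_NormedModule) (V := CV) (W := R_NormedModule) f
    (fun z : CV => snd z) (fun y => scal y (l : CV)) (fun z : CV => snd z)); [exact H|].
  apply (filterdiff_linear (U := CV) (V := R_NormedModule)), (is_linear_snd (U := R_NormedModule) (V := R_NormedModule)).
Qed.

Lemma is_derive_Cmult (f g : R -> C) (x : R) (f' g' : C) :
  is_derive_RC f x f' -> is_derive_RC g x g' ->
  is_derive_RC (fun t => f t * g t)%C x (f' * g x + f x * g')%C.
Proof.
  intros Hf Hg.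
  pose proof (is_derive_C_fst _ _ _ Hf); pose proof (is_derive_C_snd _ _ _ Hf).
  pose proof (is_derive_C_fst _ _ _ Hg); pose proof (is_derive_C_snd _ _ _ Hg).
  apply is_derive_C; simpl.
  - replace (fst f' * fst (g x) - snd f' * snd (g x) + (fst (f x) * fst g' - snd (f x) * snd g'))
      with ((fst f' * fst (g x) + fst (f x) * fst g') - (snd f' * snd (g x) + snd (f x) * snd g')) by ring.
    apply (is_derive_minus (V := R_NormedModule)); apply (is_derive_mult (K := R_AbsRing)); auto; apply Rmult_comm.
  - replace (fst f' * snd (g x) + snd f' * fst (g x) + (fst (f x) * snd g' + snd (f x) * fst g'))
      with ((fst f' * snd (g x) + fst (f x) * snd g') + (snd f' * fst (g x) + snd (f x) * fst g')) by ring.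
    apply (is_derive_plus (V := R_NormedModule)); apply (is_derive_mult (K := R_AbsRing)); auto; apply Rmult_comm.
Qed.

Lemma is_RInt_C (f : R -> C) (a b : R) (l : C) :
  is_RInt (fun t => fst (f t)) a b (fst l) -> is_RInt (fun t => snd (f t)) a b (snd l) ->
  @is_RInt CV f a b l.
Proof.
  intros H1 H2; rewrite (surjective_pairing l).
  apply (is_RInt_fct_extend_pair (U := R_NormedModule) (V := R_NormedModule)); auto.
Qed.

Lemma is_RInt_C_fst (f : R -> C) (a b : R) (l : C) :
  @is_RInt CV f a b l -> is_RInt (fun t => fst (f t)) a b (fst l).
Proof. apply (is_RInt_fct_extend_fst (U := R_NormedModule) (V := R_NormedModule)). Qed.

Lemma is_RInt_C_snd (f : R -> C) (a b : R) (l : C) :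
  @is_RInt CV f a b l -> is_RInt (fun t => snd (f t)) a b (snd l).
Proof. apply (is_RInt_fct_extend_snd (U := R_NormedModule) (V := R_NormedModule)). Qed.

Lemma is_RInt_Cscal (c : C) (f : R -> C) (a b : R) (l : C) :
  @is_RInt CV f a b l -> @is_RInt CV (fun t => c * f t)%C a b (c * l)%C.
Proof.
  intros H; pose proof (is_RInt_C_fst _ _ _ _ H); pose proof (is_RInt_C_snd _ _ _ _ H).
  apply is_RInt_C; simpl.
  - apply (is_RInt_minus (V := R_NormedModule)); apply (is_RInt_scal (V := R_NormedModule)); auto.
  - apply (is_RInt_plus (V := R_NormedModule)); apply (is_RInt_scal (V := R_NormedModule)); auto.
Qed.

Lemma is_RInt_Cconj (f : R -> C) (a b : R) (l : C) :
  @is_RInt CV f a b l -> @is_RInt CV (fun t => Cconj (f t)) a b (Cconj l).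
Proof.
  intros H; apply is_RInt_C; simpl.
  - apply is_RInt_C_fst; auto.
  - apply (is_RInt_opp (V := R_NormedModule)), is_RInt_C_snd; auto.
Qed.

(** Common source of the rules for complex scaling, conjugation and the real part of an improper
    integral. *)
Lemma is_RInt_gen_map {V W : NormedModule R_AbsRing} (Fa Fb : (R -> Prop) -> Prop)
  {FFa : Filter Fa} {FFb : Filter Fb} (T : V -> W) (f : R -> V) (g : R -> W) (l : V) :
  (forall a b y, is_RInt f a b y -> is_RInt g a b (T y)) ->
  filterlim T (locally l) (locally (T l)) ->
  is_RInt_gen f Fa Fb l -> is_RInt_gen g Fa Fb (T l).
Proof.
  intros HT Hc H P HP.
  specialize (H _ (Hc P HP)); revert H; unfold filtermapi; apply filter_imp.
  intros [a b] (y & Hy & Py); exists (T y); split; auto; apply HT; auto.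
Qed.

Lemma is_CInt_gen_scal (Fa Fb : (R -> Prop) -> Prop) {FFa : Filter Fa} {FFb : Filter Fb}
  (c : C) (f : R -> C) (l : C) :
  is_CInt_gen f Fa Fb l -> is_CInt_gen (fun t => c * f t)%C Fa Fb (c * l)%C.
Proof.
  apply (is_RInt_gen_map (V := CV) (W := CV) Fa Fb (fun z : C => (c * z)%C : C)).
  - intros a b y; apply is_RInt_Cscal.
  - apply (filterlim_C_iff (T := C)); [apply locally_filter|]; intros eps He.
    pose proof (Cmod_ge_0 c).
    assert (Hp : 0 < eps / (Cmod c + 1)) by (apply Rdiv_lt_0_compat; lra).
    generalize (proj1 (filterlim_C_iff (T := C) (locally (l : CV)) (fun z => z) l) (filterlim_id _ _) _ Hp).
    apply filter_imp; intros z Hz.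
    replace (c * z - c * l)%C with (c * (z - l))%C by ring; rewrite Cmod_mult.
    apply Rlt_div_r in Hz; [|lra]; pose proof (Cmod_ge_0 (z - l)); nra.
Qed.

Lemma is_CInt_gen_conj (Fa Fb : (R -> Prop) -> Prop) {FFa : Filter Fa} {FFb : Filter Fb}
  (f : R -> C) (l : C) :
  is_CInt_gen f Fa Fb l -> is_CInt_gen (fun t => Cconj (f t)) Fa Fb (Cconj l).
Proof.
  apply (is_RInt_gen_map (V := CV) (W := CV) Fa Fb (fun z : C => Cconj z : C)).
  - intros a b y; apply is_RInt_Cconj.
  - apply (filterlim_C_iff (T := C)); [apply locally_filter|]; intros eps He.
    generalize (proj1 (filterlim_C_iff (T := C) (locally (l : CV)) (fun z => z) l) (filterlim_id _ _) _ He).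
    apply filter_imp; intros z Hz.
    rewrite <- Cminus_conj, Cmod_conj; auto.
Qed.

Lemma is_CInt_gen_Re (Fa Fb : (R -> Prop) -> Prop) {FFa : Filter Fa} {FFb : Filter Fb}
  (f : R -> C) (l : C) :
  is_CInt_gen f Fa Fb l -> is_RInt_gen (fun t => Re (f t)) Fa Fb (Re l).
Proof.
  apply (is_RInt_gen_map (V := CV) (W := R_NormedModule) Fa Fb (fun z : C => Re z)).
  - intros a b y; apply is_RInt_C_fst.
  - destruct l as [x y]; apply (continuous_fst (U := R_UniformSpace) (V := R_UniformSpace) x y).
Qed.

(* [D] plays the role of the open interval whose ends are described by the filters. *)
Definition interval_pred (D : R -> Prop) : Prop :=
  forall a b x, D a -> D b -> a <= x <= b -> D x.

Lemma interval_pred_minmax (D : R -> Prop) (a b x : R) :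
  interval_pred D -> D a -> D b -> Rmin a b <= x <= Rmax a b -> D x.
Proof.
  intros HD Ha Hb; destruct (Rle_dec a b).
  - rewrite Rmin_left, Rmax_right by auto; apply HD; auto.
  - rewrite Rmin_right, Rmax_left by lra; apply HD; auto.
Qed.

Lemma is_RInt_gen_primitive {V : CompleteNormedModule R_AbsRing} (D : R -> Prop)
  (Fa Fb : (R -> Prop) -> Prop) {FFa : Filter Fa} {FFb : Filter Fb} (f F : R -> V) (A B : V) :
  interval_pred D -> Fa D -> Fb D ->
  (forall x, D x -> is_derive F x (f x)) -> (forall x, D x -> continuous f x) ->
  filterlim F Fa (locally A) -> filterlim F Fb (locally B) ->
  is_RInt_gen f Fa Fb (minus B A).
Proof.
  intros HD Da Db Hd Hc HA HB.
  apply (filterlimi_lim_ext_loc (fun ab : R * R => minus (F (snd ab)) (F (fst ab)))).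
  - exists D D; auto; intros a b Ha Hb; simpl.
    apply (is_RInt_derive (V := V)); intros x Hx.
    + apply Hd, (interval_pred_minmax D a b); auto.
    + apply Hc, (interval_pred_minmax D a b); auto.
  - apply (filterlim_comp_2 (F := filter_prod Fa Fb) (G := locally B) (H := locally (opp A)) (fun ab => F (snd ab)) (fun ab => opp (F (fst ab))) plus).
    + apply (filterlim_comp _ _ _ snd F _ Fb); auto; apply filterlim_snd.
    + apply (filterlim_comp _ _ _ (fun ab => F (fst ab)) opp _ (locally A)).
      * apply (filterlim_comp _ _ _ fst F _ Fa); auto; apply filterlim_fst.
      * apply (filterlim_opp (V := V)).
    + apply (filterlim_plus (V := V)).
Qed.

Lemma is_RInt_gen_RInt_lim {V : CompleteNormedModule R_AbsRing}
  (Fa Fb : (R -> Prop) -> Prop) {FFa : Filter Fa} {FFb : Filter Fb} (f : R -> V) (l : V) :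
  is_RInt_gen f Fa Fb l ->
  filterlim (fun ab => RInt f (fst ab) (snd ab)) (filter_prod Fa Fb) (locally l).
Proof.
  intros H P HP; specialize (H P HP); revert H; unfold filtermapi, filtermap; apply filter_imp.
  intros [a b] (y & Hy & Py); rewrite (is_RInt_unique _ _ _ _ Hy); auto.
Qed.

Lemma is_RInt_gen_comp {V : CompleteNormedModule R_AbsRing} (D : R -> Prop)
  (Fa Fb Ga Gb : (R -> Prop) -> Prop) {FFa : Filter Fa} {FFb : Filter Fb}
  {FGa : Filter Ga} {FGb : Filter Gb}
  (f : R -> V) (phi dphi : R -> R) (l : V) :
  interval_pred D -> Fa D -> Fb D ->
  (forall x, D x -> is_derive phi x (dphi x)) -> (forall x, D x -> continuous dphi x) ->
  (forall x, D x -> continuous f (phi x)) ->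
  filterlim phi Fa Ga -> filterlim phi Fb Gb ->
  is_RInt_gen f Ga Gb l -> is_RInt_gen (fun x => scal (dphi x) (f (phi x))) Fa Fb l.
Proof.
  intros HD Da Db Hd Hcd Hc HA HB H.
  apply (filterlimi_lim_ext_loc (fun ab : R * R => RInt f (phi (fst ab)) (phi (snd ab)))).
  - exists D D; auto; intros a b Ha Hb; simpl.
    apply (is_RInt_comp (V := V)); intros x Hx; [apply Hc|split; [apply Hd|apply Hcd]];
      apply (interval_pred_minmax D a b); auto.
  - apply (filterlim_comp _ _ _ (fun ab : R * R => (phi (fst ab), phi (snd ab)))
      (fun ab => RInt f (fst ab) (snd ab)) _ (filter_prod Ga Gb)).
    + apply filterlim_pair.
      * apply (filterlim_comp _ _ _ fst phi _ Fa); auto; apply filterlim_fst.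
      * apply (filterlim_comp _ _ _ snd phi _ Fb); auto; apply filterlim_snd.
    + apply is_RInt_gen_RInt_lim; auto.
Qed.

(** Cauchy criterion: two integrals of [f] differ by the pieces between the lower and between the
    upper end points, and each piece is bounded by the corresponding integral of [g]. *)
Lemma ex_CInt_gen_dominated (D : R -> Prop) (Fa Fb : (R -> Prop) -> Prop)
  {FFa : ProperFilter Fa} {FFb : ProperFilter Fb} (f : R -> C) (g : R -> R) (Ig : R) :
  interval_pred D -> Fa D -> Fb D -> filter_prod Fa Fb (fun ab => fst ab <= snd ab) ->
  (forall x, D x -> continuous_RC f x) -> (forall x, D x -> continuous g x) ->
  (forall x, D x -> Cmod (f x) <= g x) ->
  is_RInt_gen g Fa Fb Ig ->
  exists l, is_CInt_gen f Fa Fb l /\ Cmod l <= Ig.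
Proof.
  intros HD Da Db Hab Hf Hgc Hg HI.
  assert (Exf : forall a b, D a -> D b -> ex_RInt (V := CV) f a b).
  { intros a b Ha Hb; apply (ex_RInt_continuous (V := CV)); intros x Hx.
    apply Hf, (interval_pred_minmax D a b); auto. }
  assert (Exg : forall a b, D a -> D b -> ex_RInt g a b).
  { intros a b Ha Hb; apply (ex_RInt_continuous (V := R_CompleteNormedModule)); intros x Hx.
    apply Hgc, (interval_pred_minmax D a b); auto. }
  assert (Hle : forall a b, D a -> D b -> Cmod (RInt (V := CV) f a b) <= Rabs (RInt g a b)).
  { assert (H1 : forall a b, a <= b -> D a -> D b -> Cmod (RInt (V := CV) f a b) <= RInt g a b).
    { intros a b Hlt Ha Hb; rewrite Cmod_norm.
      apply (norm_RInt_le (V := CV) f g a b); auto.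
      - intros x Hx; apply Rle_trans with (Cmod (f x)); [rewrite Cmod_norm; apply Rle_refl|apply Hg, (HD a b); auto].
      - apply (RInt_correct (V := CV)); auto.
      - apply (RInt_correct (V := R_CompleteNormedModule)); auto. }
    intros a b Ha Hb; destruct (Rle_dec a b) as [Hlt|Hlt].
    - eapply Rle_trans; [apply H1; auto|apply Rle_abs].
    - rewrite <- (opp_RInt_swap (V := CV) f), <- (opp_RInt_swap g) by auto.
      change (Cmod (- RInt (V := CV) f b a) <= Rabs (- RInt g b a)).
      rewrite Cmod_opp, Rabs_Ropp; eapply Rle_trans; [apply H1; auto; lra|apply Rle_abs]. }
  assert (Hlim := is_RInt_gen_RInt_lim (V := R_CompleteNormedModule) Fa Fb g Ig HI).
  destruct (proj1 (filterlim_locally_cauchy (U := CV) (F := filter_prod Fa Fb)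
     (fun ab => RInt (V := CV) f (fst ab) (snd ab)))) as [l Hl].
  { intros eps.
    assert (He : 0 < eps / 4) by (pose proof (cond_pos eps); lra).
    destruct (proj1 (filterlim_locally _ _) Hlim (mkposreal _ He)) as [Qa Qb HQa HQb HQ].
    exists (fun ab => (Qa (fst ab) /\ D (fst ab)) /\ (Qb (snd ab) /\ D (snd ab))); split.
    { exists (fun a => Qa a /\ D a) (fun b => Qb b /\ D b); auto; apply filter_and; auto. }
    intros [a b] [a' b'] [[Ha Da1] [Hb Db1]] [[Ha' Da2] [Hb' Db2]]; simpl in *.
    apply C_NormedModule_mixin_compat1.
    (* The intermediate pair [(a', b)] isolates each piece of the integral of [g] as a difference of
       two values close to [Ig]. *)
    pose proof (HQ a b Ha Hb) as B1; pose proof (HQ a' b Ha' Hb) as B2; pose proof (HQ a' b' Ha' Hb') as B3.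
    unfold ball in B1, B2, B3; simpl in B1, B2, B3; unfold AbsRing_ball, abs, minus, plus, opp in B1, B2, B3; simpl in B1, B2, B3.
    pose proof (RInt_Chasles (V := CV) f a' a b (Exf _ _ Da2 Da1) (Exf _ _ Da1 Db1)) as C1.
    pose proof (RInt_Chasles (V := CV) f a' b b' (Exf _ _ Da2 Db1) (Exf _ _ Db1 Db2)) as C2.
    pose proof (RInt_Chasles g a' a b (Exg _ _ Da2 Da1) (Exg _ _ Da1 Db1)) as C3.
    pose proof (RInt_Chasles g a' b b' (Exg _ _ Da2 Db1) (Exg _ _ Db1 Db2)) as C4.
    change (RInt (V := CV) f a' a + RInt (V := CV) f a b = RInt (V := CV) f a' b)%C in C1.
    change (RInt (V := CV) f a' b + RInt (V := CV) f b b' = RInt (V := CV) f a' b')%C in C2.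
    change (RInt g a' a + RInt g a b = RInt g a' b) in C3.
    change (RInt g a' b + RInt g b b' = RInt g a' b') in C4.
    change (Cmod (RInt (V := CV) f a' b' - RInt (V := CV) f a b) < eps).
    rewrite <- C2, <- C1.
    replace (RInt (V := CV) f a' a + RInt (V := CV) f a b + RInt (V := CV) f b b' - RInt (V := CV) f a b)%C
      with (RInt (V := CV) f a' a + RInt (V := CV) f b b')%C by ring.
    eapply Rle_lt_trans; [apply Cmod_triangle|].
    pose proof (Hle a' a Da2 Da1); pose proof (Hle b b' Db1 Db2).
    apply Rabs_lt_between in B1; apply Rabs_lt_between in B2; apply Rabs_lt_between in B3.
    assert (Rabs (RInt g a' a) < 2 * (eps / 4)) by (apply Rabs_lt_between; lra).
    assert (Rabs (RInt g b b') < 2 * (eps / 4)) by (apply Rabs_lt_between; lra).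
    lra. }
  assert (HIf : is_CInt_gen f Fa Fb l).
  { apply (filterlimi_lim_ext_loc (fun ab => RInt (V := CV) f (fst ab) (snd ab))); auto.
    exists D D; auto; intros a b Ha Hb; apply (RInt_correct (V := CV)); auto. }
  exists l; split; auto.
  rewrite Cmod_norm; apply (RInt_gen_norm (V := CV) (Fa := Fa) (Fb := Fb) f g); auto.
  exists D D; auto; intros a b Ha Hb x Hx; simpl in Hx.
  apply Rle_trans with (Cmod (f x)); [rewrite Cmod_norm; apply Rle_refl|apply Hg, (HD a b); auto].
Qed.

(** * Complex powers and the exponential series *)

Lemma Cexp_plus (z w : C) : Cexp (z + w) = (Cexp z * Cexp w)%C.
Proof.
  destruct z as [a b], w as [c d]; apply Ceq; unfold Cexp, Re, Im; simpl;
    rewrite exp_plus, ?cos_plus, ?sin_plus; ring.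
Qed.

Lemma Cexp_0 : Cexp 0%C = 1%C.
Proof. apply Ceq; unfold Cexp, Re, Im; simpl; rewrite exp_0, ?cos_0, ?sin_0; ring. Qed.

Lemma Cmod_Cexp (z : C) : Cmod (Cexp z) = exp (Re z).
Proof.
  unfold Cmod, Cexp; simpl.
  replace (exp (Re z) * cos (Im z) * (exp (Re z) * cos (Im z) * 1) +
     exp (Re z) * sin (Im z) * (exp (Re z) * sin (Im z) * 1))
    with (exp (Re z) * exp (Re z) * (Rsqr (sin (Im z)) + Rsqr (cos (Im z)))) by (unfold Rsqr; ring).
  rewrite sin2_cos2, Rmult_1_r; apply sqrt_square; left; apply exp_pos.
Qed.

Lemma Cexp_conj (z : C) : Cexp (Cconj z) = Cconj (Cexp z).
Proof.
  destruct z as [a b]; apply Ceq; unfold Cexp, Re, Im; simpl; rewrite ?cos_neg, ?sin_neg; ring.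
Qed.

Lemma Cexp_RtoC (x : R) : Cexp (RtoC x) = RtoC (exp x).
Proof. apply Ceq; unfold Cexp, Re, Im; simpl; rewrite ?cos_0, ?sin_0; ring. Qed.

Lemma Rpower_pos (x a : R) : 0 < Rpower x a.
Proof. apply exp_pos. Qed.

Lemma Cmod_Rcpow (x : R) (s : C) : Cmod (Rcpow x s) = Rpower x (Re s).
Proof.
  unfold Rcpow, Rpower; rewrite Cmod_Cexp; f_equal; destruct s; unfold Re; simpl; ring.
Qed.

Lemma Rcpow_plus (x : R) (s t : C) : Rcpow x (s + t) = (Rcpow x s * Rcpow x t)%C.
Proof. unfold Rcpow; rewrite <- Cexp_plus; f_equal; ring. Qed.

Lemma Rcpow_0 (x : R) : Rcpow x 0%C = 1%C.
Proof. unfold Rcpow; rewrite Cmult_0_l; apply Cexp_0. Qed.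

Lemma Rcpow_1_l (s : C) : Rcpow 1 s = 1%C.
Proof. unfold Rcpow; rewrite ln_1, Cmult_0_r; apply Cexp_0. Qed.

Lemma Rcpow_RtoC (x a : R) : Rcpow x (RtoC a) = RtoC (Rpower x a).
Proof. unfold Rcpow, Rpower; rewrite <- RtoC_mult; apply Cexp_RtoC. Qed.

Lemma Rcpow_1_r (x : R) : 0 < x -> Rcpow x 1%C = RtoC x.
Proof. intros H; rewrite Rcpow_RtoC, Rpower_1; auto. Qed.

Lemma Rcpow_mult_l (x y : R) (s : C) : 0 < x -> 0 < y ->
  Rcpow (x * y) s = (Rcpow x s * Rcpow y s)%C.
Proof. intros Hx Hy; unfold Rcpow; rewrite ln_mult, <- Cexp_plus, RtoC_plus; auto; f_equal; ring. Qed.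

Lemma Rcpow_inv_l (x : R) (s : C) : 0 < x -> Rcpow (/ x) s = Rcpow x (- s).
Proof. intros Hx; unfold Rcpow; rewrite ln_Rinv, RtoC_opp; auto; f_equal; ring. Qed.

Lemma Rcpow_conj (x : R) (s : C) : Rcpow x (Cconj s) = Cconj (Rcpow x s).
Proof.
  unfold Rcpow; rewrite <- Cexp_conj, Cmult_conj; f_equal; f_equal.
  apply Ceq; simpl; ring.
Qed.

Lemma Rcpow_neq_0 (x : R) (s : C) : Rcpow x s <> 0%C.
Proof. apply Cmod_gt_0; rewrite Cmod_Rcpow; apply Rpower_pos. Qed.

Lemma Rcpow_opp (x : R) (s : C) : (Rcpow x s * Rcpow x (- s))%C = 1%C.
Proof. rewrite <- Rcpow_plus, <- (Rcpow_0 x); f_equal; ring. Qed.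

Lemma Rcpow_minus_1 (x : R) (s : C) : 0 < x -> Rcpow x (s - 1) = (Rcpow x s * RtoC (/ x))%C.
Proof.
  intros Hx; unfold Cminus; rewrite Rcpow_plus; f_equal.
  rewrite <- RtoC_opp, Rcpow_RtoC, Rpower_Ropp, Rpower_1; auto.
Qed.

Lemma is_derive_Rcpow (x : R) (s : C) : 0 < x ->
  is_derive_RC (fun t => Rcpow t s) x (s * Rcpow x (s - 1))%C.
Proof.
  intros Hx; rewrite Rcpow_minus_1 by auto.
  destruct s as [a b]; apply is_derive_C; unfold Rcpow, Cexp, Re, Im; simpl.
  - auto_derive; [auto|]; unfold Rminus; field; lra.
  - auto_derive; [auto|]; unfold Rminus; field; lra.
Qed.

Lemma continuous_Rcpow (x : R) (s : C) : 0 < x -> continuous_RC (fun t => Rcpow t s) x.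
Proof.
  intros Hx; apply (ex_derive_continuous (K := R_AbsRing) (V := CV)).
  exists (s * Rcpow x (s - 1))%C; apply is_derive_Rcpow; auto.
Qed.

Lemma is_derive_Cexp_line (z : C) (t : R) :
  is_derive_RC (fun t => Cexp (RtoC t * z)) t (z * Cexp (RtoC t * z))%C.
Proof.
  destruct z as [a b]; apply is_derive_C; unfold Cexp, Re, Im; simpl.
  - auto_derive; [auto|]; unfold Rminus; ring.
  - auto_derive; [auto|]; unfold Rminus; ring.
Qed.

(** Integration of [H' = z h] from [0]. Each use raises the exponent of [t] by one, which drives the
    induction for the Taylor remainder. *)
Lemma linear_ode_bound (z : C) (H h : R -> C) (M : R) (n : nat) :
  (forall t, is_derive_RC H t (z * h t)%C) -> (forall t, continuous_RC h t) -> H 0 = 0%C ->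
  (forall t, 0 <= t <= 1 -> Cmod (h t) <= M * t ^ n) ->
  forall t, 0 <= t <= 1 -> Cmod (H t) <= Cmod z * M / INR (S n) * t ^ (S n).
Proof.
  intros Hd Hc H0 Hb t Ht.
  pose proof (is_RInt_derive (V := CV) H (fun t => (z * h t)%C) 0 t
    (fun x _ => Hd x)
    (fun x _ => continuous_Cmult (fun _ => z) h x (continuous_const (V := CV) z x) (Hc x))) as HI.
  rewrite H0 in HI; change (@is_RInt CV (fun t => (z * h t)%C) 0 t (H t - 0)%C) in HI.
  replace (H t - 0)%C with (H t) in HI by ring.
  rewrite Cmod_norm.
  apply (norm_RInt_le (V := CV) (fun t => (z * h t)%C) (fun t => Cmod z * M * t ^ n) 0 t); auto; [lra| |].
  - intros x Hx; apply Rle_trans with (Cmod (z * h x)); [rewrite Cmod_norm; apply Rle_refl|].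
    rewrite Cmod_mult, Rmult_assoc; apply Rmult_le_compat_l; [apply Cmod_ge_0|apply Hb; lra].
  - pose proof (is_RInt_derive (V := R_CompleteNormedModule)
      (fun t => Cmod z * M / INR (S n) * t ^ (S n)) (fun t => Cmod z * M * t ^ n) 0 t) as HR.
    assert (E : minus (Cmod z * M / INR (S n) * t ^ S n) (Cmod z * M / INR (S n) * 0 ^ S n)
                = Cmod z * M / INR (S n) * t ^ S n).
    { unfold minus, plus, opp; simpl plus; rewrite (pow_i (S n)) by lia; simpl; ring. }
    rewrite <- E; clear E.
    apply HR.
    + intros x _; auto_derive; [auto|].
      assert (INR (S n) <> 0) by (apply not_0_INR; lia).
      change (match n with O => 1 | S _ => INR n + 1 end) with (INR (S n)).
      change (Init.Nat.pred (S n)) with n; field; auto.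
    + intros x _; continuous_by_derive; auto.
Qed.

Definition Cexp_poly (N : nat) (z : C) : C :=
  @sum_n C_Ring (fun k => (z ^ k * RtoC (/ INR (fact k)))%C) N.

Lemma Cexp_poly_0 (z : C) : Cexp_poly 0 z = 1%C.
Proof. unfold Cexp_poly; rewrite sum_O; simpl; rewrite Rinv_1; ring. Qed.

Lemma Cexp_poly_S (N : nat) (z : C) :
  Cexp_poly (S N) z = (Cexp_poly N z + z ^ (S N) * RtoC (/ INR (fact (S N))))%C.
Proof. unfold Cexp_poly; rewrite sum_Sn; reflexivity. Qed.

Lemma is_derive_RC_plus (f g : R -> C) (x : R) (a b : C) :
  is_derive_RC f x a -> is_derive_RC g x b -> is_derive_RC (fun t => f t + g t)%C x (a + b)%C.
Proof. apply (is_derive_plus (K := R_AbsRing) (V := CV)). Qed.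

Lemma is_derive_RC_minus (f g : R -> C) (x : R) (a b : C) :
  is_derive_RC f x a -> is_derive_RC g x b -> is_derive_RC (fun t => f t - g t)%C x (a - b)%C.
Proof. apply (is_derive_minus (K := R_AbsRing) (V := CV)). Qed.

Lemma is_derive_Cpow_line (z : C) (n : nat) (t : R) :
  is_derive_RC (fun t => (RtoC t * z) ^ (S n))%C t (z * (RtoC (INR (S n)) * (RtoC t * z) ^ n))%C.
Proof.
  assert (H1 : is_derive_RC (fun t => RtoC t * z)%C t z).
  { pose proof (is_derive_Cmult (fun t => RtoC t) (fun _ => z) t 1 0
      (is_derive_RtoC (fun t => t) t 1 (is_derive_id (K := R_AbsRing) t))
      (is_derive_const (K := R_AbsRing) (V := CV) z t)) as H.
    simpl in H; replace (1 * z + RtoC t * 0)%C with z in H by ring; exact H. }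
  induction n as [|n IH].
  - replace (z * (RtoC (INR 1) * (RtoC t * z) ^ 0))%C with z by (simpl; ring).
    apply (is_derive_ext (K := R_AbsRing) (V := CV) (fun t => RtoC t * z)%C); auto.
    intros x; simpl; change ((RtoC x * z) = (RtoC x * z) * 1)%C; ring.
  - replace (z * (RtoC (INR (S (S n))) * (RtoC t * z) ^ S n))%C
      with (z * (RtoC t * z) ^ (S n) + (RtoC t * z) * (z * (RtoC (INR (S n)) * (RtoC t * z) ^ n)))%C.
    + apply (is_derive_Cmult (fun t => RtoC t * z)%C (fun t => (RtoC t * z) ^ S n)%C); auto.
    + rewrite (S_INR (S n)), RtoC_plus; simpl Cpow; ring.
Qed.

Lemma is_derive_Cexp_poly_line (z : C) (N : nat) (t : R) :
  is_derive_RC (fun t => Cexp_poly (S N) (RtoC t * z)) t (z * Cexp_poly N (RtoC t * z))%C.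
Proof.
  assert (Hterm : forall k, is_derive_RC
    (fun t => (RtoC t * z) ^ (S k) * RtoC (/ INR (fact (S k))))%C t
    (z * ((RtoC t * z) ^ k * RtoC (/ INR (fact k))))%C).
  { intros k.
    replace (z * ((RtoC t * z) ^ k * RtoC (/ INR (fact k))))%C
      with (z * (RtoC (INR (S k)) * (RtoC t * z) ^ k) * RtoC (/ INR (fact (S k)))
            + (RtoC t * z) ^ (S k) * 0)%C.
    - apply (is_derive_Cmult (fun t => (RtoC t * z) ^ S k)%C (fun _ => RtoC (/ INR (fact (S k))))); [apply is_derive_Cpow_line|].
      apply is_derive_RC_const.
    - change (fact (S k)) with (S k * fact k)%nat; rewrite mult_INR, Rinv_mult, RtoC_mult.
      assert (INR (S k) <> 0) by (apply not_0_INR; lia).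
      replace (RtoC (/ INR (S k))) with (/ RtoC (INR (S k)))%C by (symmetry; apply RtoC_inv; auto).
      field; apply RtoC_neq_0; auto. }
  induction N as [|N IH].
  - apply (is_derive_ext (K := R_AbsRing) (V := CV)
      (fun t => 1 + (RtoC t * z) ^ 1 * RtoC (/ INR (fact 1)))%C).
    + intros x; rewrite Cexp_poly_S, Cexp_poly_0; auto.
    + rewrite Cexp_poly_0.
      replace (z * 1)%C with (0 + z * ((RtoC t * z) ^ 0 * RtoC (/ INR (fact 0))))%C
        by (simpl; rewrite Rinv_1; ring).
      apply is_derive_RC_plus; [apply is_derive_RC_const|apply Hterm].
  - apply (is_derive_ext (K := R_AbsRing) (V := CV)
      (fun t => Cexp_poly (S N) (RtoC t * z) + (RtoC t * z) ^ (S (S N)) * RtoC (/ INR (fact (S (S N)))))%C).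
    + intros x; rewrite (Cexp_poly_S (S N)); auto.
    + rewrite Cexp_poly_S.
      replace (z * (Cexp_poly N (RtoC t * z) + (RtoC t * z) ^ S N * RtoC (/ INR (fact (S N)))))%C
        with (z * Cexp_poly N (RtoC t * z) + z * ((RtoC t * z) ^ S N * RtoC (/ INR (fact (S N)))))%C by ring.
      apply is_derive_RC_plus; [exact IH|apply Hterm].
Qed.

Lemma Cexp_poly_at_0 (N : nat) : Cexp_poly N 0%C = 1%C.
Proof.
  induction N as [|N IH]; [apply Cexp_poly_0|rewrite Cexp_poly_S, IH; simpl; ring].
Qed.

(** Along the ray [t z] the derivative of the remainder of degree [N + 1] is [z] times that of
    degree [N]; the claim is the case [t = 1]. *)
Lemma Cexp_remainder (N : nat) (z : C) :
  Cmod (Cexp z - Cexp_poly N z) <= Cmod z ^ (S N) / INR (fact (S N)) * exp (Cmod z).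
Proof.
  assert (Hexp : forall t, 0 <= t <= 1 -> Cmod (Cexp (RtoC t * z)) <= exp (Cmod z)).
  { intros t Ht; rewrite Cmod_Cexp.
    assert (Re (RtoC t * z) <= Cmod z).
    { eapply Rle_trans; [apply Rle_abs|eapply Rle_trans; [apply re_le_Cmod|]].
      rewrite Cmod_mult, Cmod_R, Rabs_right by lra; pose proof (Cmod_ge_0 z); nra. }
    destruct H as [H|H]; [left; apply exp_increasing; auto|right; f_equal; auto]. }
  assert (HR : forall N t, 0 <= t <= 1 ->
    Cmod (Cexp (RtoC t * z) - Cexp_poly N (RtoC t * z))
      <= Cmod z ^ (S N) * exp (Cmod z) / INR (fact (S N)) * t ^ (S N)).
  { clear N; intros N; induction N as [|N IH].
    - intros t Ht.
      pose proof (linear_ode_bound z (fun t => Cexp (RtoC t * z) - Cexp_poly 0 (RtoC t * z))%C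
        (fun t => Cexp (RtoC t * z)) (exp (Cmod z)) 0) as HH.
      eapply Rle_trans; [apply HH; auto|].
      + intros x; replace (z * Cexp (RtoC x * z))%C with (z * Cexp (RtoC x * z) - 0)%C by ring.
        apply is_derive_RC_minus; [apply is_derive_Cexp_line|].
        apply (is_derive_ext (K := R_AbsRing) (V := CV) (fun _ => RtoC 1)).
        * intros y; rewrite Cexp_poly_0; auto.
        * apply is_derive_RC_const.
      + intros x; apply (ex_derive_continuous (K := R_AbsRing) (V := CV)).
        eexists; apply is_derive_Cexp_line.
      + rewrite Cmult_0_l, Cexp_0, Cexp_poly_0; ring.
      + intros x Hx; simpl; rewrite Rmult_1_r; auto.
      + right; simpl; field.
    - intros t Ht.
      pose proof (linear_ode_bound z (fun t => Cexp (RtoC t * z) - Cexp_poly (S N) (RtoC t * z))%C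
        (fun t => Cexp (RtoC t * z) - Cexp_poly N (RtoC t * z))%C
        (Cmod z ^ (S N) * exp (Cmod z) / INR (fact (S N))) (S N)) as HH.
      eapply Rle_trans; [apply HH; auto|].
      + intros x; replace (z * (Cexp (RtoC x * z) - Cexp_poly N (RtoC x * z)))%C
          with (z * Cexp (RtoC x * z) - z * Cexp_poly N (RtoC x * z))%C by ring.
        apply is_derive_RC_minus; [apply is_derive_Cexp_line|apply is_derive_Cexp_poly_line].
      + intros x; apply (ex_derive_continuous (K := R_AbsRing) (V := CV)).
        destruct N as [|N].
        * exists (z * Cexp (RtoC x * z) - 0)%C.
          apply is_derive_RC_minus; [apply is_derive_Cexp_line|].
          apply (is_derive_ext (K := R_AbsRing) (V := CV) (fun _ => RtoC 1)).
          { intros y; rewrite Cexp_poly_0; auto. }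
          apply is_derive_RC_const.
        * eexists; apply is_derive_RC_minus; [apply is_derive_Cexp_line|apply is_derive_Cexp_poly_line].
      + rewrite Cmult_0_l, Cexp_0, Cexp_poly_at_0; ring.
      + right; change (fact (S (S N))) with (S (S N) * fact (S N))%nat; rewrite mult_INR.
        change (Cmod z ^ S (S N)) with (Cmod z * Cmod z ^ S N).
        field; split; [apply INR_fact_neq_0|apply not_0_INR; lia]. }
  specialize (HR N 1 ltac:(lra)).
  replace (RtoC 1 * z)%C with z in HR by ring; rewrite pow1 in HR.
  eapply Rle_trans; [exact HR|right; field; apply INR_fact_neq_0].
Qed.

Lemma pow_div_fact_le_exp (x : R) (n : nat) : 0 <= x -> x ^ n / INR (fact n) <= exp x.
Proof.
  intros Hx.
  assert (H : is_lim_seq (sum_n (fun k => x ^ k / INR (fact k))) (exp x)).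
  { pose proof (is_exp_Reals x) as He; unfold is_pseries in He.
    apply (is_series_ext _ (fun k => x ^ k / INR (fact k))) in He; [exact He|].
    intros k; rewrite pow_n_pow; unfold scal; simpl; unfold mult; simpl; unfold Rdiv; ring. }
  assert (Hp : forall k, 0 <= x ^ k / INR (fact k)).
  { intros k; apply Rdiv_le_0_compat; [apply pow_le; auto|apply INR_fact_lt_0]. }
  apply Rle_trans with (sum_n (fun k => x ^ k / INR (fact k)) n).
  - destruct n as [|n]; [rewrite sum_O; lra|].
    rewrite sum_Sn; unfold plus; simpl.
    assert (0 <= sum_n (fun k => x ^ k / INR (fact k)) n); [|simpl in *; lra].
    induction n as [|n IH]; [rewrite sum_O; auto|rewrite sum_Sn; unfold plus; simpl].
    specialize (Hp (S n)); simpl in *; lra.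
  - apply (is_lim_seq_incr_compare (sum_n (fun k => x ^ k / INR (fact k)))); auto.
    intros k; rewrite sum_Sn; unfold plus; simpl; specialize (Hp (S k)); simpl in *; lra.
Qed.

(** * Improper integrals on the half-line *)

Notation p_oo := (Rbar_locally p_infty).
Notation is_CInt_0_oo f l := (is_CInt_gen f (at_right 0) p_oo l).

Lemma at_right_0_intro (P : R -> Prop) (d : R) :
  0 < d -> (forall x, 0 < x < d -> P x) -> at_right 0 P.
Proof.
  intros Hd H; exists (mkposreal d Hd); intros y Hy Hy0; apply H; split; auto.
  unfold ball in Hy; simpl in Hy; unfold AbsRing_ball, abs, minus, plus, opp in Hy; simpl in Hy.
  apply Rabs_lt_between in Hy; lra.
Qed.

Lemma p_oo_intro (P : R -> Prop) (M : R) : (forall x, M < x -> P x) -> p_oo P.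
Proof. intros H; exists M; auto. Qed.

Lemma interval_pred_pos : interval_pred (fun x => 0 < x).
Proof. intros a b x Ha Hb Hx; lra. Qed.

Lemma at_right_0_pos : at_right 0 (fun x => 0 < x).
Proof. apply (at_right_0_intro _ 1); [lra|intros x Hx; lra]. Qed.

Lemma p_oo_pos : p_oo (fun x => 0 < x).
Proof. apply (p_oo_intro _ 0); auto. Qed.

Lemma INR_S_pos (n : nat) : 0 < INR (S n).
Proof. apply lt_0_INR; lia. Qed.

Lemma INR_S_lim_p_oo : filterlim (fun n => INR (S n)) eventually p_oo.
Proof.
  intros P [M HM]; destruct (nfloor_ex (Rmax M 0)) as [n [Hn1 Hn2]]; [apply Rmax_r|].
  exists n; intros k Hk; apply HM; pose proof (Rmax_l M 0).
  apply le_INR in Hk; rewrite S_INR; lra.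
Qed.

Lemma prod_0_oo_ordered (u v : R) : 0 < u ->
  filter_prod (at_right 0) p_oo (fun ab => 0 < fst ab <= u /\ v <= snd ab).
Proof.
  intros Hu; exists (fun x => 0 < x <= u) (fun x => v <= x).
  - apply (at_right_0_intro _ u); auto; intros x Hx; lra.
  - apply (p_oo_intro _ v); intros x Hx; lra.
  - intros x y Hx Hy; auto.
Qed.

Lemma filterlim_R_iff {T : Type} (F : (T -> Prop) -> Prop) {FF : Filter F} (f : T -> R) (l : R) :
  filterlim f F (locally l) <-> forall eps, 0 < eps -> F (fun x => Rabs (f x - l) < eps).
Proof.
  rewrite (filterlim_locally f l); split.
  - intros H eps He; apply (H (mkposreal eps He)).
  - intros H eps; apply (H eps (cond_pos eps)).
Qed.

Lemma filterlim_C_0_bound {T : Type} (F : (T -> Prop) -> Prop) {FF : Filter F} (f : T -> C) (g : T -> R) :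
  F (fun x => Cmod (f x) <= g x) -> filterlim g F (locally 0) -> filterlim f F (locally (RtoC 0)).
Proof.
  intros H Hg; apply filterlim_C_iff; auto; intros eps He.
  generalize (filter_and _ _ H (proj1 (filterlim_R_iff F g 0) Hg eps He)).
  apply filter_imp; intros x [H1 H2].
  replace (f x - 0)%C with (f x) by ring.
  rewrite Rminus_0_r in H2; apply Rabs_lt_between in H2; lra.
Qed.

Lemma filterlim_R_scal_0 {T : Type} (F : (T -> Prop) -> Prop) {FF : Filter F} (g : T -> R) (k : R) :
  filterlim g F (locally 0) -> filterlim (fun x => k * g x) F (locally 0).
Proof.
  intros H; apply filterlim_R_iff; auto; intros eps He.
  assert (Hp : 0 < eps / (Rabs k + 1)) by (apply Rdiv_lt_0_compat; auto; pose proof (Rabs_pos k); lra).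
  generalize (proj1 (filterlim_R_iff F g 0) H _ Hp); apply filter_imp; intros x Hx.
  rewrite Rminus_0_r in *; rewrite Rabs_mult.
  pose proof (Rabs_pos k); pose proof (Rabs_pos (g x)).
  apply Rlt_div_r in Hx; [|lra]; nra.
Qed.

Lemma Rpower_lim_0 (a : R) : 0 < a -> filterlim (fun x => Rpower x a) (at_right 0) (locally 0).
Proof.
  intros Ha; apply filterlim_R_iff; [typeclasses eauto|]; intros eps He.
  apply (at_right_0_intro _ (Rpower eps (/ a))); [apply Rpower_pos|]; intros x Hx.
  rewrite Rminus_0_r, Rabs_right by (left; apply Rpower_pos).
  apply Rlt_le_trans with (Rpower (Rpower eps (/ a)) a); [apply Rlt_Rpower_l; auto|].
  rewrite Rpower_mult, Rinv_l, Rpower_1 by lra; lra.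
Qed.

Lemma Rpower_lim_p_oo (a : R) : a < 0 -> filterlim (fun x => Rpower x a) p_oo (locally 0).
Proof.
  intros Ha; apply filterlim_R_iff; [typeclasses eauto|]; intros eps He.
  apply (p_oo_intro _ (Rpower eps (/ a))); intros x Hx.
  rewrite Rminus_0_r, Rabs_right by (left; apply Rpower_pos).
  replace a with (- - a) by ring; rewrite (Rpower_Ropp x).
  rewrite <- (Rinv_inv eps); apply Rinv_lt_contravar.
  - apply Rmult_lt_0_compat; [apply Rinv_0_lt_compat; auto|apply Rpower_pos].
  - apply Rle_lt_trans with (Rpower (Rpower eps (/ a)) (- a)).
    + rewrite Rpower_mult; replace (/ a * - a) with (Ropp 1) by (field; lra).
      rewrite Rpower_Ropp, Rpower_1; auto; lra.
    + apply Rlt_Rpower_l; [lra|split; auto; apply Rpower_pos].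
Qed.

Lemma is_derive_Rpower (x a : R) : 0 < x -> is_derive (fun t => Rpower t a) x (a * Rpower x (a - 1)).
Proof.
  intros Hx; unfold Rpower; auto_derive; auto.
  replace ((a - 1) * ln x) with (a * ln x + - ln x) by ring.
  rewrite exp_plus, exp_Ropp, exp_ln by auto; field; lra.
Qed.

Lemma continuous_Rpower (x a : R) : 0 < x -> continuous (fun t => Rpower t a) x.
Proof.
  intros Hx; apply (ex_derive_continuous (K := R_AbsRing) (V := R_NormedModule)).
  eexists; apply is_derive_Rpower; auto.
Qed.

(** The derivative of [- 1 / (1 + x^a)]. It behaves like [x^(a-1)] at [0] and like [x^(-a-1)] at
    infinity, so one explicit majorant of total mass [1] serves both ends of the half-line. *)
Definition int_kernel (a x : R) : R := a * Rpower x (a - 1) * / (1 + Rpower x a) ^ 2.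

Lemma continuous_int_kernel (a x : R) : 0 < x -> continuous (int_kernel a) x.
Proof.
  intros Hx; apply (ex_derive_continuous (K := R_AbsRing) (V := R_NormedModule)).
  unfold int_kernel, Rpower; auto_derive.
  pose proof (exp_pos (a * ln x)); repeat split; auto; simpl; nra.
Qed.

Lemma is_RInt_gen_int_kernel (a : R) : 0 < a ->
  is_RInt_gen (int_kernel a) (at_right 0) p_oo 1.
Proof.
  intros Ha.
  pose proof (is_RInt_gen_primitive (V := R_CompleteNormedModule) (fun x => 0 < x) (at_right 0) p_oo
    (int_kernel a) (fun x => - / (1 + Rpower x a)) (- 1) 0) as H.
  replace (minus (0 : R_CompleteNormedModule) (- 1)) with 1 in H
    by (unfold minus, plus, opp; simpl; ring).
  apply H; clear H.
  - apply interval_pred_pos.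
  - apply at_right_0_pos.
  - apply p_oo_pos.
  - intros x Hx; unfold int_kernel, Rpower; auto_derive.
    + pose proof (exp_pos (a * ln x)); split; auto; split; auto; lra.
    + replace ((a - 1) * ln x) with (a * ln x + - ln x) by ring.
      rewrite exp_plus, exp_Ropp, exp_ln by auto.
      pose proof (exp_pos (a * ln x)); field; lra.
  - apply continuous_int_kernel.
  - pose proof (Rpower_lim_0 a Ha) as H.
    apply filterlim_R_iff; [typeclasses eauto|]; intros eps He.
    generalize (proj1 (filterlim_R_iff (at_right 0) _ 0) H eps He); apply filter_imp; intros x Hx.
    pose proof (Rpower_pos x a).
    rewrite Rminus_0_r, Rabs_right in Hx by lra.
    replace (- / (1 + Rpower x a) - - 1) with (Rpower x a / (1 + Rpower x a)) by (field; lra).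
    rewrite Rabs_right; [apply Rlt_div_l; nra|].
    apply Rle_ge, Rdiv_le_0_compat; lra.
  - pose proof (Rpower_lim_p_oo (- a) ltac:(lra)) as H.
    apply filterlim_R_iff; [typeclasses eauto|]; intros eps He.
    generalize (proj1 (filterlim_R_iff p_oo _ 0) H eps He); apply filter_imp; intros x Hx.
    pose proof (Rpower_pos x a).
    rewrite Rminus_0_r, Rpower_Ropp, Rabs_right in Hx by (left; apply Rinv_0_lt_compat; auto).
    rewrite Rminus_0_r, Rabs_Ropp, Rabs_right by (left; apply Rinv_0_lt_compat; lra).
    apply Rle_lt_trans with (/ Rpower x a); auto.
    apply Rinv_le_contravar; lra.
Qed.

(** The factor [4] is [2^2]: [1 + x^a] is at most [2] for [x <= 1] and at most [2 x^a] for
    [x >= 1]. *)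
Lemma int_kernel_bound (a B x y : R) : 0 < a -> 0 <= B -> 0 < x ->
  (x <= 1 -> y <= B * Rpower x (a - 1)) -> (1 <= x -> y <= B * Rpower x (- a - 1)) ->
  y <= 4 * B / a * int_kernel a x.
Proof.
  intros Ha HB Hx H1 H2; unfold int_kernel.
  pose proof (Rpower_pos x a) as Hp; pose proof (Rpower_pos x (a - 1)) as Hq.
  replace (4 * B / a * (a * Rpower x (a - 1) * / (1 + Rpower x a) ^ 2))
    with (B * (Rpower x (a - 1) * (4 / (1 + Rpower x a) ^ 2))) by (field; lra).
  destruct (Rle_dec x 1) as [Hle|Hle].
  - eapply Rle_trans; [apply H1; auto|].
    apply Rmult_le_compat_l; auto.
    rewrite <- (Rmult_1_r (Rpower x (a - 1))) at 1; apply Rmult_le_compat_l; [lra|].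
    apply Rle_div_r; [nra|].
    assert (Rpower x a <= 1); [|nra].
    apply Rle_trans with (Rpower 1 a); [apply Rle_Rpower_l; lra|].
    unfold Rpower; rewrite ln_1, Rmult_0_r, exp_0; lra.
  - eapply Rle_trans; [apply H2; lra|].
    apply Rmult_le_compat_l; auto.
    replace (- a - 1) with ((a - 1) + - (2 * a)) by ring.
    rewrite Rpower_plus; apply Rmult_le_compat_l; [lra|].
    replace (- (2 * a)) with (- a + - a) by ring; rewrite Rpower_plus, Rpower_Ropp.
    replace (/ Rpower x a * / Rpower x a) with (1 / Rpower x a ^ 2) by (field; lra).
    rewrite <- Rle_div_r by (apply pow_lt; lra).
    replace (1 / Rpower x a ^ 2 * (1 + Rpower x a) ^ 2) with (((1 + Rpower x a) / Rpower x a) ^ 2) by (field; lra).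
    assert (1 <= Rpower x a).
    { rewrite <- (Rpower_O x) by auto; apply Rle_Rpower; lra. }
    assert (0 <= (1 + Rpower x a) / Rpower x a <= 2); [|nra].
    split; [apply Rdiv_le_0_compat; lra|apply Rle_div_l; lra].
Qed.

Lemma ex_CInt_0_oo (f : R -> C) (a B : R) : 0 < a -> 0 <= B ->
  (forall x, 0 < x -> continuous_RC f x) ->
  (forall x, 0 < x <= 1 -> Cmod (f x) <= B * Rpower x (a - 1)) ->
  (forall x, 1 <= x -> Cmod (f x) <= B * Rpower x (- a - 1)) ->
  exists l, is_CInt_0_oo f l /\ Cmod l <= 4 * B / a.
Proof.
  intros Ha HB Hc H1 H2.
  destruct (ex_CInt_gen_dominated (fun x => 0 < x) (at_right 0) p_oo f
    (fun x => 4 * B / a * int_kernel a x) (4 * B / a * 1)) as (l & Hl & Hb).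
  - apply interval_pred_pos.
  - apply at_right_0_pos.
  - apply p_oo_pos.
  - generalize (prod_0_oo_ordered 1 1 ltac:(lra)); apply filter_imp; intros [u v]; simpl; lra.
  - auto.
  - intros x Hx; apply (continuous_scal_r (K := R_AbsRing) (V := R_NormedModule)), continuous_int_kernel; auto.
  - intros x Hx; apply int_kernel_bound; auto.
  - apply (is_RInt_gen_scal (V := R_NormedModule)), is_RInt_gen_int_kernel; auto.
  - exists l; split; auto; lra.
Qed.

Lemma ex_CInt_1_oo (f : R -> C) (a B : R) : 1 < a ->
  (forall x, 1 <= x -> continuous_RC f x) ->
  (forall x, 1 <= x -> Cmod (f x) <= B * Rpower x (- a)) ->
  exists l, is_CInt_gen f (at_point 1) p_oo l /\ Cmod l <= B / (a - 1).
Proof.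
  intros Ha Hc Hb.
  assert (HI : is_RInt_gen (fun x => Rpower x (- a)) (at_point 1) p_oo (/ (a - 1))).
  { pose proof (is_RInt_gen_primitive (V := R_CompleteNormedModule) (fun x => 1 <= x) (at_point 1) p_oo
      (fun x => Rpower x (- a)) (fun x => - / (a - 1) * Rpower x (1 - a)) (- / (a - 1)) 0) as H.
    replace (minus (0 : R_CompleteNormedModule) (- / (a - 1))) with (/ (a - 1)) in H
      by (unfold minus, plus, opp; simpl; ring).
    apply H; clear H.
    - intros u v x Hu Hv Hx; lra.
    - unfold at_point; lra.
    - apply (p_oo_intro _ 1); intros; lra.
    - intros x Hx.
      replace (Rpower x (- a)) with (- / (a - 1) * ((1 - a) * Rpower x ((1 - a) - 1))).
      + apply is_derive_scal.
        apply is_derive_Rpower; lra.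
      + replace (1 - a - 1) with (- a) by ring; field; lra.
    - intros x Hx; apply continuous_Rpower; lra.
    - intros P [d Hd]; unfold filtermap, at_point; apply Hd.
      replace (Rpower 1 (1 - a)) with 1; [rewrite Rmult_1_r; apply ball_center|].
      unfold Rpower; rewrite ln_1, Rmult_0_r, exp_0; auto.
    - apply filterlim_R_scal_0; [typeclasses eauto|].
      apply Rpower_lim_p_oo; lra. }
  destruct (ex_CInt_gen_dominated (fun x => 1 <= x) (at_point 1) p_oo f
    (fun x => B * Rpower x (- a)) (B * / (a - 1))) as (l & Hl & Hlb).
  - intros u v x Hu Hv Hx; lra.
  - unfold at_point; lra.
  - apply (p_oo_intro _ 1); intros; lra.
  - exists (fun x => x = 1) (fun x => 1 <= x); [reflexivity|apply (p_oo_intro _ 1); intros; lra|].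
    intros x y Hx Hy; simpl; lra.
  - auto.
  - intros x Hx; apply (continuous_scal_r (K := R_AbsRing) (V := R_NormedModule)), continuous_Rpower; lra.
  - auto.
  - apply (is_RInt_gen_scal (V := R_NormedModule)); auto.
  - exists l; split; auto.
Qed.

Lemma is_CInt_0_oo_unique (f : R -> C) (l l' : C) : is_CInt_0_oo f l -> is_CInt_0_oo f l' -> l = l'.
Proof.
  intros H H'; rewrite <- (is_RInt_gen_unique (V := CV) f l H); apply (is_RInt_gen_unique (V := CV)); auto.
Qed.

Lemma is_CInt_0_oo_ext (f g : R -> C) (l : C) :
  (forall x, 0 < x -> f x = g x) -> is_CInt_0_oo f l -> is_CInt_0_oo g l.
Proof.
  intros H; apply (is_RInt_gen_ext (V := CV)).
  generalize (prod_0_oo_ordered 1 1 ltac:(lra)); apply filter_imp; intros [u v]; simpl; intros Huv x Hx.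
  rewrite Rmin_left in Hx by lra; apply H; lra.
Qed.

Lemma is_CInt_0_oo_plus (f g : R -> C) (l m : C) :
  is_CInt_0_oo f l -> is_CInt_0_oo g m -> is_CInt_0_oo (fun x => f x + g x)%C (l + m)%C.
Proof. apply (is_RInt_gen_plus (V := CV)). Qed.

Lemma is_CInt_0_oo_minus (f g : R -> C) (l m : C) :
  is_CInt_0_oo f l -> is_CInt_0_oo g m -> is_CInt_0_oo (fun x => f x - g x)%C (l - m)%C.
Proof. apply (is_RInt_gen_minus (V := CV)). Qed.

Lemma is_CInt_0_oo_primitive (f F : R -> C) (A B : C) :
  (forall x, 0 < x -> is_derive_RC F x (f x)) -> (forall x, 0 < x -> continuous_RC f x) ->
  filterlim F (at_right 0) (locally A) -> filterlim F p_oo (locally B) ->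
  is_CInt_0_oo f (B - A)%C.
Proof.
  intros Hd Hc HA HB.
  apply (is_RInt_gen_primitive (V := CV) (fun x => 0 < x) (at_right 0) p_oo f F); auto.
  - apply interval_pred_pos.
  - apply at_right_0_pos.
  - apply p_oo_pos.
Qed.

Lemma is_CInt_0_oo_scale (f : R -> C) (c : R) (l : C) : 0 < c ->
  (forall x, 0 < x -> continuous_RC f x) ->
  is_CInt_0_oo f l -> is_CInt_0_oo (fun x => RtoC c * f (c * x)%R)%C l.
Proof.
  intros Hc Hf H.
  apply (is_CInt_0_oo_ext (fun x => scal c (f (c * x)%R : CV) : C)).
  { intros x _; apply Ceq; unfold scal; simpl; unfold scal; simpl; unfold mult; simpl; ring. }
  apply (is_RInt_gen_comp (V := CV) (fun x => 0 < x) (at_right 0) p_oo (at_right 0) p_oo f (fun x => c * x) (fun _ => c)); auto.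
  - apply interval_pred_pos.
  - apply at_right_0_pos.
  - apply p_oo_pos.
  - intros x _; auto_derive; auto; ring.
  - intros x _; apply continuous_const.
  - intros x Hx; apply Hf, Rmult_lt_0_compat; auto.
  - intros P [d Hd].
    apply (at_right_0_intro _ (d / c)); [apply Rdiv_lt_0_compat; auto; apply cond_pos|].
    intros x Hx; apply Hd; [|apply Rmult_lt_0_compat; lra].
    unfold ball; simpl; unfold AbsRing_ball, abs, minus, plus, opp; simpl.
    destruct Hx as [Hx1 Hx2]; apply Rlt_div_r in Hx2; auto.
    rewrite Rabs_right; [lra|]; apply Rle_ge; pose proof (Rmult_lt_0_compat _ _ Hc Hx1); lra.
  - intros P [M HM]; apply (p_oo_intro _ (M / c)); intros x Hx; apply HM.
    apply Rlt_div_l in Hx; auto; lra.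
Qed.

(** The substitution [x -> 1/x] exchanges the ends; the minus sign of its derivative is absorbed by
    reversing the orientation. *)
Lemma is_CInt_0_oo_inv (f : R -> C) (l : C) :
  (forall x, 0 < x -> continuous_RC f x) ->
  is_CInt_0_oo f l -> is_CInt_0_oo (fun x => RtoC (/ x ^ 2) * f (/ x)%R)%C l.
Proof.
  intros Hf H.
  pose proof (is_RInt_gen_swap (V := CV) (Fa := p_oo) (Fb := at_right 0) f l H) as Hs.
  replace l with (opp (opp (l : CV)))
    by (apply Ceq; unfold opp; simpl; unfold opp; simpl; ring).
  apply (is_CInt_0_oo_ext (fun x => opp (scal (- / x ^ 2) (f (/ x) : CV)) : C)).
  { intros x _; apply Ceq; unfold opp, scal; simpl; unfold opp, scal; simpl; unfold mult; simpl; ring. }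
  apply (is_RInt_gen_opp (V := CV)).
  apply (is_RInt_gen_comp (V := CV) (fun x => 0 < x) (at_right 0) p_oo p_oo (at_right 0) f (fun x => / x) (fun x => - / x ^ 2)); auto.
  - apply interval_pred_pos.
  - apply at_right_0_pos.
  - apply p_oo_pos.
  - intros x Hx; auto_derive; [lra|]; field; lra.
  - intros x Hx; continuous_by_derive.
    apply Rgt_not_eq; simpl; nra.
  - intros x Hx; apply Hf, Rinv_0_lt_compat; auto.
  - intros P [M HM]; apply (at_right_0_intro _ (/ (Rabs M + 1))).
    + apply Rinv_0_lt_compat; pose proof (Rabs_pos M); lra.
    + intros x Hx; apply HM; pose proof (Rle_abs M); pose proof (Rabs_pos M).
      apply Rlt_trans with (Rabs M + 1); [lra|].
      rewrite <- (Rinv_inv (Rabs M + 1)); apply Rinv_lt_contravar; [|lra].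
      apply Rmult_lt_0_compat; [lra|apply Rinv_0_lt_compat; lra].
  - intros P [d Hd]; apply (p_oo_intro _ (/ d)); intros x Hx; pose proof (cond_pos d) as Hp.
    pose proof (Rinv_0_lt_compat _ Hp) as Hq.
    assert (Hi : 0 < / x) by (apply Rinv_0_lt_compat; lra).
    apply Hd; auto.
    unfold ball; simpl; unfold AbsRing_ball, abs, minus, plus, opp; simpl.
    rewrite Rabs_right by lra.
    rewrite <- (Rinv_inv d), Ropp_0, Rplus_0_r; apply Rinv_lt_contravar; auto.
    apply Rmult_lt_0_compat; lra.
Qed.

(** A limit of positive integrals is only known to be nonnegative; the fixed piece over [[1, 2]]
    keeps strict positivity. *)
Lemma is_RInt_gen_0_oo_ge (f : R -> R) (l : R) :
  (forall x, 0 < x -> continuous f x) -> (forall x, 0 < x -> 0 <= f x) ->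
  is_RInt_gen f (at_right 0) p_oo l -> RInt f 1 2 <= l.
Proof.
  intros Hc Hp H.
  apply Rnot_lt_le; intros Hlt.
  pose proof (is_RInt_gen_RInt_lim (V := R_CompleteNormedModule) (at_right 0) p_oo f l H) as HL.
  pose proof (proj1 (filterlim_R_iff (filter_prod (at_right 0) p_oo) _ l) HL (RInt f 1 2 - l) ltac:(lra)) as HL'.
  destruct (filter_ex (F := filter_prod (at_right 0) p_oo) _ (filter_and _ _ HL' (prod_0_oo_ordered 1 2 ltac:(lra)))) as [[u v] [H1 H2]].
  simpl in H1, H2.
  assert (Ex : forall a b, 0 < a -> a <= b -> ex_RInt f a b).
  { intros a b Ha Hab; apply (ex_RInt_continuous (V := R_CompleteNormedModule)); intros x Hx.
    rewrite Rmin_left in Hx by auto; apply Hc; lra. }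
  pose proof (RInt_Chasles f u 1 v (Ex u 1 ltac:(lra) ltac:(lra)) (Ex 1 v ltac:(lra) ltac:(lra))) as C1.
  pose proof (RInt_Chasles f 1 2 v (Ex 1 2 ltac:(lra) ltac:(lra)) (Ex 2 v ltac:(lra) ltac:(lra))) as C2.
  change (RInt f u 1 + RInt f 1 v = RInt f u v) in C1.
  change (RInt f 1 2 + RInt f 2 v = RInt f 1 v) in C2.
  assert (0 <= RInt f u 1).
  { apply RInt_ge_0; [lra|apply Ex; lra|intros x Hx; apply Hp; lra]. }
  assert (0 <= RInt f 2 v).
  { apply RInt_ge_0; [lra|apply Ex; lra|intros x Hx; apply Hp; lra]. }
  apply Rabs_lt_between in H1; lra.
Qed.

Lemma is_RInt_gen_0_oo_ge_0 (f : R -> R) (l : R) :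
  (forall x, 0 < x -> continuous f x) -> (forall x, 0 < x -> 0 <= f x) ->
  is_RInt_gen f (at_right 0) p_oo l -> 0 <= l.
Proof.
  intros Hc Hp H; apply Rle_trans with (RInt f 1 2); [|apply is_RInt_gen_0_oo_ge; auto].
  apply RInt_ge_0; [lra| |intros x Hx; apply Hp; lra].
  apply (ex_RInt_continuous (V := R_CompleteNormedModule)); intros x Hx.
  rewrite Rmin_left in Hx by lra; apply Hc; lra.
Qed.

Lemma is_RInt_gen_0_oo_gt_0 (f : R -> R) (l : R) :
  (forall x, 0 < x -> continuous f x) -> (forall x, 0 < x -> 0 < f x) ->
  is_RInt_gen f (at_right 0) p_oo l -> 0 < l.
Proof.
  intros Hc Hp H; apply Rlt_le_trans with (RInt f 1 2).
  - apply RInt_gt_0; [lra|intros x Hx; apply Hp; lra|intros x Hx; apply Hc; lra].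
  - apply is_RInt_gen_0_oo_ge; auto; intros x Hx; left; auto.
Qed.

Notation is_RInt_0_oo f l := (@is_RInt_gen R_NormedModule f (at_right 0) p_oo l).

Lemma is_RInt_0_oo_plus (f g : R -> R) (l m : R) :
  is_RInt_0_oo f l -> is_RInt_0_oo g m -> is_RInt_0_oo (fun x => f x + g x) (l + m).
Proof. apply (is_RInt_gen_plus (V := R_NormedModule)). Qed.

Lemma is_RInt_0_oo_scal (f : R -> R) (k l : R) :
  is_RInt_0_oo f l -> is_RInt_0_oo (fun x => k * f x) (k * l).
Proof. apply (is_RInt_gen_scal (V := R_NormedModule)). Qed.

(** * The Gamma function *)

Lemma exp_le_exp (x y : R) : x <= y -> exp x <= exp y.
Proof. intros [H| ->]; [left; apply exp_increasing; auto|right; auto]. Qed.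

Lemma Rpower_le_exponent_small (x a b : R) : 0 < x <= 1 -> b <= a -> Rpower x a <= Rpower x b.
Proof.
  intros Hx Hab; apply exp_le_exp.
  assert (ln x <= 0); [|nra].
  rewrite <- ln_1; apply ln_le; lra.
Qed.

Lemma Rpower_exp_bounded (a : R) :
  exists B, 1 <= B /\ forall x, 1 <= x -> Rpower x a * exp (- x) <= B.
Proof.
  destruct (nfloor_ex (Rmax a 0)) as [n [Hn1 Hn2]]; [apply Rmax_r|].
  assert (Hn : a <= INR (S n)) by (rewrite S_INR; pose proof (Rmax_l a 0); lra).
  (* From [x^k <= k! e^x], with [k] an integer above [a]. *)
  exists (INR (fact (S n))); split.
  - replace 1 with (INR 1) by reflexivity; apply le_INR, lt_O_fact.
  - intros x Hx; rewrite exp_Ropp; apply Rle_div_l; [apply exp_pos|].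
    apply Rle_trans with (x ^ (S n)).
    + rewrite <- Rpower_pow by lra; apply Rle_Rpower; auto.
    + pose proof (pow_div_fact_le_exp x (S n) ltac:(lra)) as H.
      apply Rle_div_l in H; [rewrite Rmult_comm; auto|apply INR_fact_lt_0].
Qed.

Definition gamma_integrand (s : C) (x : R) : C := (Rcpow x (s - 1) * RtoC (exp (- x)))%C.

Lemma continuous_gamma_integrand (s : C) (x : R) : 0 < x -> continuous_RC (gamma_integrand s) x.
Proof.
  intros Hx; apply continuous_Cmult; [apply continuous_Rcpow; auto|].
  apply continuous_RtoC; continuous_by_derive; auto.
Qed.

Lemma Cmod_gamma_integrand (s : C) (x : R) :
  Cmod (gamma_integrand s x) = Rpower x (Re s - 1) * exp (- x).
Proof.
  unfold gamma_integrand; rewrite Cmod_mult, Cmod_Rcpow, Cmod_R, Rabs_right by (left; apply exp_pos).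
  f_equal; f_equal; destruct s; unfold Re; simpl; ring.
Qed.

Lemma exp_opp_le_1 (x : R) : 0 <= x -> exp (- x) <= 1.
Proof. intros Hx; rewrite <- exp_0; apply exp_le_exp; lra. Qed.

Lemma is_CInt_CGamma (s : C) : 0 < Re s -> is_CInt_0_oo (gamma_integrand s) (CGamma s).
Proof.
  intros Hs.
  (* At infinity [x^(Re s - 1) e^(-x) = x^(-Re s - 1) * x^(2 Re s) e^(-x)], which explains the
     exponent [2 Re s]. *)
  destruct (Rpower_exp_bounded (2 * Re s)) as (B & HB1 & HB).
  destruct (ex_CInt_0_oo (gamma_integrand s) (Re s) B) as (l & Hl & _); auto; try lra.
  - intros x Hx; apply continuous_gamma_integrand; auto.
  - intros x Hx; rewrite Cmod_gamma_integrand, Rmult_comm.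
    pose proof (exp_opp_le_1 x ltac:(lra)); pose proof (Rpower_pos x (Re s - 1)).
    apply Rmult_le_compat_r; lra.
  - intros x Hx; rewrite Cmod_gamma_integrand.
    replace (Re s - 1) with ((- Re s - 1) + 2 * Re s) by ring; rewrite Rpower_plus.
    specialize (HB x Hx); pose proof (Rpower_pos x (- Re s - 1)).
    rewrite Rmult_assoc, Rmult_comm; apply Rmult_le_compat_r; lra.
  - unfold CGamma; change (is_CInt_0_oo (gamma_integrand s)
      (RInt_gen (V := CV) (gamma_integrand s) (at_right 0) p_oo)).
    rewrite (is_RInt_gen_unique (V := CV) (gamma_integrand s) l Hl); auto.
Qed.

Lemma is_CInt_CGamma_scale (s : C) (c : R) : 0 < c -> 0 < Re s ->
  is_CInt_0_oo (fun x => Rcpow x (s - 1) * RtoC (exp (- (c * x))))%C (Rcpow c (- s) * CGamma s)%C.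
Proof.
  intros Hc Hs.
  pose proof (is_CInt_gen_scal (at_right 0) p_oo (Rcpow c (- s)) _ _
    (is_CInt_0_oo_scale _ c _ Hc (fun x Hx => continuous_gamma_integrand s x Hx) (is_CInt_CGamma s Hs))) as H.
  revert H; apply is_CInt_0_oo_ext; intros x Hx; unfold gamma_integrand.
  rewrite Rcpow_mult_l, (Rcpow_minus_1 c) by auto.
  assert (RtoC c <> 0%C) by (apply RtoC_neq_0; lra).
  rewrite (RtoC_inv c) by lra.
  replace (Rcpow c (- s) * (RtoC c * (Rcpow c s * / RtoC c * Rcpow x (s - 1) * RtoC (exp (- (c * x))))))%C
    with ((Rcpow c s * Rcpow c (- s)) * (Rcpow x (s - 1) * RtoC (exp (- (c * x)))))%C by (field; auto).
  rewrite Rcpow_opp; ring.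
Qed.

Lemma CGamma_conj (s : C) : 0 < Re s -> CGamma (Cconj s) = Cconj (CGamma s).
Proof.
  intros Hs; apply (is_CInt_0_oo_unique (gamma_integrand (Cconj s))).
  - apply is_CInt_CGamma; auto.
  - generalize (is_CInt_gen_conj (at_right 0) p_oo _ _ (is_CInt_CGamma s Hs)).
    apply is_CInt_0_oo_ext; intros x Hx; unfold gamma_integrand.
    rewrite Cmult_conj, <- Rcpow_conj, Cminus_conj; f_equal; [f_equal; f_equal|]; apply Ceq; simpl; ring.
Qed.

(** The derivative of [x^s e^(-x)], a function vanishing at both ends, has integral [0]. *)
Lemma CGamma_plus_1 (s : C) : 0 < Re s -> CGamma (s + 1) = (s * CGamma s)%C.
Proof.
  intros Hs.
  assert (Hs1 : 0 < Re (s + 1)) by (destruct s; unfold Re in *; simpl in *; lra).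
  assert (H : is_CInt_0_oo (fun x => s * gamma_integrand s x - gamma_integrand (s + 1) x)%C (0 - 0)%C).
  { apply (is_CInt_0_oo_primitive _ (fun x => Rcpow x s * RtoC (exp (- x)))%C).
    - intros x Hx.
      replace (s * gamma_integrand s x - gamma_integrand (s + 1) x)%C
        with (s * Rcpow x (s - 1) * RtoC (exp (- x)) + Rcpow x s * RtoC (- exp (- x)))%C.
      + apply (is_derive_Cmult (fun x => Rcpow x s) (fun x => RtoC (exp (- x)))); [apply is_derive_Rcpow; auto|].
        apply is_derive_RtoC; auto_derive; auto; ring.
      + unfold gamma_integrand; replace (s + 1 - 1)%C with s by ring; rewrite RtoC_opp; ring.
    - intros x Hx.
      apply continuous_RC_minus.
      + apply (continuous_Cmult (fun _ => s)); [apply continuous_RC_const|].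
        apply continuous_gamma_integrand; auto.
      + apply continuous_gamma_integrand; auto.
    - apply (filterlim_C_0_bound (at_right 0) _ (fun x => Rpower x (Re s))).
      + generalize at_right_0_pos; apply filter_imp; intros x Hx.
        rewrite Cmod_mult, Cmod_Rcpow, Cmod_R, Rabs_right by (left; apply exp_pos).
        pose proof (exp_opp_le_1 x ltac:(lra)); pose proof (Rpower_pos x (Re s)); nra.
      + apply Rpower_lim_0; auto.
    - destruct (Rpower_exp_bounded (Re s + 1)) as (B & HB1 & HB).
      apply (filterlim_C_0_bound p_oo _ (fun x => B * Rpower x (- (1)))).
      + apply (p_oo_intro _ 1); intros x Hx.
        rewrite Cmod_mult, Cmod_Rcpow, Cmod_R, Rabs_right by (left; apply exp_pos).
        specialize (HB x ltac:(lra)).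
        replace (Re s) with (- (1) + (Re s + 1)) by ring; rewrite (Rpower_plus (- (1))).
        pose proof (Rpower_pos x (- (1))).
        rewrite Rmult_assoc, Rmult_comm; apply Rmult_le_compat_r; lra.
      + apply filterlim_R_scal_0; [typeclasses eauto|]; apply Rpower_lim_p_oo; lra. }
  pose proof (is_CInt_0_oo_minus _ _ _ _
    (is_CInt_gen_scal (at_right 0) p_oo s _ _ (is_CInt_CGamma s Hs)) (is_CInt_CGamma (s + 1) Hs1)) as H'.
  pose proof (is_CInt_0_oo_unique _ _ _ H H') as E.
  replace (CGamma (s + 1)) with (s * CGamma s - (s * CGamma s - CGamma (s + 1)))%C by ring.
  rewrite <- E; ring.
Qed.

Lemma CGamma_real_pos (a : R) : 0 < a -> 0 < Re (CGamma (RtoC a)).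
Proof.
  intros Ha.
  assert (Hs : 0 < Re (RtoC a)) by (simpl; auto).
  apply (is_RInt_gen_0_oo_gt_0 (fun x => Re (gamma_integrand (RtoC a) x))).
  - intros x Hx; apply continuous_C_fst, continuous_gamma_integrand; auto.
  - intros x Hx; unfold gamma_integrand; rewrite <- RtoC_minus, Rcpow_RtoC, <- RtoC_mult; simpl.
    apply Rmult_lt_0_compat; apply exp_pos.
  - apply is_CInt_gen_Re; [typeclasses eauto|typeclasses eauto|]; apply is_CInt_CGamma; auto.
Qed.

Lemma CGamma_real (a : R) : 0 < a -> CGamma (RtoC a) = RtoC (Re (CGamma (RtoC a))).
Proof.
  intros Ha.
  assert (Hs : 0 < Re (RtoC a)) by (simpl; auto).
  pose proof (CGamma_conj (RtoC a) Hs) as H.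
  replace (Cconj (RtoC a)) with (RtoC a) in H by (apply Ceq; simpl; ring).
  apply (f_equal snd) in H; simpl in H.
  apply Ceq; [reflexivity|simpl; lra].
Qed.

(** With [v = ln u] this reads [v^2 <= (2 sinh (v/2))^2], a consequence of [sinh y >= y] for
    [y >= 0]. *)
Lemma ln_sq_le (u : R) : 0 < u -> (ln u) ^ 2 <= u + / u - 2.
Proof.
  intros Hu; rewrite <- (exp_ln u Hu) at 2 3; rewrite <- exp_Ropp.
  set (v := ln u); clearbody v; clear u Hu.
  assert (H : forall y, 0 <= y -> 2 * y <= exp y - exp (- y)).
  { intros y Hy; destruct (Req_dec y 0) as [->|Hy0]; [rewrite Ropp_0; lra|].
    destruct (MVT_gen (fun y => exp y - exp (- y)) 0 y (fun y => exp y + exp (- y))) as (c & Hc & E).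
    - intros x _; auto_derive; auto; ring.
    - intros x _; apply continuity_pt_filterlim.
      apply (ex_derive_continuous (K := R_AbsRing) (V := R_NormedModule) (fun y => exp y - exp (- y))); auto_derive; auto.
    - rewrite Ropp_0, Rminus_diag in E; try rewrite Rminus_0_r in E.
      assert (2 <= exp c + exp (- c)).
      { rewrite exp_Ropp; pose proof (exp_pos c).
        assert (0 <= (exp c - 1) ^ 2 / exp c) by (apply Rdiv_le_0_compat; auto; apply pow2_ge_0).
        replace ((exp c - 1) ^ 2 / exp c) with (exp c + / exp c - 2) in H0 by (field; lra); lra. }
      nra. }
  assert (Hs : forall v, 0 <= v -> v ^ 2 <= exp v + exp (- v) - 2).
  { clear v; intros v Hv; specialize (H (v / 2) ltac:(lra)).
    pose proof (exp_pos (v / 2)); pose proof (exp_pos (- (v / 2))).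
    assert (E1 : exp v = exp (v / 2) * exp (v / 2)) by (rewrite <- exp_plus; f_equal; lra).
    assert (E2 : exp (- v) = exp (- (v / 2)) * exp (- (v / 2))) by (rewrite <- exp_plus; f_equal; lra).
    assert (E3 : exp (v / 2) * exp (- (v / 2)) = 1) by (rewrite <- exp_plus, <- exp_0; f_equal; lra).
    rewrite E1, E2; nra. }
  destruct (Rle_dec 0 v) as [Hv|Hv]; [apply Hs; auto|].
  specialize (Hs (- v) ltac:(lra)); rewrite Ropp_involutive in Hs.
  replace ((- v) ^ 2) with (v ^ 2) in Hs by ring; lra.
Qed.

Lemma cos_ge_quadratic (y : R) : 1 - y ^ 2 / 2 <= cos y.
Proof.
  replace y with (2 * (y / 2)) at 2 by field.
  rewrite cos_2a_sin.
  assert (H0 : forall z, 0 <= z -> Rabs (sin z) <= Rabs z).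
  { intros z Hz; destruct (Req_dec z 0) as [->|Hz0]; [rewrite sin_0; lra|].
    rewrite (Rabs_right z) by lra; apply Rabs_le; split; [|left; apply sin_lt_x; lra].
    destruct (Rle_dec z PI).
    - pose proof (sin_ge_0 z ltac:(lra) ltac:(lra)); lra.
    - pose proof (SIN_bound z); pose proof PI2_1; lra. }
  assert (H : Rabs (sin (y / 2)) <= Rabs (y / 2)).
  { destruct (Rle_dec 0 (y / 2)) as [Hy|Hy]; [auto|].
    rewrite <- (Rabs_Ropp (sin _)), <- (Rabs_Ropp (y / 2)), <- sin_neg; apply H0; lra. }
  apply Rsqr_le_abs_1 in H; unfold Rsqr in H; nra.
Qed.

(* After rotating by [a^(-it)] the integrand has real part
   [x^(a-1) e^(-x) cos(t ln(x/a))], and the Gamma density concentrates near [x = a]. *)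
Lemma CGamma_neq_0_large (a t : R) : 1 < a -> t ^ 2 < 2 * (a - 1) -> CGamma (a, t) <> 0%C.
Proof.
  intros Ha Ht E0.
  assert (Hs : 0 < Re ((a, t) : C)) by (unfold Re; simpl; lra).
  pose proof (is_CInt_gen_Re (at_right 0) p_oo _ _
    (is_CInt_gen_scal (at_right 0) p_oo (Rcpow a (0, - t)) _ _ (is_CInt_CGamma (a, t) Hs))) as H1.
  rewrite E0, Cmult_0_r in H1; change (Re 0) with 0 in H1.
  assert (HG : forall b, 0 < b -> is_RInt_gen (fun x => Rpower x (b - 1) * exp (- x)) (at_right 0) p_oo (Re (CGamma (RtoC b)))).
  { intros b Hb.
    pose proof (is_CInt_gen_Re (at_right 0) p_oo _ _ (is_CInt_CGamma (RtoC b) Hb)) as H.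
    revert H; apply (is_RInt_gen_ext (V := R_NormedModule)); apply filter_forall; intros uv x _.
    unfold gamma_integrand; rewrite <- RtoC_minus, Rcpow_RtoC, <- RtoC_mult; reflexivity. }
  set (g := fun b => Re (CGamma (RtoC b))) in *.
  assert (Hrec : forall b, 0 < b -> g (b + 1) = b * g b).
  { intros b Hb; unfold g; rewrite RtoC_plus, CGamma_plus_1 by auto.
    rewrite (CGamma_real b Hb), <- RtoC_mult; reflexivity. }
  (* The integrand assembled below is [x^(a-1) e^(-x) (cos (t ln (x/a)) - 1 + k (x/a + a/x - 2))],
     nonnegative by the quadratic bound on [cos] and [ln_sq_le]. If [CGamma (a, t)] vanished, the
     recurrence would make its integral [g (a - 1) (k - (a - 1)) < 0]. *)
  set (k := t ^ 2 / 2).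
  pose proof (is_RInt_0_oo_plus _ _ _ _ H1
    (is_RInt_0_oo_plus _ _ _ _ (is_RInt_0_oo_scal _ (- (1 + 2 * k)) _ (HG a ltac:(lra)))
      (is_RInt_0_oo_plus _ _ _ _ (is_RInt_0_oo_scal _ (k / a) _ (HG (a + 1) ltac:(lra)))
        (is_RInt_0_oo_scal _ (k * a) _ (HG (a - 1) ltac:(lra)))))) as H.
  apply is_RInt_gen_0_oo_ge_0 in H.
  - fold (g a) (g (a + 1)) (g (a - 1)) in H.
    pose proof (CGamma_real_pos a ltac:(lra)) as Hp; fold (g a) in Hp.
    pose proof (Hrec a ltac:(lra)) as R1; pose proof (Hrec (a - 1) ltac:(lra)) as R2.
    replace (a - 1 + 1) with a in R2 by ring; rewrite R1, R2 in H.
    pose proof (CGamma_real_pos (a - 1) ltac:(lra)) as Hp1; fold (g (a - 1)) in Hp1.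
    assert (g (a - 1) * (k - (a - 1)) >= 0).
    { apply Rle_ge; eapply Rle_trans; [exact H|right; field; lra]. }
    assert (k < a - 1) by (unfold k; lra); nra.
  - intros x Hx.
    apply (continuous_plus (V := R_NormedModule)).
    + apply continuous_C_fst, (continuous_Cmult (fun _ => Rcpow a (0, - t)));
        [apply continuous_RC_const|apply continuous_gamma_integrand; auto].
    + apply (ex_derive_continuous (K := R_AbsRing) (V := R_NormedModule)).
      unfold Rpower; auto_derive; auto.
  - intros x Hx.
    assert (E : Re (Rcpow a (0, - t) * gamma_integrand (a, t) x)
      = Rpower x (a - 1) * exp (- x) * cos (t * ln (x / a))).
    { unfold gamma_integrand, Rcpow; rewrite Cmult_assoc, <- Cexp_plus.
      replace (((0, - t)%R : C) * RtoC (ln a) + ((a, t) - 1) * RtoC (ln x))%C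
        with (((a - 1) * ln x, t * ln (x / a))%R : C).
      - unfold Cexp, Re, Im, Rpower; simpl; ring.
      - rewrite ln_div by lra; apply Ceq; simpl; ring. }
    rewrite E.
    pose proof (Rpower_pos x (a - 1)) as Hp; pose proof (exp_pos (- x)) as He.
    assert (E1 : Rpower x (a + 1 - 1) = Rpower x (a - 1) * x).
    { replace (a + 1 - 1) with (a - 1 + 1) by ring; rewrite Rpower_plus, Rpower_1; auto. }
    assert (E2 : Rpower x (a - 1 - 1) = Rpower x (a - 1) * / x).
    { unfold Rminus at 1; rewrite Rpower_plus, Rpower_Ropp, Rpower_1; auto. }
    rewrite E1, E2.
    pose proof (cos_ge_quadratic (t * ln (x / a))) as Hcos.
    pose proof (ln_sq_le (x / a) ltac:(apply Rdiv_lt_0_compat; lra)) as Hln.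
    replace (/ (x / a)) with (a * / x) in Hln by (field; lra).
    assert (Hk : 0 <= k) by (unfold k; pose proof (pow2_ge_0 t); lra).
    assert (Hc2 : 1 - k * (x / a + a * / x - 2) <= cos (t * ln (x / a))).
    { eapply Rle_trans; [|exact Hcos].
      replace ((t * ln (x / a)) ^ 2 / 2) with (k * ln (x / a) ^ 2) by (unfold k; field).
      apply Rplus_le_compat_l, Ropp_le_contravar, Rmult_le_compat_l; auto. }
    assert (Hpe : 0 < Rpower x (a - 1) * exp (- x)) by (apply Rmult_lt_0_compat; auto).
    apply Rle_trans with (Rpower x (a - 1) * exp (- x) *
      (cos (t * ln (x / a)) - (1 - k * (x / a + a * / x - 2)))).
    + apply Rmult_le_pos; lra.
    + right; field; lra.
Qed.

(** By the recurrence a zero at [s] is also a zero at every [s + n]; for large [n] this meets the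
    region [t^2 < 2 (a - 1)], where there is none. *)
Lemma CGamma_neq_0 (s : C) : 0 < Re s -> CGamma s <> 0%C.
Proof.
  intros Hs E.
  assert (H : forall n, CGamma (s + RtoC (INR n)) = 0%C).
  { intros n; induction n as [|n IH]; [simpl; rewrite Cplus_0_r; auto|].
    rewrite S_INR, RtoC_plus, Cplus_assoc, CGamma_plus_1, IH; [ring|].
    destruct s; unfold Re in *; simpl in *; pose proof (pos_INR n); lra. }
  destruct (nfloor_ex (Im s ^ 2 + 2)) as [n [Hn1 Hn2]]; [nra|].
  apply (CGamma_neq_0_large (Re s + INR (S n)) (Im s)); try (rewrite S_INR; nra).
  rewrite <- (H (S n)); f_equal; destruct s; apply Ceq; unfold Re, Im; simpl; ring.
Qed.

Lemma Rpower_abs_ln_bound (r x : R) : 0 < r -> 0 < x ->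
  (x <= 1 -> exp (r * Rabs (ln x)) = Rpower x (- r)) /\ (1 <= x -> exp (r * Rabs (ln x)) = Rpower x r).
Proof.
  intros Hr Hx; unfold Rpower; split; intros H.
  - f_equal; rewrite Rabs_left1; [ring|rewrite <- ln_1; apply ln_le; lra].
  - f_equal; rewrite Rabs_right; [ring|apply Rle_ge; rewrite <- ln_1; apply ln_le; lra].
Qed.

(** The first-order estimate of [x^(w-s) - 1] produces [|ln x|], absorbed by
    [r |ln x| <= e^(r |ln x|)]; with the exponential already present this makes [2 r]. *)
Lemma Rcpow_diff_bound (x r : R) (s w : C) : 0 < x -> 0 < r -> Cmod (w - s) <= r ->
  Cmod (Rcpow x w - Rcpow x s) <= Cmod (w - s) / r * (Rpower x (Re s) * exp (2 * r * Rabs (ln x))).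
Proof.
  intros Hx Hr Hw.
  replace (Rcpow x w - Rcpow x s)%C with (Rcpow x s * (Cexp ((w - s) * RtoC (ln x)) - 1))%C.
  2:{ change (Cexp ((w - s) * RtoC (ln x))) with (Rcpow x (w - s)).
      replace (Rcpow x w) with (Rcpow x s * Rcpow x (w - s))%C by (rewrite <- Rcpow_plus; f_equal; ring).
      ring. }
  rewrite Cmod_mult, Cmod_Rcpow.
  pose proof (Cexp_remainder 0 ((w - s) * RtoC (ln x))) as H.
  rewrite Cexp_poly_0, Cmod_mult, Cmod_R in H; simpl in H.
  rewrite Rmult_1_r, Rdiv_1_r in H.
  pose proof (Rpower_pos x (Re s)); pose proof (Cmod_ge_0 (w - s)); pose proof (Rabs_pos (ln x)).
  replace (Cmod (w - s) / r * (Rpower x (Re s) * exp (2 * r * Rabs (ln x))))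
    with (Rpower x (Re s) * (Cmod (w - s) / r * exp (2 * r * Rabs (ln x)))) by ring.
  apply Rmult_le_compat_l; [lra|].
  eapply Rle_trans; [exact H|].
  replace (2 * r * Rabs (ln x)) with (r * Rabs (ln x) + r * Rabs (ln x)) by ring; rewrite exp_plus.
  assert (E1 : r * Rabs (ln x) <= exp (r * Rabs (ln x))).
  { pose proof (exp_ineq1_le (r * Rabs (ln x))); lra. }
  assert (E2 : exp (Cmod (w - s) * Rabs (ln x)) <= exp (r * Rabs (ln x))).
  { apply exp_le_exp, Rmult_le_compat_r; auto. }
  replace (Cmod (w - s) * Rabs (ln x)) with (Cmod (w - s) / r * (r * Rabs (ln x))) at 1 by (field; lra).
  assert (0 <= Cmod (w - s) / r) by (apply Rdiv_le_0_compat; auto).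
  rewrite Rmult_assoc; apply Rmult_le_compat_l; auto.
  apply Rmult_le_compat; auto; [nra|left; apply exp_pos].
Qed.

Lemma CGamma_cont (s : C) : 0 < Re s -> Clim_at CGamma s (CGamma s).
Proof.
  intros Hs.
  (* As [Re s = 4 r], the loss [2 r] leaves the exponent [2 r - 1] at [0], still integrable. *)
  set (r := Re s / 4).
  assert (Hr : 0 < r) by (unfold r; lra).
  (* At infinity the exponent is [6 r - 1 = (- 2 r - 1) + 8 r], and [e^(-x)] pays for [x^(8 r)]. *)
  destruct (Rpower_exp_bounded (8 * r)) as (B & HB1 & HB).
  assert (HL : forall w, Cmod (w - s) < r ->
    Cmod (CGamma w - CGamma s) <= 4 * (Cmod (w - s) / r * B) / (2 * r)).
  { intros w Hw.
    assert (Hrew : 0 < Re w).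
    { pose proof (re_le_Cmod (w - s)) as H; apply Rabs_le_between in H.
      destruct w, s; unfold Re in *; simpl in *; unfold r in *; lra. }
    assert (H0 : 0 <= Cmod (w - s) / r) by (apply Rdiv_le_0_compat; auto; apply Cmod_ge_0).
    assert (Hb : forall x, 0 < x -> Cmod (gamma_integrand w x - gamma_integrand s x) <=
      Cmod (w - s) / r * (Rpower x (Re s - 1) * exp (2 * r * Rabs (ln x)) * exp (- x))).
    { intros x Hx; unfold gamma_integrand.
      replace (Rcpow x (w - 1) * RtoC (exp (- x)) - Rcpow x (s - 1) * RtoC (exp (- x)))%C
        with ((Rcpow x (w - 1) - Rcpow x (s - 1)) * RtoC (exp (- x)))%C by ring.
      rewrite Cmod_mult, Cmod_R, Rabs_right by (left; apply exp_pos).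
      pose proof (Rcpow_diff_bound x r (s - 1) (w - 1) Hx Hr) as H.
      replace (w - 1 - (s - 1))%C with (w - s)%C in H by ring.
      replace (Re (s - 1)) with (Re s - 1) in H by (destruct s; unfold Re; simpl; ring).
      rewrite <- Rmult_assoc; apply Rmult_le_compat_r; [left; apply exp_pos|apply H; lra]. }
    destruct (ex_CInt_0_oo (fun x => gamma_integrand w x - gamma_integrand s x)%C (2 * r)
      (Cmod (w - s) / r * B)) as (l & Hl & Hlb).
    - lra.
    - apply Rmult_le_pos; lra.
    - intros x Hx; apply continuous_RC_minus; apply continuous_gamma_integrand; auto.
    - intros x Hx; eapply Rle_trans; [apply Hb; lra|].
      rewrite (Rmult_assoc (Cmod (w - s) / r) B); apply Rmult_le_compat_l; auto.
      rewrite (proj1 (Rpower_abs_ln_bound (2 * r) x ltac:(lra) ltac:(lra))) by lra.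
      rewrite <- Rpower_plus; replace (Re s - 1 + - (2 * r)) with (2 * r - 1) by (unfold r; field).
      pose proof (Rpower_pos x (2 * r - 1)); pose proof (exp_opp_le_1 x ltac:(lra)); nra.
    - intros x Hx; eapply Rle_trans; [apply Hb; lra|].
      rewrite (Rmult_assoc (Cmod (w - s) / r) B); apply Rmult_le_compat_l; auto.
      rewrite (proj2 (Rpower_abs_ln_bound (2 * r) x ltac:(lra) ltac:(lra))) by lra.
      rewrite <- Rpower_plus.
      replace (Re s - 1 + 2 * r) with (- (2 * r) - 1 + 8 * r) by (unfold r; field).
      rewrite Rpower_plus, Rmult_assoc, Rmult_comm; apply Rmult_le_compat_r; [left; apply Rpower_pos|].
      apply HB; auto.
    - rewrite (is_CInt_0_oo_unique (fun x => gamma_integrand w x - gamma_integrand s x)%C (CGamma w - CGamma s) l); auto.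
      apply is_CInt_0_oo_minus; apply is_CInt_CGamma; auto. }
  intros eps He.
  set (K := 4 * B / (r * (2 * r))).
  assert (HK : 0 < K) by (unfold K; apply Rdiv_lt_0_compat; nra).
  exists (Rmin r (eps / K)); split; [apply Rmin_glb_lt; auto; apply Rdiv_lt_0_compat; auto|].
  intros w Hw.
  eapply Rle_lt_trans; [apply HL; eapply Rlt_le_trans; [exact Hw|apply Rmin_l]|].
  replace (4 * (Cmod (w - s) / r * B) / (2 * r)) with (Cmod (w - s) * K) by (unfold K; field; lra).
  apply Rlt_div_r; auto; eapply Rlt_le_trans; [exact Hw|apply Rmin_r].
Qed.

(** * Analytic continuation of the zeta function *)

Notation is_CInt_1_oo f l := (is_CInt_gen f (at_point 1) p_oo l).

Lemma is_CInt_1_oo_unique (f : R -> C) (l l' : C) : is_CInt_1_oo f l -> is_CInt_1_oo f l' -> l = l'.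
Proof.
  intros H H'; rewrite <- (is_RInt_gen_unique (V := CV) f l H); apply (is_RInt_gen_unique (V := CV)); auto.
Qed.

Lemma is_CInt_1_oo_ext (f g : R -> C) (l : C) :
  (forall x, 1 <= x -> f x = g x) -> is_CInt_1_oo f l -> is_CInt_1_oo g l.
Proof.
  intros H; apply (is_RInt_gen_ext (V := CV)).
  exists (fun x => x = 1) (fun x => 1 <= x); [reflexivity|apply (p_oo_intro _ 1); intros; lra|].
  intros x y -> Hy z Hz; simpl in Hz; rewrite Rmin_left in Hz by lra; apply H; lra.
Qed.

Lemma is_CInt_1_oo_plus (f g : R -> C) (l m : C) :
  is_CInt_1_oo f l -> is_CInt_1_oo g m -> is_CInt_1_oo (fun x => f x + g x)%C (l + m)%C.
Proof. apply (is_RInt_gen_plus (V := CV)). Qed.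

Lemma is_CInt_1_oo_minus (f g : R -> C) (l m : C) :
  is_CInt_1_oo f l -> is_CInt_1_oo g m -> is_CInt_1_oo (fun x => f x - g x)%C (l - m)%C.
Proof. apply (is_RInt_gen_minus (V := CV)). Qed.

Lemma ln_ge_0 (x : R) : 1 <= x -> 0 <= ln x.
Proof. intros Hx; rewrite <- ln_1; apply ln_le; lra. Qed.

Definition mellin_integrand (p : R -> R) (s : C) (x : R) : C := (RtoC (p x) * Rcpow x (- s))%C.

Definition mellin_1_oo (p : R -> R) (s : C) : C :=
  @RInt_gen CV (mellin_integrand p s) (at_point 1) p_oo.

Lemma continuous_mellin_integrand (p : R -> R) (s : C) (x : R) :
  (forall x, continuous p x) -> 0 < x -> continuous_RC (mellin_integrand p s) x.
Proof.
  intros Hp Hx; apply (continuous_Cmult (fun x => RtoC (p x)) (fun x => Rcpow x (- s))).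
  - apply continuous_RtoC; auto.
  - apply continuous_Rcpow; auto.
Qed.

Lemma Cmod_mellin_integrand (p : R -> R) (B : R) (s : C) (x : R) :
  (forall x, Rabs (p x) <= B) -> Cmod (mellin_integrand p s x) <= B * Rpower x (- Re s).
Proof.
  intros Hp; unfold mellin_integrand; rewrite Cmod_mult, Cmod_R, Cmod_Rcpow.
  replace (Re (- s)) with (- Re s) by (destruct s; reflexivity).
  apply Rmult_le_compat_r; auto; left; apply Rpower_pos.
Qed.

Lemma is_CInt_mellin_1_oo (p : R -> R) (B : R) (s : C) :
  (forall x, continuous p x) -> (forall x, Rabs (p x) <= B) -> 1 < Re s ->
  is_CInt_1_oo (mellin_integrand p s) (mellin_1_oo p s).
Proof.
  intros Hc HB Hs.
  destruct (ex_CInt_1_oo (mellin_integrand p s) (Re s) B) as (l & Hl & _); auto.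
  - intros x Hx; apply continuous_mellin_integrand; auto; lra.
  - intros x Hx; apply Cmod_mellin_integrand; auto.
  - unfold mellin_1_oo; rewrite (is_RInt_gen_unique (V := CV) (mellin_integrand p s) l Hl); auto.
Qed.

Lemma continuous_Cexp_poly_ln (N : nat) (z : C) (x : R) : 0 < x ->
  continuous_RC (fun x => Cexp_poly N (z * RtoC (- ln x))) x.
Proof.
  intros Hx.
  assert (Hl : continuous_RC (fun x => z * RtoC (- ln x))%C x).
  { apply (continuous_Cmult (fun _ => z) (fun x => RtoC (- ln x))); [apply continuous_RC_const|].
    apply continuous_RtoC; continuous_by_derive; auto. }
  assert (Hpow : forall k, continuous_RC (fun x => (z * RtoC (- ln x)) ^ k)%C x).
  { intros k; induction k as [|k IH]; [apply continuous_RC_const|].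
    apply (continuous_Cmult (fun x => z * RtoC (- ln x))%C (fun x => (z * RtoC (- ln x)) ^ k)%C); auto. }
  induction N as [|N IH].
  - apply (continuous_ext (T := R_UniformSpace) (U := CV) (fun _ => RtoC 1)); [|apply continuous_RC_const].
    intros y; rewrite Cexp_poly_0; auto.
  - apply (continuous_ext (T := R_UniformSpace) (U := CV)
      (fun x => Cexp_poly N (z * RtoC (- ln x)) + (z * RtoC (- ln x)) ^ (S N) * RtoC (/ INR (fact (S N))))%C).
    + intros y; rewrite Cexp_poly_S; auto.
    + apply continuous_RC_plus; auto.
      apply (continuous_Cmult (fun x => (z * RtoC (- ln x)) ^ S N)%C (fun _ => RtoC (/ INR (fact (S N))))); auto.
      apply continuous_RC_const.
Qed.

(* Expanding [x^(-s)] in powers of [s - s0], the [N]th remainder is at most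
   [2^(-N-1) x^(-Re s0 + 3 |s - s0|)], which is still integrable. *)
Lemma mellin_1_oo_analytic (p : R -> R) (B : R) (s0 : C) :
  (forall x, continuous p x) -> (forall x, Rabs (p x) <= B) -> 1 < Re s0 ->
  analytic_at (mellin_1_oo p) s0.
Proof.
  intros Hc HB Hs.
  (* Then [Re s0 - 3 r - 1 = r > 0]: a loss of [x^(3 r)] keeps the integral convergent. *)
  set (r := (Re s0 - 1) / 4).
  assert (Hr : 0 < r) by (unfold r; lra).
  assert (HB0 : 0 <= B) by (eapply Rle_trans; [apply Rabs_pos|apply (HB 0)]).
  set (c := fun (k : nat) (x : R) => (mellin_integrand p s0 x * RtoC ((- ln x) ^ k / INR (fact k)))%C).
  assert (Hck : forall k x, 0 < x -> continuous_RC (c k) x).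
  { intros k x Hx; apply (continuous_Cmult (mellin_integrand p s0) (fun x => RtoC ((- ln x) ^ k / INR (fact k)))).
    - apply continuous_mellin_integrand; auto.
    - apply continuous_RtoC; continuous_by_derive; auto. }
  assert (Hk : forall k, exists l, is_CInt_1_oo (c k) l).
  { intros k.
    destruct (ex_CInt_1_oo (c k) (Re s0 - r) (B * / r ^ k)) as (l & Hl & _); [unfold r; lra| | |exists l; auto].
    - intros x Hx; apply Hck; lra.
    - intros x Hx; unfold c; rewrite Cmod_mult, Cmod_R.
      pose proof (ln_ge_0 x Hx) as Hln.
      assert (Hrk : 0 < r ^ k) by (apply pow_lt; auto).
      (* One term of the exponential series of [r ln x] is at most its sum [x^r]. *)
      assert (E1 : Rabs ((- ln x) ^ k / INR (fact k)) <= / r ^ k * Rpower x r).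
      { unfold Rdiv; rewrite Rabs_mult, <- RPow_abs, Rabs_Ropp, (Rabs_right (ln x)) by lra.
        rewrite (Rabs_right (/ _)) by (left; apply Rinv_0_lt_compat, INR_fact_lt_0).
        pose proof (pow_div_fact_le_exp (r * ln x) k ltac:(nra)) as H.
        rewrite Rpow_mult_distr in H.
        unfold Rpower; apply Rmult_le_reg_l with (r ^ k); auto.
        rewrite <- !Rmult_assoc, Rinv_r, Rmult_1_l by lra; exact H. }
      pose proof (Cmod_mellin_integrand p B s0 x HB).
      replace (- (Re s0 - r)) with (- Re s0 + r) by ring; rewrite Rpower_plus.
      replace (B * / r ^ k * (Rpower x (- Re s0) * Rpower x r))
        with ((B * Rpower x (- Re s0)) * (/ r ^ k * Rpower x r)) by ring.
      apply Rmult_le_compat; auto; [apply Cmod_ge_0|apply Rabs_pos]. }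
  set (a := fun k => proj1_sig (constructive_indefinite_description _ (Hk k))).
  assert (Ha : forall k, is_CInt_1_oo (c k) (a k)).
  { intros k; unfold a; destruct (constructive_indefinite_description _ (Hk k)); auto. }
  exists a, r; split; auto; intros s Hs1.
  set (rho := Cmod (s - s0)) in *.
  assert (Hrho : 0 <= rho) by apply Cmod_ge_0.
  assert (Hsum : forall N, is_CInt_1_oo
     (fun x => mellin_integrand p s0 x * Cexp_poly N ((s - s0) * RtoC (- ln x)))%C
     (@sum_n C_Ring (fun k => ((s - s0) ^ k * a k)%C) N)).
  { intros N; induction N as [|N IH].
    - rewrite sum_O.
      generalize (is_CInt_gen_scal (at_point 1) p_oo ((s - s0) ^ 0)%C _ _ (Ha 0%nat)).
      apply is_CInt_1_oo_ext; intros x Hx; unfold c; rewrite Cexp_poly_0; simpl.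
      rewrite Rdiv_1_r; ring.
    - rewrite sum_Sn.
      generalize (is_CInt_1_oo_plus _ _ _ _ IH (is_CInt_gen_scal (at_point 1) p_oo ((s - s0) ^ (S N))%C _ _ (Ha (S N)))).
      apply is_CInt_1_oo_ext; intros x Hx; unfold c; rewrite Cexp_poly_S, Cpow_mult_l.
      unfold Rdiv; rewrite RtoC_mult, <- RtoC_pow; ring. }
  assert (Hre : 1 < Re s).
  { pose proof (re_le_Cmod (s - s0)) as H; apply Rabs_le_between in H; fold rho in H.
    destruct s, s0; unfold Re in *; simpl in *; unfold r in *; lra. }
  pose proof (is_CInt_mellin_1_oo p B s Hc HB Hre) as HI.
  set (K := B / (Re s0 - 3 * r - 1)).
  assert (Herr : forall N, Cmod (@sum_n C_Ring (fun k => ((s - s0) ^ k * a k)%C) N - mellin_1_oo p s)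
     <= K * (1 / 2) ^ (S N)).
  { intros N.
    destruct (ex_CInt_1_oo (fun x => mellin_integrand p s0 x * Cexp_poly N ((s - s0) * RtoC (- ln x))
                 - mellin_integrand p s x)%C (Re s0 - 3 * r) (B * (1 / 2) ^ (S N))) as (l & Hl & Hlb).
    - unfold r; lra.
    - intros x Hx; apply continuous_RC_minus; [|apply continuous_mellin_integrand; auto; lra].
      apply (continuous_Cmult (mellin_integrand p s0) (fun x => Cexp_poly N ((s - s0) * RtoC (- ln x)))).
      + apply continuous_mellin_integrand; auto; lra.
      + apply continuous_Cexp_poly_ln; lra.
    - intros x Hx.
      set (z := ((s - s0) * RtoC (- ln x))%C).
      replace (mellin_integrand p s x) with (mellin_integrand p s0 x * Cexp z)%C.
      2:{ unfold mellin_integrand, Rcpow, z; rewrite <- Cmult_assoc, <- Cexp_plus, RtoC_opp; f_equal; f_equal; ring. }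
      replace (mellin_integrand p s0 x * Cexp_poly N z - mellin_integrand p s0 x * Cexp z)%C
        with (mellin_integrand p s0 x * (Cexp_poly N z - Cexp z))%C by ring.
      rewrite Cmod_mult, (Cmod_sub_comm (Cexp_poly N z)).
      pose proof (ln_ge_0 x Hx) as Hln.
      assert (Hz : Cmod z = rho * ln x).
      { unfold z; rewrite Cmod_mult, Cmod_R, Rabs_Ropp, Rabs_right by lra; auto. }
      (* Doubling the argument gains [2^(-N-1)] at the price of [x^(2 rho)]; the exponential factor
         in [Cexp_remainder] costs one more [x^rho]. *)
      assert (Hrem : Cmod (Cexp z - Cexp_poly N z) <= (1 / 2) ^ (S N) * Rpower x (3 * r)).
      { eapply Rle_trans; [apply Cexp_remainder|]; rewrite Hz.
        pose proof (pow_div_fact_le_exp (2 * (rho * ln x)) (S N) ltac:(nra)) as H.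
        assert (E : (rho * ln x) ^ S N / INR (fact (S N)) <= (1 / 2) ^ (S N) * exp (2 * (rho * ln x))).
        { replace ((rho * ln x) ^ S N) with ((1 / 2) ^ S N * (2 * (rho * ln x)) ^ S N).
          - unfold Rdiv at 1; rewrite Rmult_assoc; apply Rmult_le_compat_l; [apply pow_le; lra|exact H].
          - rewrite <- Rpow_mult_distr; f_equal; field. }
        apply Rle_trans with ((1 / 2) ^ S N * exp (2 * (rho * ln x)) * exp (rho * ln x)).
        - apply Rmult_le_compat_r; [left; apply exp_pos|exact E].
        - rewrite Rmult_assoc, <- exp_plus; apply Rmult_le_compat_l; [apply pow_le; lra|].
          unfold Rpower; apply exp_le_exp; nra. }
      pose proof (Cmod_mellin_integrand p B s0 x HB).
      replace (- (Re s0 - 3 * r)) with (- Re s0 + 3 * r) by ring; rewrite Rpower_plus.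
      replace (B * (1 / 2) ^ S N * (Rpower x (- Re s0) * Rpower x (3 * r)))
        with ((B * Rpower x (- Re s0)) * ((1 / 2) ^ S N * Rpower x (3 * r))) by ring.
      apply Rmult_le_compat; auto; apply Cmod_ge_0.
    - rewrite (is_CInt_1_oo_unique _ _ _ (is_CInt_1_oo_minus _ _ _ _ (Hsum N) HI) Hl).
      eapply Rle_trans; [exact Hlb|right; unfold K, Rdiv; ring]. }
  apply (filterlim_ext (@sum_n C_Ring (fun k => ((s - s0) ^ k * a k)%C))).
  { intros N; apply (sum_n_ext (G := C_Ring)); intros k; rewrite <- (pow_n_Cpow (s - s0)); reflexivity. }
  apply (filterlim_C_iff eventually); intros eps He.
  pose proof (is_lim_seq_geom (1 / 2) ltac:(rewrite Rabs_right; lra)) as Hg.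
  assert (HK : 0 <= K) by (unfold K; apply Rdiv_le_0_compat; auto; unfold r; lra).
  assert (Hp : 0 < eps / (K + 1)) by (apply Rdiv_lt_0_compat; lra).
  destruct (proj1 (filterlim_R_iff eventually _ 0) Hg _ Hp) as [N0 HN0].
  exists N0; intros N HN.
  eapply Rle_lt_trans; [apply Herr|].
  specialize (HN0 (S N) ltac:(lia)).
  assert (0 <= (1 / 2) ^ S N) by (apply pow_le; lra).
  rewrite Rminus_0_r, Rabs_right in HN0 by lra.
  apply Rlt_div_r in HN0; [|lra]; nra.
Qed.

(** * Periodic functions of mean zero and repeated integration by parts *)

Definition periodic_mean_0 (p : R -> R) : Prop :=
  (forall x, continuous p x) /\ (forall x, p (x + 1) = p x) /\ is_RInt p 0 1 0.

Lemma periodic_IZR (p : R -> R) (x : R) (n : Z) : (forall x, p (x + 1) = p x) -> p (x + IZR n) = p x.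
Proof.
  intros Hp.
  assert (Hn : forall k x, p (x + INR k) = p x).
  { intros k; induction k as [|k IH]; intros y; [simpl; f_equal; ring|].
    rewrite S_INR, <- Rplus_assoc, Hp; auto. }
  destruct (Z_le_gt_dec 0 n) as [H|H].
  - rewrite <- (Z2Nat.id n), <- INR_IZR_INZ by auto; apply Hn.
  - rewrite <- (Hn (Z.to_nat (- n)) (x + IZR n)); f_equal.
    rewrite INR_IZR_INZ, Z2Nat.id, opp_IZR by lia; ring.
Qed.

Lemma Int_part_bounds (x : R) : IZR (Int_part x) <= x < IZR (Int_part x) + 1.
Proof. pose proof (base_Int_part x); lra. Qed.

Lemma periodic_bounded (p : R -> R) : periodic_mean_0 p -> exists B, forall x, Rabs (p x) <= B.
Proof.
  intros (Hc & Hp & _).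
  destruct (continuity_ab_maj (fun x => Rabs (p x)) 0 1) as (M & HM & _); [lra| |].
  - intros x _; apply continuity_pt_filterlim.
    apply (continuous_comp (U := R_UniformSpace) (V := R_UniformSpace) p Rabs); auto; apply continuous_Rabs.
  - exists (Rabs (p M)); intros x.
    pose proof (Int_part_bounds x).
    replace x with (x - IZR (Int_part x) + IZR (Int_part x)) by ring.
    rewrite periodic_IZR by auto; apply HM; lra.
Qed.

(** Mean zero makes the primitive periodic, and subtracting the mean [m] of that primitive restores
    mean zero, so the construction can be iterated. *)
Lemma periodic_primitive (p : R -> R) : periodic_mean_0 p ->
  exists q, periodic_mean_0 q /\ forall x, is_derive q x (p x).
Proof.
  intros (Hc & Hp & Hm).
  assert (Hex : forall a b, ex_RInt p a b).
  { intros a b; apply (ex_RInt_continuous (V := R_CompleteNormedModule)); intros; apply Hc. }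
  set (q0 := fun x => RInt p 0 x).
  assert (Hd : forall x, is_derive q0 x (p x)).
  { intros x; apply (is_derive_RInt (V := R_NormedModule) p q0 0 x); [|apply Hc].
    apply filter_forall; intros y; apply (RInt_correct (V := R_CompleteNormedModule)); auto. }
  assert (Hq0c : forall x, continuous q0 x).
  { intros x; apply (ex_derive_continuous (K := R_AbsRing) (V := R_NormedModule)); eexists; apply Hd. }
  set (m := RInt q0 0 1).
  exists (fun x => q0 x - m); split.
  - repeat split.
    + intros x; apply (continuous_minus (V := R_NormedModule)); auto; apply continuous_const.
    + intros x.
      assert (E : q0 (x + 1) = q0 x); [|rewrite E; auto].
      unfold q0.
      rewrite <- (RInt_Chasles p 0 1 (x + 1)), (is_RInt_unique _ _ _ _ Hm) by auto.
      change (0 + RInt p 1 (x + 1) = RInt p 0 x); rewrite Rplus_0_l.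
      pose proof (RInt_comp_lin p 1 1 0 x) as H.
      rewrite Rmult_0_r, Rplus_0_l, Rmult_1_l in H.
      rewrite <- H by auto; apply RInt_ext; intros y _.
      unfold scal; simpl; unfold mult; simpl; rewrite !Rmult_1_l; apply Hp.
    + assert (Hq : is_RInt q0 0 1 m).
      { apply (RInt_correct (V := R_CompleteNormedModule)), (ex_RInt_continuous (V := R_CompleteNormedModule)); auto. }
      pose proof (is_RInt_minus (V := R_NormedModule) _ _ _ _ _ _ Hq (is_RInt_const (V := R_NormedModule) 0 1 m)) as H.
      replace (minus (m : R_NormedModule) (scal (1 - 0) (m : R_NormedModule))) with 0 in H
        by (unfold minus, plus, opp, scal; simpl; unfold mult; simpl; ring).
      exact H.
  - intros x.
    pose proof (is_derive_minus (V := R_NormedModule) _ _ _ _ _ (Hd x) (is_derive_const (V := R_NormedModule) m x)) as H.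
    rewrite <- (Rminus_0_r (p x)); exact H.
Qed.

Lemma mellin_1_oo_by_parts (p q : R -> R) (s : C) : periodic_mean_0 p -> periodic_mean_0 q ->
  (forall x, is_derive q x (p x)) -> 1 < Re s ->
  mellin_1_oo p s = (s * mellin_1_oo q (s + 1) + - RtoC (q 1))%C.
Proof.
  intros Hp Hq Hd Hs.
  destruct (periodic_bounded p Hp) as [B HB]; destruct (periodic_bounded q Hq) as [B' HB'].
  destruct Hp as (Hpc & _); destruct Hq as (Hqc & _).
  assert (Hs1 : 1 < Re (s + 1)) by (destruct s; unfold Re in *; simpl in *; lra).
  pose proof (is_CInt_mellin_1_oo p B s Hpc HB Hs) as H1.
  pose proof (is_CInt_mellin_1_oo q B' (s + 1) Hqc HB' Hs1) as H2.
  assert (H : is_CInt_1_oo (fun x => mellin_integrand p s x - s * mellin_integrand q (s + 1) x)%C (0 - RtoC (q 1))%C).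
  { apply (is_RInt_gen_primitive (V := CV) (fun x => 1 <= x) (at_point 1) p_oo _ (mellin_integrand q s)).
    - intros a b x Ha Hb Hx; lra.
    - unfold at_point; lra.
    - apply (p_oo_intro _ 1); intros; lra.
    - intros x Hx.
      replace (mellin_integrand p s x - s * mellin_integrand q (s + 1) x)%C
        with (RtoC (p x) * Rcpow x (- s) + RtoC (q x) * (- s * Rcpow x (- s - 1)))%C.
      + apply (is_derive_Cmult (fun x => RtoC (q x)) (fun x => Rcpow x (- s))).
        * apply is_derive_RtoC; auto.
        * apply is_derive_Rcpow; lra.
      + unfold mellin_integrand; replace (- (s + 1))%C with (- s - 1)%C by ring; ring.
    - intros x Hx; apply continuous_RC_minus; [apply continuous_mellin_integrand; auto; lra|].
      apply (continuous_Cmult (fun _ => s) (mellin_integrand q (s + 1))); [apply continuous_RC_const|].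
      apply continuous_mellin_integrand; auto; lra.
    - intros P [d Pd]; unfold filtermap, at_point; apply Pd.
      unfold mellin_integrand; rewrite Rcpow_1_l, Cmult_1_r; apply ball_center.
    - apply (filterlim_C_0_bound p_oo _ (fun x => B' * Rpower x (- Re s))).
      + apply (p_oo_intro _ 1); intros x Hx; apply Cmod_mellin_integrand; auto.
      + apply filterlim_R_scal_0; [typeclasses eauto|]; apply Rpower_lim_p_oo; lra. }
  pose proof (is_CInt_1_oo_minus _ _ _ _ H1 (is_CInt_gen_scal (at_point 1) p_oo s _ _ H2)) as H'.
  pose proof (is_CInt_1_oo_unique _ _ _ H H') as E.
  replace (mellin_1_oo p s) with ((mellin_1_oo p s - s * mellin_1_oo q (s + 1)) + s * mellin_1_oo q (s + 1))%C by ring.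
  rewrite <- E; ring.
Qed.

(** Each integration by parts trades [s] for [s + 1], hence gains one unit of half-plane. *)
Lemma mellin_1_oo_continuation (K : nat) (p : R -> R) : periodic_mean_0 p ->
  exists F : C -> C, (forall s, 1 - INR K < Re s -> analytic_at F s) /\
                     (forall s, 1 < Re s -> F s = mellin_1_oo p s).
Proof.
  revert p; induction K as [|K IH]; intros p Hp.
  - exists (mellin_1_oo p); split; auto; intros s Hs; simpl in Hs.
    destruct (periodic_bounded p Hp) as [B HB]; destruct Hp as [Hc _].
    apply (mellin_1_oo_analytic p B); auto; lra.
  - destruct (periodic_primitive p Hp) as (q & Hq & Hd).
    destruct (IH q Hq) as (F & HF1 & HF2).
    exists (fun s => (s + 0) * F (s + 1) + - RtoC (q 1))%C; split.
    + intros s Hs; apply analytic_at_plus; [|apply analytic_at_const].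
      apply (analytic_at_mult_linear (fun s => F (s + 1)%C)), analytic_at_translate, HF1.
      rewrite S_INR in Hs; destruct s; unfold Re in *; simpl in *; lra.
    + intros s Hs; rewrite (mellin_1_oo_by_parts p q s), HF2, Cplus_0_r; auto.
      destruct s; unfold Re in *; simpl in *; lra.
Qed.

(** The continuations to different half-planes agree where both are analytic, so at each [s] any
    sufficiently large index gives the same value. *)
Lemma mellin_1_oo_entire (p : R -> R) : periodic_mean_0 p ->
  exists F : C -> C, (forall s, analytic_at F s) /\ (forall s, 1 < Re s -> F s = mellin_1_oo p s).
Proof.
  intros Hp.
  set (Fk := fun K => proj1_sig (constructive_indefinite_description _ (mellin_1_oo_continuation K p Hp))).
  assert (HF : forall K, (forall s, 1 - INR K < Re s -> analytic_at (Fk K) s) /\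
                     (forall s, 1 < Re s -> Fk K s = mellin_1_oo p s)).
  { intros K; unfold Fk; destruct (constructive_indefinite_description _ (mellin_1_oo_continuation K p Hp)); auto. }
  assert (Hag : forall j k s, 1 - INR j < Re s -> 1 - INR k < Re s -> Fk j s = Fk k s).
  { intros j k s Hj Hk.
    apply (identity_half_plane (Fk j) (Fk k) (Rmax (1 - INR j) (1 - INR k)) 1).
    - intros w Hw; apply HF; eapply Rle_lt_trans; [apply Rmax_l|exact Hw].
    - intros w Hw; apply HF; eapply Rle_lt_trans; [apply Rmax_r|exact Hw].
    - intros w Hw; rewrite !(fun K => proj2 (HF K)); auto.
    - apply Rmax_lub_lt; auto. }
  set (n := fun s : C => Z.to_nat (up (1 - Re s))).
  assert (Hn : forall s, 1 - INR (n s) < Re s).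
  { intros s; unfold n; pose proof (archimed (1 - Re s)) as [H _].
    destruct (Z_le_gt_dec 0 (up (1 - Re s))) as [Hz|Hz].
    - rewrite INR_IZR_INZ, Z2Nat.id by auto; lra.
    - assert (IZR (up (1 - Re s)) <= 0) by (apply IZR_le; lia).
      pose proof (pos_INR (Z.to_nat (up (1 - Re s)))); lra. }
  exists (fun s => Fk (n s) s); split.
  (* One index more than at [s] itself, so that the whole unit disc around [s] lies in the domain of
     a single [Fk]. *)
  - intros s; apply (analytic_at_ext_loc (Fk (S (n s))) _ s 1); [lra| |].
    + intros w Hw; apply Hag; auto.
      pose proof (re_le_Cmod (w - s)) as H; apply Rabs_le_between in H.
      specialize (Hn s); rewrite S_INR; destruct w, s; unfold Re in *; simpl in *; lra.
    + apply HF; specialize (Hn s); rewrite S_INR; lra.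
  - intros s Hs; apply HF; auto.
Qed.

(** * Euler-Maclaurin summation and the construction of zeta *)

Definition bernoulli_saw (x : R) : R :=
  let v := x - IZR (Int_part x) in (v ^ 2 - v) / 2 + 1 / 12.

(** The right end is included because the polynomial takes equal values at [0] and [1]. This is the
    continuity at integers that the first Bernoulli polynomial would lack. *)
Lemma bernoulli_saw_interval (n : Z) (x : R) : IZR n <= x <= IZR n + 1 ->
  bernoulli_saw x = ((x - IZR n) ^ 2 - (x - IZR n)) / 2 + 1 / 12.
Proof.
  intros Hx; unfold bernoulli_saw.
  pose proof (Int_part_bounds x) as Hb.
  destruct (Req_dec x (IZR n + 1)) as [E|Hne].
  - assert (Int_part x = n + 1)%Z as ->.
    { apply Z.le_antisymm; apply Z.lt_succ_r, lt_IZR; rewrite ?succ_IZR, ?plus_IZR; lra. }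
    rewrite plus_IZR, E; field.
  - assert (Int_part x = n) as ->; auto.
    apply Z.le_antisymm; apply Z.lt_succ_r, lt_IZR; rewrite ?succ_IZR; lra.
Qed.

Lemma continuous_bernoulli_saw (x : R) : continuous bernoulli_saw x.
Proof.
  assert (Hpoly : forall n : Z, continuous (fun x => ((x - IZR n) ^ 2 - (x - IZR n)) / 2 + 1 / 12) x).
  { intros n; continuous_by_derive; auto. }
  set (n := Int_part x).
  pose proof (Int_part_bounds x) as Hb; fold n in Hb.
  apply (proj2 (filterlim_R_iff (locally x) bernoulli_saw (bernoulli_saw x))); intros eps He.
  pose proof (proj1 (filterlim_R_iff (locally x) _ _) (Hpoly n) eps He) as H1.
  pose proof (proj1 (filterlim_R_iff (locally x) _ _) (Hpoly (n - 1)%Z) eps He) as H2.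
  assert (H3 : locally x (fun y => IZR n - 1 < y < IZR n + 1)).
  { apply filter_and; [apply (open_gt (IZR n - 1) x)|apply (open_lt (IZR n + 1) x)]; lra. }
  assert (H4 : IZR n < x -> locally x (fun y => IZR n < y)) by (intros H; apply (open_gt (IZR n) x); auto).
  assert (H5 : locally x (fun y => IZR n < y \/ x = IZR n)).
  { destruct (Req_dec x (IZR n)) as [E|E]; [apply filter_forall; auto|].
    generalize (H4 ltac:(lra)); apply filter_imp; auto. }
  generalize (filter_and _ _ (filter_and _ _ H1 H2) (filter_and _ _ H3 H5)).
  apply filter_imp; intros y [[Y1 Y2] [Y3 Y4]].
  destruct (Rle_dec (IZR n) y) as [Hy|Hy].
  - rewrite (bernoulli_saw_interval n y), (bernoulli_saw_interval n x) by lra; auto.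
  - assert (Ex : x = IZR n) by (destruct Y4; auto; lra).
    rewrite (bernoulli_saw_interval (n - 1) y), (bernoulli_saw_interval (n - 1) x)
      by (rewrite minus_IZR; lra); auto.
Qed.

Lemma periodic_bernoulli_saw : periodic_mean_0 bernoulli_saw.
Proof.
  repeat split.
  - apply continuous_bernoulli_saw.
  - intros x; pose proof (Int_part_bounds x) as Hb.
    rewrite (bernoulli_saw_interval (Int_part x) x) by lra.
    rewrite (bernoulli_saw_interval (Int_part x + 1) (x + 1)) by (rewrite plus_IZR; lra).
    rewrite plus_IZR; field.
  - apply (is_RInt_ext (V := R_NormedModule) (fun x => (x ^ 2 - x) / 2 + 1 / 12)).
    + intros x Hx; rewrite Rmin_left, Rmax_right in Hx by lra.
      rewrite (bernoulli_saw_interval 0 x) by lra; rewrite Rminus_0_r; auto.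
    + pose proof (is_RInt_derive (V := R_CompleteNormedModule)
        (fun x => (x ^ 3 / 3 - x ^ 2 / 2) / 2 + x / 12) (fun x => (x ^ 2 - x) / 2 + 1 / 12) 0 1) as H.
      refine (eq_ind _ (fun l => is_RInt (V := R_NormedModule) _ 0 1 l) (H _ _) _ _).
      * intros x _; auto_derive; auto; field.
      * intros x _; continuous_by_derive; auto.
      * unfold minus, plus, opp; simpl; field.
Qed.

Definition zeta_psum (s : C) (n : nat) : C :=
  @sum_n C_Ring (fun k => Rcpow (INR (S k)) (- s)) n.

Lemma zeta_psum_S (s : C) (n : nat) :
  zeta_psum s (S n) = (zeta_psum s n + Rcpow (INR (S (S n))) (- s))%C.
Proof. unfold zeta_psum; rewrite sum_Sn; reflexivity. Qed.

Definition saw_integrand (s : C) (x : R) : C :=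
  (s * (s + 1) * mellin_integrand bernoulli_saw (s + 2) x)%C.

(** Two integrations by parts on one unit interval; [q] equals [1/12] at both ends and [q'] equals
    [-1/2] and [1/2], which yields the trapezoidal term. *)
Lemma saw_integral_interval (s : C) (n : nat) : s <> 1%C ->
  @is_RInt CV (saw_integrand s) (INR (S n)) (INR (S (S n)))
    ((Rcpow (INR (S (S n))) (1 - s) - Rcpow (INR (S n)) (1 - s)) / (1 - s)
     - s / 12 * (Rcpow (INR (S (S n))) (- s - 1) - Rcpow (INR (S n)) (- s - 1))
     - (Rcpow (INR (S n)) (- s) + Rcpow (INR (S (S n))) (- s)) / 2)%C.
Proof.
  intros Hs.
  assert (Hs1 : (1 - s)%C <> 0%C) by (apply Cminus_neq_0; auto).
  set (a := INR (S n)).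
  assert (Ha : 0 < a) by apply INR_S_pos.
  replace (INR (S (S n))) with (a + 1) by (unfold a; rewrite (S_INR (S n)); auto).
  set (q := fun x => ((x - a) ^ 2 - (x - a)) / 2 + 1 / 12).
  set (q' := fun x => x - a - 1 / 2).
  (* A primitive of [s (s + 1) q(x) x^(-s-2)]: the terms in [q'] cancel, and the last summand
     compensates [q'' = 1]. *)
  set (F := fun x => (RtoC (q x) * (- s * Rcpow x (- s - 1)) - RtoC (q' x) * Rcpow x (- s)
                      + / (1 - s) * Rcpow x (1 - s))%C).
  apply (is_RInt_ext (V := CV) (fun x => s * (s + 1) * (RtoC (q x) * Rcpow x (- (s + 2))))%C).
  { intros x Hx; rewrite Rmin_left, Rmax_right in Hx by lra.
    unfold saw_integrand, mellin_integrand; f_equal; f_equal; f_equal; unfold q, a.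
    rewrite INR_IZR_INZ; symmetry; apply bernoulli_saw_interval.
    rewrite <- INR_IZR_INZ; fold a; lra. }
  assert (E : minus (F (a + 1)%R : CV) (F a) =
     ((Rcpow (a + 1)%R (1 - s) - Rcpow a (1 - s)) / (1 - s)
     - s / 12 * (Rcpow (a + 1)%R (- s - 1) - Rcpow a (- s - 1))
     - (Rcpow a (- s) + Rcpow (a + 1)%R (- s)) / 2)%C).
  { change (F (a + 1)%R - F a = ((Rcpow (a + 1)%R (1 - s) - Rcpow a (1 - s)) / (1 - s)
     - s / 12 * (Rcpow (a + 1)%R (- s - 1) - Rcpow a (- s - 1))
     - (Rcpow a (- s) + Rcpow (a + 1)%R (- s)) / 2))%C.
    unfold F.
    replace (q (a + 1)) with (1 / 12) by (unfold q; field).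
    replace (q a) with (1 / 12) by (unfold q; field).
    replace (q' (a + 1)) with (1 / 2) by (unfold q'; field).
    replace (q' a) with (- (1 / 2)) by (unfold q'; field).
    rewrite RtoC_opp, !RtoC_div by lra; field; auto. }
  rewrite <- E; apply (is_RInt_derive (V := CV)).
  - intros x Hx; rewrite Rmin_left, Rmax_right in Hx by lra.
    assert (Hx0 : 0 < x) by lra.
    replace (s * (s + 1) * (RtoC (q x) * Rcpow x (- (s + 2))))%C with
      (((RtoC (q' x) * (- s * Rcpow x (- s - 1)) + RtoC (q x) * (0 * Rcpow x (- s - 1) + - s * ((- s - 1) * Rcpow x (- s - 1 - 1))))
       - (1 * Rcpow x (- s) + RtoC (q' x) * (- s * Rcpow x (- s - 1))))
       + (0 * Rcpow x (1 - s) + / (1 - s) * ((1 - s) * Rcpow x (1 - s - 1))))%C.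
    + apply is_derive_RC_plus; [apply is_derive_RC_minus|].
      * apply (is_derive_Cmult (fun x => RtoC (q x)) (fun x => - s * Rcpow x (- s - 1))%C).
        { apply is_derive_RtoC; unfold q, q'; auto_derive; auto; field. }
        apply (is_derive_Cmult (fun _ => - s)%C (fun x => Rcpow x (- s - 1))).
        { apply is_derive_RC_const. }
        apply is_derive_Rcpow; auto.
      * apply (is_derive_Cmult (fun x => RtoC (q' x)) (fun x => Rcpow x (- s))).
        { apply is_derive_RtoC; unfold q'; auto_derive; auto; ring. }
        apply is_derive_Rcpow; auto.
      * apply (is_derive_Cmult (fun _ => / (1 - s))%C (fun x => Rcpow x (1 - s))).
        { apply is_derive_RC_const. }
        apply is_derive_Rcpow; auto.
    + replace (1 - s - 1)%C with (- s)%C by ring.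
      replace (- s - 1 - 1)%C with (- (s + 2))%C by ring.
      field; auto.
  - intros x Hx; rewrite Rmin_left, Rmax_right in Hx by lra.
    apply (continuous_Cmult (fun _ => s * (s + 1))%C (fun x => RtoC (q x) * Rcpow x (- (s + 2)))%C);
      [apply continuous_RC_const|].
    apply (continuous_Cmult (fun x => RtoC (q x)) (fun x => Rcpow x (- (s + 2)))).
    + apply continuous_RtoC, (ex_derive_continuous (K := R_AbsRing) (V := R_NormedModule)).
      unfold q; auto_derive; auto.
    + apply continuous_Rcpow; lra.
Qed.

Lemma euler_maclaurin (s : C) (n : nat) : s <> 1%C ->
  @is_RInt CV (saw_integrand s) 1 (INR (S n))
    (1 / (s - 1) + 1 / 2 + s / 12 + Rcpow (INR (S n)) (- s) / 2
     - s / 12 * Rcpow (INR (S n)) (- s - 1)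
     - (zeta_psum s n - Rcpow (INR (S n)) (1 - s) / (1 - s)))%C.
Proof.
  intros Hs.
  assert (Hs1 : (1 - s)%C <> 0%C) by (apply Cminus_neq_0; auto).
  assert (Hs2 : (s - 1)%C <> 0%C) by (apply Cminus_neq_0; auto).
  induction n as [|n IH].
  - replace (INR 1) with 1 by reflexivity.
    unfold zeta_psum; rewrite sum_O; replace (INR 1) with 1 by reflexivity; rewrite !Rcpow_1_l.
    match goal with |- is_RInt _ _ _ ?l => replace l with (RtoC 0) by (field; auto) end.
    apply (is_RInt_point (V := CV)).
  - pose proof (is_RInt_Chasles (V := CV) _ _ _ _ _ _ IH (saw_integral_interval s n Hs)) as H.
    refine (eq_ind _ (fun l => is_RInt (V := CV) _ 1 _ l) H _ _); clear H.
    match goal with |- @eq _ (@plus _ ?x ?y) ?z => change (@eq C (Cplus x y) z) end.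
    rewrite zeta_psum_S; field; auto.
Qed.

(** The integral converges already for [Re s > -1]; the boundary terms, of size [N^(- Re s)], are
    what asks for [Re s > 0]. *)
Lemma zeta_psum_lim (s : C) : 0 < Re s -> s <> 1%C ->
  filterlim (fun n => zeta_psum s n - Rcpow (INR (S n)) (1 - s) / (1 - s))%C eventually
    (locally (1 / (s - 1) + 1 / 2 + s / 12 - s * (s + 1) * mellin_1_oo bernoulli_saw (s + 2))%C).
Proof.
  intros Hs Hs1.
  destruct (periodic_bounded _ periodic_bernoulli_saw) as [B HB].
  assert (Hs2 : 1 < Re (s + 2)) by (destruct s; unfold Re in *; simpl in *; lra).
  pose proof (is_CInt_gen_scal (at_point 1) p_oo (s * (s + 1))%C _ _
    (is_CInt_mellin_1_oo _ B _ continuous_bernoulli_saw HB Hs2)) as HI.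
  pose proof (is_RInt_gen_RInt_lim (V := CV) (at_point 1) p_oo _ _ HI) as HL.
  set (L := (s * (s + 1) * mellin_1_oo bernoulli_saw (s + 2))%C) in *.
  assert (HL' : filterlim (fun n => RInt (V := CV) (saw_integrand s) 1 (INR (S n))) eventually (locally (L : CV))).
  { apply (filterlim_comp _ _ _ (fun n => (1, INR (S n))) (fun ab => RInt (V := CV) (saw_integrand s) (fst ab) (snd ab))
      eventually (filter_prod (at_point 1) p_oo)); [|exact HL].
    apply filterlim_pair.
    - intros P HP; unfold filtermap; apply filter_forall; intros _; exact HP.
    - apply INR_S_lim_p_oo. }
  clear HL; rename HL' into HL.
  apply (filterlim_C_iff eventually); intros eps He.
  rewrite (filterlim_C_iff eventually) in HL.
  assert (Hpow : filterlim (fun n => Rpower (INR (S n)) (- Re s)) eventually (locally 0)).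
  { apply (filterlim_comp _ _ _ (fun n => INR (S n)) (fun x => Rpower x (- Re s)) eventually p_oo).
    - apply INR_S_lim_p_oo.
    - apply Rpower_lim_p_oo; lra. }
  set (K := 1 / 2 + Cmod s / 12).
  assert (HK : 0 < K) by (unfold K; pose proof (Cmod_ge_0 s); lra).
  assert (Hp : 0 < eps / 2 / K) by (apply Rdiv_lt_0_compat; lra).
  generalize (filter_and (F := eventually) _ _ (HL (eps / 2) ltac:(lra)) (proj1 (filterlim_R_iff eventually _ 0) Hpow _ Hp)).
  apply filter_imp; intros n [H1 H2].
  pose proof (is_RInt_unique (V := CV) _ _ _ _ (euler_maclaurin s n Hs1)) as E.
  rewrite E in H1; clear E.
  set (x := INR (S n)) in *.
  set (W := (zeta_psum s n - Rcpow x (1 - s) / (1 - s))%C) in *.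
  replace (W - (1 / (s - 1) + 1 / 2 + s / 12 - L))%C with
    (- ((1 / (s - 1) + 1 / 2 + s / 12 + Rcpow x (- s) / 2 - s / 12 * Rcpow x (- s - 1) - W) - L)
     + (Rcpow x (- s) / 2 - s / 12 * Rcpow x (- s - 1)))%C by ring.
  eapply Rle_lt_trans; [apply Cmod_triangle|]; rewrite Cmod_opp.
  rewrite Rminus_0_r, Rabs_right in H2 by (left; apply Rpower_pos).
  apply Rlt_div_r in H2; auto.
  assert (Cmod (Rcpow x (- s) / 2 - s / 12 * Rcpow x (- s - 1)) <= Rpower x (- Re s) * K); [|lra].
  assert (E1 : Cmod (Rcpow x (- s)) = Rpower x (- Re s)) by (rewrite Cmod_Rcpow; f_equal).
  assert (E2 : Cmod (Rcpow x (- s - 1)) <= Rpower x (- Re s)).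
  { rewrite Cmod_Rcpow; apply Rle_Rpower.
    - unfold x; rewrite S_INR; pose proof (pos_INR n); lra.
    - destruct s; unfold Re; simpl; lra. }
  eapply Rle_trans; [apply Cmod_triangle|]; rewrite Cmod_opp.
  rewrite Cmod_mult, !Cmod_div, E1, !Cmod_R by (apply RtoC_neq_0; lra).
  rewrite !Rabs_right by lra.
  unfold K; pose proof (Cmod_ge_0 s); pose proof (Rpower_pos x (- Re s)).
  assert (Cmod s / 12 * Cmod (Rcpow x (- s - 1)) <= Cmod s / 12 * Rpower x (- Re s)).
  { apply Rmult_le_compat_l; lra. }
  lra.
Qed.

Lemma Re_gt_1_neq_1 (s : C) : 1 < Re s -> s <> 1%C.
Proof. intros Hs ->; simpl in Hs; lra. Qed.

Lemma zeta_psum_series (s : C) (l : C) : 1 < Re s ->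
  filterlim (fun n => zeta_psum s n - Rcpow (INR (S n)) (1 - s) / (1 - s))%C eventually (locally l) ->
  is_Cseries (fun n => Rcpow (INR (S n)) (- s)) l.
Proof.
  intros Hs H; apply (filterlim_C_iff eventually); intros eps He.
  rewrite (filterlim_C_iff eventually) in H.
  assert (Hs1 : (1 - s)%C <> 0%C) by (apply Cminus_neq_0; intros E; apply (Re_gt_1_neq_1 s); auto).
  assert (Hm : 0 < Cmod (1 - s)) by (apply Cmod_gt_0; auto).
  assert (Hpow : filterlim (fun n => Rpower (INR (S n)) (1 - Re s)) eventually (locally 0)).
  { apply (filterlim_comp _ _ _ (fun n => INR (S n)) (fun x => Rpower x (1 - Re s)) eventually p_oo).
    - apply INR_S_lim_p_oo.
    - apply Rpower_lim_p_oo; lra. }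
  assert (Hp : 0 < eps / 2 * Cmod (1 - s)) by (apply Rmult_lt_0_compat; lra).
  generalize (filter_and (F := eventually) _ _ (H (eps / 2) ltac:(lra)) (proj1 (filterlim_R_iff eventually _ 0) Hpow _ Hp)).
  apply filter_imp; intros n [H1 H2].
  change (Cmod (zeta_psum s n - l) < eps).
  replace (zeta_psum s n - l)%C with
    ((zeta_psum s n - Rcpow (INR (S n)) (1 - s) / (1 - s) - l) + Rcpow (INR (S n)) (1 - s) / (1 - s))%C by ring.
  eapply Rle_lt_trans; [apply Cmod_triangle|].
  rewrite Cmod_div, Cmod_Rcpow by auto.
  replace (Re (1 - s)) with (1 - Re s) by (destruct s; unfold Re; simpl; ring).
  rewrite Rminus_0_r, Rabs_right in H2 by (left; apply Rpower_pos).
  apply Rlt_div_l in H2; auto; lra.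
Qed.

(** Besides existence it records what the choice in [zeta] would hide: the polar part at [1] and the
    limit formula valid in the strip. *)
Lemma zeta_construction : exists f g : C -> C, is_Riemann_zeta f /\ analytic_at g 1%C /\
  (forall s, f s = (1 / (s - 1) + g s)%C) /\
  forall s, 0 < Re s -> s <> 1%C ->
    filterlim (fun n => zeta_psum s n - Rcpow (INR (S n)) (1 - s) / (1 - s))%C eventually (locally (f s)).
Proof.
  destruct (mellin_1_oo_entire _ periodic_bernoulli_saw) as (F & HF1 & HF2).
  (* The form [(s + 0) * ...] fits [analytic_at_mult_linear]. *)
  set (g := fun s => (1 / 2 + (/ 12 * ((s + 0) * 1) + (- (1)) * ((s + 0) * ((s + 1) * F (s + 2)))))%C).
  assert (Hg : forall s, analytic_at g s).
  { intros s; apply analytic_at_plus; [apply analytic_at_const|].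
    apply analytic_at_plus; apply analytic_at_scal.
    - apply (analytic_at_mult_linear (fun _ => RtoC 1)), analytic_at_const.
    - apply (analytic_at_mult_linear (fun s => (s + 1) * F (s + 2))%C),
        (analytic_at_mult_linear (fun s => F (s + 2)%C)), analytic_at_translate, HF1. }
  assert (Hlim : forall s, 0 < Re s -> s <> 1%C ->
    filterlim (fun n => zeta_psum s n - Rcpow (INR (S n)) (1 - s) / (1 - s))%C eventually
      (locally (1 / (s - 1) + g s)%C)).
  { intros s Hs Hs1.
    replace (1 / (s - 1) + g s)%C
      with (1 / (s - 1) + 1 / 2 + s / 12 - s * (s + 1) * mellin_1_oo bernoulli_saw (s + 2))%C.
    - apply zeta_psum_lim; auto.
    - unfold g; rewrite HF2 by (destruct s; unfold Re in *; simpl in *; lra).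
      field; apply Cminus_neq_0; auto. }
  exists (fun s => 1 / (s - 1) + g s)%C, g; repeat split; auto.
  - intros s Hs; apply analytic_at_plus; auto.
    apply (analytic_at_ext (fun s => 1 * / (s - 1))%C); [reflexivity|].
    apply analytic_at_scal, analytic_at_inv; auto.
  - intros s Hs; apply zeta_psum_series; auto; apply Hlim; [lra|apply Re_gt_1_neq_1; auto].
Qed.

(** * First properties of [zeta], and its behaviour near the pole *)

Lemma zeta_is_Riemann_zeta : is_Riemann_zeta zeta.
Proof.
  unfold zeta; apply epsilon_spec.
  destruct zeta_construction as (f & g & Hf & _); exists f; exact Hf.
Qed.

Lemma zeta_analytic (s : C) : s <> 1%C -> analytic_at zeta s.
Proof. apply zeta_is_Riemann_zeta. Qed.

Lemma Riemann_zeta_unique (f : C -> C) (s : C) : is_Riemann_zeta f -> s <> 1%C -> zeta s = f s.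
Proof.
  intros [Ha Hf] Hs; destruct zeta_is_Riemann_zeta as [Hza Hz].
  apply agree_near_eq, zeta_identity; auto; intros w Hw.
  apply (eventually_C_lim_unique _ _ _ (Hz w Hw) (Hf w Hw)).
Qed.

Lemma zeta_psum_lim_zeta (s : C) : 0 < Re s -> s <> 1%C ->
  filterlim (fun n => zeta_psum s n - Rcpow (INR (S n)) (1 - s) / (1 - s))%C eventually (locally (zeta s)).
Proof.
  intros Hs Hs1; destruct zeta_construction as (f & g & Hf & _ & _ & Hlim).
  rewrite (Riemann_zeta_unique f s Hf Hs1); auto.
Qed.

(** At a zero the regular part would satisfy [|g s| = 1 / |s - 1|], larger than [|g 1| + 1] close to
    [1], against the continuity of [g]. *)
Lemma zeta_neq_0_near_1 : exists d, 0 < d /\ forall s : C, s <> 1%C -> Cmod (s - 1) < d -> zeta s <> 0%C.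
Proof.
  destruct zeta_construction as (f & g & Hf & Hg & Hfg & _).
  destruct (analytic_at_cont g _ Hg 1 ltac:(lra)) as (d & Hd & Hc).
  pose proof (Cmod_ge_0 (g 1%C)).
  exists (Rmin d (/ (Cmod (g 1%C) + 1))); split.
  { apply Rmin_glb_lt; auto; apply Rinv_0_lt_compat; lra. }
  intros s Hs Hsd E.
  rewrite (Riemann_zeta_unique f s Hf Hs), Hfg in E.
  assert (Hs1 := Cminus_neq_0 _ _ Hs).
  assert (Hp : 0 < Cmod (s - 1)) by (apply Cmod_gt_0; auto).
  specialize (Hc s (Rlt_le_trans _ _ _ Hsd (Rmin_l _ _))).
  pose proof (Cmod_ge_sub (g s) (g 1%C)).
  assert (E' : Cmod (g s) = / Cmod (s - 1)).
  { replace (g s) with (1 / (s - 1) + g s - / (s - 1))%C by (field; auto).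
    rewrite E; replace (0 - / (s - 1))%C with (- / (s - 1))%C by ring.
    rewrite Cmod_opp, Cmod_inv; auto. }
  assert (Hlt : Cmod (s - 1) < / (Cmod (g 1%C) + 1)) by (eapply Rlt_le_trans; [exact Hsd|apply Rmin_r]).
  apply Rinv_lt_contravar in Hlt; [|apply Rmult_lt_0_compat; auto; apply Rinv_0_lt_compat; lra].
  rewrite Rinv_inv in Hlt; lra.
Qed.

(** * Jacobi's theta identity *)

(* [cbin m k] is the central-shifted binomial coefficient [C(2m, m+k)]. *)
Fixpoint cbin (m k : nat) : R :=
  match m with
  | O => match k with O => 1 | S _ => 0 end
  | S m' => match k with
            | O => 2 * cbin m' 0 + 2 * cbin m' 1
            | S k' => cbin m' k' + 2 * cbin m' (S k') + cbin m' (S (S k'))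
            end
  end.

Lemma cbin_0 (m k : nat) : (m < k)%nat -> cbin m k = 0.
Proof.
  revert k; induction m as [|m IH]; intros [|k] Hk; try lia; simpl; auto.
  rewrite !IH by lia; ring.
Qed.

Lemma cbin_ge_0 (m k : nat) : 0 <= cbin m k.
Proof.
  revert k; induction m as [|m IH]; intros [|k]; simpl; try lra.
  - pose proof (IH 0%nat); pose proof (IH 1%nat); lra.
  - pose proof (IH k); pose proof (IH (S k)); pose proof (IH (S (S k))); lra.
Qed.

Lemma cbin_central_pos (m : nat) : 0 < cbin m 0.
Proof. induction m as [|m IH]; simpl; [lra|pose proof (cbin_ge_0 m 1); lra]. Qed.

(** The quotient [(m - k) / (m + k + 1)] of neighbouring binomial coefficients, cleared of
    denominators so that the recursion proves it for every [k]. *)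
Lemma cbin_ratio (m k : nat) : (INR m + INR k + 1) * cbin m (S k) = (INR m - INR k) * cbin m k.
Proof.
  revert k; induction m as [|m IH]; intros k.
  - destruct k; simpl; ring.
  - rewrite (S_INR m); destruct k as [|k].
    + pose proof (IH 0%nat) as H0; pose proof (IH 1%nat) as H1; simpl in *; lra.
    + pose proof (IH k) as H0; pose proof (IH (S k)) as H1; pose proof (IH (S (S k))) as H2.
      change (cbin (S m) (S (S k))) with (cbin m (S k) + 2 * cbin m (S (S k)) + cbin m (S (S (S k)))).
      change (cbin (S m) (S k)) with (cbin m k + 2 * cbin m (S k) + cbin m (S (S k))).
      rewrite !S_INR in *; lra.
Qed.

(** The symmetric trigonometric sum of [b |k| e^(i k theta)] over [|k| <= n]. *)
Fixpoint cos_sum (b : nat -> R) (theta : R) (n : nat) : R :=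
  match n with
  | O => b O
  | S n' => cos_sum b theta n' + 2 * b (S n') * cos (INR (S n') * theta)
  end.

Lemma cos_sum_S (b : nat -> R) (theta : R) (n : nat) :
  cos_sum b theta (S n) = cos_sum b theta n + 2 * b (S n) * cos (INR (S n) * theta).
Proof. reflexivity. Qed.

Lemma cos_product (theta : R) (n : nat) :
  2 * cos theta * cos (INR (S n) * theta) = cos (INR (S (S n)) * theta) + cos (INR n * theta).
Proof.
  rewrite !S_INR.
  replace ((INR n + 1 + 1) * theta) with ((INR n + 1) * theta + theta) by ring.
  replace (INR n * theta) with ((INR n + 1) * theta - theta) by ring.
  rewrite cos_plus, cos_minus; ring.
Qed.

(** Multiplication by [2 + 2 cos theta] convolves the coefficients with [1, 2, 1]. The right-hand
    side is the effect of truncating at [n] and vanishes once [b] does at [n] and [n + 1]. *)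
Lemma cos_sum_step (b b' : nat -> R) (theta : R) (n : nat) :
  b' O = 2 * b O + 2 * b 1%nat ->
  (forall k, b' (S k) = b k + 2 * b (S k) + b (S (S k))) ->
  (2 + 2 * cos theta) * cos_sum b theta n - cos_sum b' theta n
    = 2 * b n * cos (INR (S n) * theta) - 2 * b (S n) * cos (INR n * theta).
Proof.
  intros H0 HS; induction n as [|n IH].
  - simpl; rewrite H0, Rmult_0_l, Rmult_1_l, cos_0; ring.
  - rewrite !cos_sum_S, HS.
    pose proof (cos_product theta n) as Hc.
    set (x := cos (INR (S n) * theta)) in *; set (y := cos (INR (S (S n)) * theta)) in *.
    set (z := cos (INR n * theta)) in *.
    replace ((2 + 2 * cos theta) * (cos_sum b theta n + 2 * b (S n) * x) -
       (cos_sum b' theta n + 2 * (b n + 2 * b (S n) + b (S (S n))) * x))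
      with (((2 + 2 * cos theta) * cos_sum b theta n - cos_sum b' theta n)
        + 2 * b (S n) * (2 * cos theta * x) - 2 * (b n + b (S (S n))) * x) by ring.
    rewrite IH, Hc; ring.
Qed.

Lemma cos_sum_cbin (m n : nat) (theta : R) : (m <= n)%nat ->
  cos_sum (cbin m) theta n = (2 + 2 * cos theta) ^ m.
Proof.
  revert n; induction m as [|m IH]; intros n Hn.
  - simpl; clear Hn; induction n as [|n IHn]; simpl; [auto|].
    rewrite IHn; ring.
  - simpl pow; rewrite <- (IH n) by lia.
    pose proof (cos_sum_step (cbin m) (cbin (S m)) theta n (eq_refl _) (fun k => eq_refl _)) as H.
    rewrite !(cbin_0 m) in H by lia; lra.
Qed.

Lemma dirichlet_kernel (alpha : R) (p : nat) :
  sin (alpha / 2) * cos_sum (fun _ => 1) alpha p = sin ((INR p + 1 / 2) * alpha).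
Proof.
  induction p as [|p IH].
  - simpl; rewrite Rmult_1_r; f_equal; field.
  - rewrite cos_sum_S, Rmult_plus_distr_l, IH.
    replace ((INR (S p) + 1 / 2) * alpha) with (INR (S p) * alpha + alpha / 2) by field.
    replace ((INR p + 1 / 2) * alpha) with (INR (S p) * alpha - alpha / 2) by (rewrite S_INR; field).
    rewrite sin_plus, sin_minus; ring.
Qed.

Lemma cos_INR_2PI (k : nat) : cos (INR k * (2 * PI)) = 1.
Proof.
  replace (INR k * (2 * PI)) with (0 + 2 * INR k * PI) by ring; rewrite cos_period, cos_0; auto.
Qed.

Lemma sin_INR_PI (k : nat) : sin (INR k * PI) = 0.
Proof. apply sin_eq_0_1; exists (Z.of_nat k); rewrite <- INR_IZR_INZ; auto. Qed.

(** Orthogonality of characters modulo [l]: since [l] is odd, the indices [|j| <= p] form a complete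
    residue system. If [l] does not divide [k], then [sin (k PI) = 0] while [sin (k PI / l)] is
    not. *)
Lemma dirichlet_kernel_root (p k : nat) (l := (2 * p + 1)%nat) :
  cos_sum (fun _ => 1) (2 * PI * INR k / INR l) p =
    if Nat.eqb (k mod l) 0 then INR l else 0.
Proof.
  assert (Hl : INR l <> 0) by (apply not_0_INR; unfold l; lia).
  destruct (Nat.eqb_spec (k mod l) 0) as [E|E].
  - apply Nat.Div0.div_exact in E.
    assert (H : forall n, cos_sum (fun _ => 1) (2 * PI * INR k / INR l) n = 1 + 2 * INR n).
    { intros n; induction n as [|n IH]; [simpl; ring|].
      rewrite cos_sum_S, IH.
      replace (INR (S n) * (2 * PI * INR k / INR l)) with (INR (S n * (k / l)) * (2 * PI)).
      - rewrite cos_INR_2PI, S_INR; ring.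
      - rewrite mult_INR; replace (INR k) with (INR l * INR (k / l)) by (rewrite <- mult_INR; f_equal; auto).
        field; auto. }
    rewrite H; unfold l; rewrite plus_INR, mult_INR; simpl; ring.
  - pose proof (dirichlet_kernel (2 * PI * INR k / INR l) p) as H.
    replace ((INR p + 1 / 2) * (2 * PI * INR k / INR l)) with (INR k * PI) in H.
    2:{ unfold l in *; rewrite plus_INR, mult_INR in *; simpl in *; field; lra. }
    rewrite sin_INR_PI in H.
    apply Rmult_integral in H; destruct H as [H|H]; auto.
    exfalso; apply sin_eq_0_0 in H; destruct H as [z Hz].
    apply E.
    assert (Hz' : INR k = IZR z * INR l).
    { pose proof PI_RGT_0; apply Rmult_eq_reg_l with (PI / INR l).
      - replace (PI / INR l * INR k) with (2 * PI * INR k / INR l / 2) by (field; auto).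
        rewrite Hz; field; auto.
      - unfold Rdiv; apply Rmult_integral_contrapositive; split; [lra|apply Rinv_neq_0_compat; auto]. }
    rewrite !INR_IZR_INZ, <- mult_IZR in Hz'; apply eq_IZR in Hz'.
    apply Nat2Z.inj; rewrite Nat2Z.inj_mod, Hz', Z.mod_mul; auto; unfold l; lia.
Qed.

Lemma sum_f_swap (f : nat -> nat -> R) (a b : nat) :
  sum_n (fun i => sum_n (fun j => f i j) b) a = sum_n (fun j => sum_n (fun i => f i j) a) b.
Proof. apply (sum_n_switch f). Qed.

Lemma cos_sum_sum_n (b : nat -> R) (theta : R) (n : nat) :
  cos_sum b theta n = b O + 2 * sum_n (fun k => match k with O => 0 | S _ => b k * cos (INR k * theta) end) n.
Proof.
  induction n as [|n IH]; [rewrite sum_O; simpl; ring|].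
  rewrite sum_Sn; unfold plus; simpl in *; rewrite IH; ring.
Qed.

Lemma sum_n_Rplus (u v : nat -> R) (n : nat) : sum_n (fun k => u k + v k) n = sum_n u n + sum_n v n.
Proof. apply (sum_n_plus u v n). Qed.

Lemma sum_n_Rmult (c : R) (u : nat -> R) (n : nat) : sum_n (fun k => c * u k) n = c * sum_n u n.
Proof. apply (sum_n_mult_l (K := R_Ring) c u n). Qed.

Lemma sum_n_SR (u : nat -> R) (n : nat) : sum_n u (S n) = sum_n u n + u (S n).
Proof. apply (sum_Sn (G := R_AbelianMonoid)). Qed.

Lemma sum_n_ext_R (u v : nat -> R) (n : nat) : (forall k, u k = v k) -> sum_n u n = sum_n v n.
Proof. apply (sum_n_ext (G := R_AbelianMonoid)). Qed.

Lemma sum_multiples (b : nat -> R) (l N : nat) : (0 < l)%nat ->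
  sum_n (fun k => match k with O => 0 | S _ => b k * (if Nat.eqb (k mod l) 0 then 1 else 0) end) (l * N)
  = sum_n (fun q => match q with O => 0 | S _ => b (l * q)%nat end) N.
Proof.
  intros Hl; set (u := fun k => _).
  induction N as [|N IH]; [rewrite Nat.mul_0_r, !sum_O; reflexivity|].
  rewrite (sum_n_SR _ N), <- IH.
  assert (Hr : forall r, (r < l)%nat -> sum_n u (l * N + r) = sum_n u (l * N)).
  { intros r; induction r as [|r IHr]; intros Hr; [rewrite Nat.add_0_r; auto|].
    rewrite Nat.add_succ_r, sum_n_SR, IHr by lia.
    unfold u at 2; replace (S (l * N + r)) with (S r + N * l)%nat by lia.
    rewrite Nat.Div0.mod_add, Nat.mod_small by lia; simpl; ring. }
  replace (l * S N)%nat with (S (l * N + (l - 1))) at 1 by lia.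
  rewrite sum_n_SR, Hr by lia; f_equal.
  unfold u; replace (S (l * N + (l - 1))) with (l * S N)%nat by lia.
  replace ((l * S N) mod l) with 0%nat.
  - destruct (l * S N)%nat eqn:E; [lia|rewrite <- E; simpl; ring].
  - rewrite Nat.mul_comm; symmetry; apply Nat.Div0.mod_mul.
Qed.

(* Discrete Poisson summation: expand [(2 + 2 cos)^m] and sum over the [l]th roots of unity. *)
Lemma polya_identity (m p : nat) (l := (2 * p + 1)%nat) :
  4 ^ m + 2 * sum_n (fun j => match j with O => 0 | S _ => (2 + 2 * cos (2 * PI * INR j / INR l)) ^ m end) p
  = INR l * (cbin m 0 + 2 * sum_n (fun q => match q with O => 0 | S _ => cbin m (l * q) end) m).
Proof.
  assert (Hl : (0 < l)%nat) by (unfold l; lia).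
  assert (Hl0 : INR l <> 0) by (apply not_0_INR; lia).
  (* A truncation order at least the degree [m] and a multiple of [l], as [sum_multiples]
     requires. *)
  set (n := (l * m)%nat).
  assert (Hn : (m <= n)%nat) by (unfold n; nia).
  (* Weight one half at [j = 0]: the sum over [|j| <= p] becomes twice a weighted sum over
     [0 <= j <= p]. *)
  set (w := fun j : nat => match j with O => 1 / 2 | S _ => 1 end).
  assert (HL : forall u : nat -> R, u O + 2 * sum_n (fun j => match j with O => 0 | S _ => u j end) p
     = 2 * sum_n (fun j => w j * u j) p).
  { clear - w; intros u; induction p as [|p' IH]; [rewrite !sum_O; unfold w; simpl; lra|].
    rewrite !sum_n_SR; change (w (S p')) with 1; lra. }
  pose proof (HL (fun j => (2 + 2 * cos (2 * PI * INR j / INR l)) ^ m)) as E1; cbv beta in E1.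
  replace ((2 + 2 * cos (2 * PI * INR 0 / INR l)) ^ m) with (4 ^ m) in E1.
  2:{ simpl; unfold Rdiv; rewrite Rmult_0_r, Rmult_0_l, cos_0; f_equal; ring. }
  rewrite E1; clear E1.
  rewrite (sum_n_ext_R _ (fun j => w j * cbin m 0 +
    2 * sum_n (fun k => w j * match k with O => 0 | S _ => cbin m k * cos (INR k * (2 * PI * INR j / INR l)) end) n)).
  2:{ intros j; rewrite <- (cos_sum_cbin m n) by auto; rewrite cos_sum_sum_n, sum_n_Rmult; rewrite Rmult_plus_distr_l; apply f_equal2; [reflexivity|]; rewrite <- Rmult_assoc, (Rmult_comm (w j) 2), Rmult_assoc; reflexivity. }
  rewrite sum_n_Rplus, sum_n_Rmult, sum_f_swap.
  assert (E3 : forall k, 2 * sum_n (fun j => w j * match k with O => 0 | S _ => cbin m k * cos (INR k * (2 * PI * INR j / INR l)) end) p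
     = match k with O => 0 | S _ => INR l * (cbin m k * (if Nat.eqb (k mod l) 0 then 1 else 0)) end).
  { intros [|k].
    - rewrite (sum_n_ext_R _ (fun _ => 0 * 0)) by (intros; ring); rewrite sum_n_Rmult; ring.
    - rewrite <- (HL (fun j => cbin m (S k) * cos (INR (S k) * (2 * PI * INR j / INR l)))); cbv beta.
      pose proof (dirichlet_kernel_root p (S k)) as D; cbv zeta in D; fold l in D; rewrite cos_sum_sum_n in D.
      replace (INR l * (cbin m (S k) * (if Nat.eqb (S k mod l) 0 then 1 else 0)))
        with (cbin m (S k) * (if Nat.eqb (S k mod l) 0 then INR l else 0))
        by (destruct (Nat.eqb (S k mod l) 0); ring).
      rewrite <- D, Rmult_plus_distr_l.
      replace (cos (INR (S k) * (2 * PI * INR 0 / INR l))) with 1.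
      2:{ change (INR 0) with 0; unfold Rdiv; rewrite Rmult_0_r, Rmult_0_l, Rmult_0_r, cos_0; auto. }
      f_equal; rewrite <- Rmult_assoc, (Rmult_comm (cbin m (S k)) 2), Rmult_assoc; f_equal.
      rewrite <- sum_n_Rmult; apply sum_n_ext_R; intros [|j]; [ring|].
      rewrite Rmult_1_l; f_equal; f_equal; field; auto. }
  assert (E4 : 2 * sum_n (fun j => cbin m 0 * w j) p = INR l * cbin m 0).
  { rewrite sum_n_Rmult.
    replace (2 * (cbin m 0 * sum_n w p)) with ((2 * sum_n w p) * cbin m 0) by ring.
    f_equal; unfold l; clear.
    induction p as [|p IH]; [rewrite sum_O; unfold w; simpl; field|].
    rewrite sum_n_SR, Rmult_plus_distr_l, IH; change (w (S p)) with 1.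
    replace (2 * S p + 1)%nat with (2 * p + 1 + 2)%nat by lia; rewrite (plus_INR _ 2); simpl; ring. }
  rewrite (sum_n_ext_R (fun j => w j * cbin m 0) (fun j => cbin m 0 * w j)) by (intros; ring).
  rewrite Rmult_plus_distr_l, E4, Rmult_plus_distr_l; f_equal.
  replace (INR l * (2 * sum_n (fun q => match q with O => 0 | S _ => cbin m (l * q) end) m))
    with (2 * (INR l * sum_n (fun q => match q with O => 0 | S _ => cbin m (l * q) end) m)) by ring.
  f_equal; rewrite <- (sum_multiples (cbin m)) by auto; fold n.
  rewrite <- !sum_n_Rmult; apply sum_n_ext_R; intros k; rewrite E3.
  destruct k; ring.
Qed.

(** * Gaussian limits of the two sides of the discrete identity *)

Definition cratio (m k : nat) : R := cbin m k / cbin m 0.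

Lemma cratio_O (m : nat) : cratio m 0 = 1.
Proof. unfold cratio; field; apply Rgt_not_eq, cbin_central_pos. Qed.

Lemma cratio_S (m k : nat) : cratio m (S k) = cratio m k * ((INR m - INR k) / (INR m + INR k + 1)).
Proof.
  unfold cratio; pose proof (cbin_ratio m k) as H; pose proof (cbin_central_pos m).
  pose proof (pos_INR m); pose proof (pos_INR k).
  replace (cbin m (S k)) with ((INR m - INR k) * cbin m k / (INR m + INR k + 1)) by (rewrite <- H; field; lra).
  field; lra.
Qed.

Lemma cratio_ge_0 (m k : nat) : 0 <= cratio m k.
Proof. apply Rdiv_le_0_compat; [apply cbin_ge_0|apply cbin_central_pos]. Qed.

Lemma cratio_0 (m k : nat) : (m < k)%nat -> cratio m k = 0.
Proof. intros H; unfold cratio; rewrite cbin_0 by auto; unfold Rdiv; ring. Qed.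

(** A product of factors [1 - (2j + 1) / (m + j + 1)], each at most [exp (- (2j + 1) / (m + K))];
    the odd numbers below [2K] add up to [K^2]. *)
Lemma cratio_le (m K : nat) : (0 < m)%nat ->
  cratio m K <= exp (- (INR K ^ 2 / (INR m + INR K))).
Proof.
  intros Hm; apply lt_INR in Hm; simpl in Hm.
  assert (H : forall k, (k <= K)%nat -> cratio m k <= exp (- (INR k ^ 2 / (INR m + INR K)))).
  { intros k; induction k as [|k IH]; intros Hk.
    - rewrite cratio_O; simpl; unfold Rdiv; rewrite !Rmult_0_l, Ropp_0, exp_0; lra.
    - specialize (IH ltac:(lia)).
      rewrite cratio_S.
      pose proof (pos_INR k); pose proof (cratio_ge_0 m k).
      assert (HkK : INR k + 1 <= INR K) by (rewrite <- S_INR; apply le_INR; auto).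
      set (y := (2 * INR k + 1) / (INR m + INR K)).
      assert (Hf : (INR m - INR k) / (INR m + INR k + 1) <= exp (- y)).
      { apply Rle_trans with (1 + - y); [|apply exp_ineq1_le].
        replace ((INR m - INR k) / (INR m + INR k + 1)) with (1 + - ((2 * INR k + 1) / (INR m + INR k + 1))) by (field; lra).
        apply Rplus_le_compat_l, Ropp_le_contravar; unfold y, Rdiv.
        apply Rmult_le_compat_l; [lra|apply Rinv_le_contravar; lra]. }
      replace (- (INR (S k) ^ 2 / (INR m + INR K))) with (- (INR k ^ 2 / (INR m + INR K)) + - y)
        by (unfold y; rewrite S_INR; field; lra).
      rewrite exp_plus.
      apply Rle_trans with (cratio m k * exp (- y)).
      + apply Rmult_le_compat_l; auto.
      + apply Rmult_le_compat_r; [left; apply exp_pos|auto]. }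
  apply H; lia.
Qed.

Lemma one_minus_ge_exp (y : R) : 0 <= y < 1 -> exp (- (y / (1 - y))) <= 1 - y.
Proof.
  intros Hy; rewrite exp_Ropp.
  pose proof (exp_ineq1_le (y / (1 - y))) as H.
  apply Rle_trans with (/ (1 + y / (1 - y))); [|right; field; lra].
  apply Rinv_le_contravar; auto.
  assert (0 <= y / (1 - y)) by (apply Rdiv_le_0_compat; lra); lra.
Qed.

(** The same product estimated from below by [one_minus_ge_exp]: for [u = (2j + 1) / (m + j + 1)]
    the quotient [u / (1 - u)] is [(2j + 1) / (m - j)]. *)
Lemma cratio_ge (m K : nat) : (K < m)%nat ->
  exp (- (INR K ^ 2 / (INR m - INR K))) <= cratio m K.
Proof.
  intros Hm; apply lt_INR in Hm.
  assert (H : forall k, (k <= K)%nat -> exp (- (INR k ^ 2 / (INR m - INR K))) <= cratio m k).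
  { intros k; induction k as [|k IH]; intros Hk.
    - rewrite cratio_O; simpl; unfold Rdiv; rewrite !Rmult_0_l, Ropp_0, exp_0; lra.
    - specialize (IH ltac:(lia)).
      rewrite cratio_S.
      pose proof (pos_INR k).
      assert (HkK : INR k + 1 <= INR K) by (rewrite <- S_INR; apply le_INR; auto).
      set (y := (2 * INR k + 1) / (INR m - INR K)).
      assert (Hf : exp (- y) <= (INR m - INR k) / (INR m + INR k + 1)).
      { set (u := (2 * INR k + 1) / (INR m + INR k + 1)).
        assert (Hu : 0 <= u < 1).
        { unfold u; split; [apply Rdiv_le_0_compat; lra|apply Rlt_div_l; lra]. }
        replace ((INR m - INR k) / (INR m + INR k + 1)) with (1 - u) by (unfold u; field; lra).
        eapply Rle_trans; [|apply one_minus_ge_exp; auto].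
        apply exp_le_exp, Ropp_le_contravar.
        replace (u / (1 - u)) with ((2 * INR k + 1) / (INR m - INR k)) by (unfold u; field; lra).
        unfold y, Rdiv; apply Rmult_le_compat_l; [lra|apply Rinv_le_contravar; lra]. }
      replace (- (INR (S k) ^ 2 / (INR m - INR K))) with (- (INR k ^ 2 / (INR m - INR K)) + - y)
        by (unfold y; rewrite S_INR; field; lra).
      rewrite exp_plus; apply Rmult_le_compat; auto; left; apply exp_pos. }
  apply H; lia.
Qed.

Lemma Series_tail_geom (w : nat -> R) (rho K : R) (J : nat) : 0 <= rho < 1 ->
  (forall j, 0 <= w j <= K * rho ^ j) -> ex_series w ->
  Series w <= sum_n w J + K * rho ^ (S J) / (1 - rho).
Proof.
  intros Hr Hw Hex.
  rewrite (Series_incr_n w (S J)) by (auto; lia); simpl Init.Nat.pred.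
  rewrite <- sum_n_Reals; apply Rplus_le_compat_l.
  assert (Hg : is_series (fun k => K * rho ^ S J * rho ^ k) (K * rho ^ S J / (1 - rho))).
  { unfold Rdiv; apply (is_series_scal (K := R_AbsRing) (V := R_NormedModule) (K * rho ^ S J)), is_series_geom; rewrite Rabs_right; lra. }
  rewrite <- (is_series_unique _ _ Hg).
  apply Series_le; [|eexists; exact Hg].
  intros k; replace (K * rho ^ S J * rho ^ k) with (K * rho ^ (S J + k)) by (rewrite pow_add; ring); apply Hw.
Qed.

Lemma ex_series_geom_bound (u : nat -> R) (rho K : R) : 0 <= rho < 1 ->
  (forall j, Rabs (u j) <= K * rho ^ j) -> ex_series u.
Proof.
  intros Hr Hu; apply (ex_series_le (K := R_AbsRing) (V := R_CompleteNormedModule) u (fun j => K * rho ^ j)); auto.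
  apply (ex_series_scal (K := R_AbsRing) (V := R_NormedModule) K), ex_series_geom; rewrite Rabs_right; lra.
Qed.

(** Dominated convergence for series: beyond [J] both tails are under the geometric majorant, and
    the first [J + 1] terms converge one by one. *)
Lemma tannery (u : nat -> nat -> R) (v : nat -> R) (rho : R) : 0 <= rho < 1 ->
  eventually (fun m => forall j, 0 <= u m j <= rho ^ j) ->
  (forall j, is_lim_seq (fun m => u m j) (v j)) ->
  is_lim_seq (fun m => Series (u m)) (Series v).
Proof.
  intros Hr [M HM] Hl.
  assert (Hv : forall j, 0 <= v j <= rho ^ j).
  { intros j; split.
    - apply (is_lim_seq_le_loc (fun _ => 0) (fun m => u m j) 0 (v j)); auto; [|apply is_lim_seq_const].
      exists M; intros m Hm; apply HM; auto.
    - apply (is_lim_seq_le_loc (fun m => u m j) (fun _ => rho ^ j) (v j) (rho ^ j)); auto; [|apply is_lim_seq_const].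
      exists M; intros m Hm; apply HM; auto. }
  assert (Exv : ex_series v).
  { apply (ex_series_geom_bound v rho 1); auto; intros j; rewrite Rabs_right, Rmult_1_l; [apply Hv|apply Rle_ge, Hv]. }
  apply (proj2 (filterlim_R_iff eventually _ _)); intros eps He.
  pose proof (is_lim_seq_geom rho ltac:(rewrite Rabs_right; lra)) as Hg.
  (* Makes the tail [2 rho^(J+1) / (1 - rho)] smaller than [eps / 2]. *)
  assert (Hp : 0 < eps * (1 - rho) / 4) by nra.
  destruct (proj1 (filterlim_R_iff eventually _ 0) Hg _ Hp) as [J HJ].
  assert (Hs : is_lim_seq (fun m => sum_n (fun j => Rabs (u m j - v j)) J) 0).
  { clear HJ; induction J as [|J IH].
    - apply (is_lim_seq_ext (fun m => Rabs (u m 0%nat - v 0%nat))); [intros m; rewrite sum_O; auto|].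
      rewrite <- Rabs_R0, <- (Rminus_diag (v 0%nat)).
      apply (is_lim_seq_abs _ (Finite (v 0%nat - v 0%nat))), is_lim_seq_minus'; [apply Hl|apply is_lim_seq_const].
    - apply (is_lim_seq_ext (fun m => sum_n (fun j => Rabs (u m j - v j)) J + Rabs (u m (S J) - v (S J)))).
      { intros m; rewrite sum_n_SR; auto. }
      replace (Finite 0) with (Finite (0 + 0)) by (f_equal; ring).
      apply is_lim_seq_plus'; auto.
      rewrite <- Rabs_R0, <- (Rminus_diag (v (S J))).
      apply (is_lim_seq_abs _ (Finite (v (S J) - v (S J)))), is_lim_seq_minus'; [apply Hl|apply is_lim_seq_const]. }
  destruct (proj1 (filterlim_R_iff eventually _ 0) Hs (eps / 2) ltac:(lra)) as [M2 HM2].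
  exists (max M M2); intros m Hm.
  assert (Hum := HM m ltac:(lia)).
  assert (Exu : ex_series (u m)).
  { apply (ex_series_geom_bound (u m) rho 1); auto; intros j; rewrite Rabs_right, Rmult_1_l; [apply Hum|apply Rle_ge, Hum]. }
  rewrite <- Series_minus by auto.
  set (w := fun j => Rabs (u m j - v j)).
  assert (Hw : forall j, 0 <= w j <= 2 * rho ^ j).
  { intros j; split; [apply Rabs_pos|]; unfold w; apply Rabs_le.
    specialize (Hum j); specialize (Hv j); lra. }
  assert (Exw : ex_series w).
  { apply (ex_series_geom_bound w rho 2); auto; intros j; rewrite Rabs_right; [apply Hw|apply Rle_ge, Hw]. }
  eapply Rle_lt_trans; [apply Series_Rabs; exact Exw|].
  eapply Rle_lt_trans; [apply (Series_tail_geom w rho 2 J); auto|].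
  specialize (HM2 m ltac:(lia)); rewrite Rminus_0_r in HM2; fold w in HM2.
  pose proof (Rle_abs (sum_n w J)).
  specialize (HJ (S J) ltac:(lia)); rewrite Rminus_0_r in HJ.
  pose proof (Rle_abs (rho ^ S J)).
  assert (2 * rho ^ S J / (1 - rho) < eps / 2); [|lra].
  apply Rlt_div_l; [lra|]; nra.
Qed.

Lemma Series_finite (u : nat -> R) (N : nat) : (forall j, (N < j)%nat -> u j = 0) -> Series u = sum_n u N.
Proof.
  intros H; apply is_series_unique.
  apply (filterlim_ext_loc (fun _ => sum_n u N)); [|apply filterlim_const].
  exists N; intros n Hn; change (sum_n u N = @sum_n R_AbelianMonoid u n).
  induction Hn as [|n Hn IH]; auto.
  rewrite sum_n_SR, <- IH, (H (S n)) by lia; symmetry; apply Rplus_0_r.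
Qed.

Lemma sin_ge_cubic (y : R) : 0 <= y <= PI -> y - y ^ 3 / 6 <= sin y.
Proof.
  intros Hy; pose proof (proj1 (sin_bound y 0 (proj1 Hy) (proj2 Hy))) as H.
  eapply Rle_trans; [|exact H]; right.
  unfold sin_approx, sin_term; simpl; field.
Qed.

(* [Theta c = sum over all integers n of exp (- c n^2)]. *)
Definition Theta (c : R) : R :=
  1 + 2 * Series (fun q => match q with O => 0 | S _ => exp (- (c * INR q ^ 2)) end).

(* With [m = k + 1], [pol_l c k = 2 pol_p c k + 1] is an odd integer within [1] of [sqrt (c m)];
   the other branch of the test is never taken. *)
Definition pol_p (c : R) (k : nat) : nat :=
  match Rle_dec 0 (sqrt (c * INR (S k)) / 2) with
  | left H => proj1_sig (nfloor_ex _ H)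
  | right _ => O
  end.

Definition pol_l (c : R) (k : nat) : nat := (2 * pol_p c k + 1)%nat.

Lemma pol_l_bounds (c : R) (k : nat) : 0 < c ->
  sqrt (c * INR (S k)) - 1 <= INR (pol_l c k) <= sqrt (c * INR (S k)) + 1.
Proof.
  intros Hc; unfold pol_l, pol_p; pose proof (sqrt_pos (c * INR (S k))).
  destruct (Rle_dec 0 (sqrt (c * INR (S k)) / 2)) as [H0|H0]; [|lra].
  destruct (nfloor_ex _ H0) as [n [H1 H2]]; simpl proj1_sig.
  rewrite plus_INR, mult_INR; change (INR 2) with 2; change (INR 1) with 1; lra.
Qed.

Lemma inv_sqrt_lim : is_lim_seq (fun k => / sqrt (INR (S k))) 0.
Proof.
  apply (is_lim_seq_ext (fun k => Rpower (INR (S k)) (- / 2))).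
  - intros k; rewrite Rpower_Ropp, Rpower_sqrt; auto; apply lt_0_INR; lia.
  - apply (filterlim_comp _ _ _ (fun n => INR (S n)) (fun x => Rpower x (- / 2)) eventually p_oo).
    + apply INR_S_lim_p_oo.
    + apply Rpower_lim_p_oo; lra.
Qed.

Definition pol_lambda (c : R) (k : nat) : R := INR (pol_l c k) / sqrt (INR (S k)).

Lemma sqrt_S_pos (k : nat) : 0 < sqrt (INR (S k)).
Proof. apply sqrt_lt_R0, lt_0_INR; lia. Qed.

Lemma pol_lambda_lim (c : R) : 0 < c -> is_lim_seq (pol_lambda c) (sqrt c).
Proof.
  intros Hc.
  apply (is_lim_seq_le_le (fun k => sqrt c - / sqrt (INR (S k))) _ (fun k => sqrt c + / sqrt (INR (S k)))).
  - intros k; pose proof (pol_l_bounds c k Hc) as [H1 H2].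
    pose proof (sqrt_S_pos k).
    rewrite sqrt_mult in H1, H2 by (try lra; apply pos_INR).
    unfold pol_lambda; split.
    + apply Rle_div_r; auto; rewrite Rmult_minus_distr_r, Rinv_l by lra; lra.
    + apply Rle_div_l; auto; rewrite Rmult_plus_distr_r, Rinv_l by lra; lra.
  - replace (Finite (sqrt c)) with (Finite (sqrt c - 0)) by (f_equal; ring).
    apply is_lim_seq_minus'; [apply is_lim_seq_const|apply inv_sqrt_lim].
  - replace (Finite (sqrt c)) with (Finite (sqrt c + 0)) by (f_equal; ring).
    apply is_lim_seq_plus'; [apply is_lim_seq_const|apply inv_sqrt_lim].
Qed.

Lemma exp_lim_seq (u : nat -> R) (l : R) : is_lim_seq u l -> is_lim_seq (fun k => exp (u k)) (exp l).
Proof.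
  intros H; apply (filterlim_comp _ _ _ u exp eventually (locally l)); auto.
  continuous_by_derive; auto.
Qed.

Lemma is_lim_seq_lt_eventually (u : nat -> R) (l b : R) : is_lim_seq u l -> l < b -> eventually (fun k => u k < b).
Proof.
  intros H Hb; generalize (proj1 (filterlim_R_iff eventually _ _) H (b - l) ltac:(lra)).
  apply filter_imp; intros k Hk; apply Rabs_lt_between in Hk; lra.
Qed.

Lemma is_lim_seq_gt_eventually (u : nat -> R) (l b : R) : is_lim_seq u l -> b < l -> eventually (fun k => b < u k).
Proof.
  intros H Hb; generalize (proj1 (filterlim_R_iff eventually _ _) H (l - b) ltac:(lra)).
  apply filter_imp; intros k Hk; apply Rabs_lt_between in Hk; lra.
Qed.

Lemma exp_pow (x : R) (n : nat) : exp (INR n * x) = exp x ^ n.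
Proof.
  induction n as [|n IH]; [simpl; rewrite Rmult_0_l; apply exp_0|].
  rewrite S_INR, Rmult_plus_distr_r, exp_plus, IH, Rmult_1_l; simpl; ring.
Qed.

Lemma exp_quadratic_le_geom (d : R) (j : nat) : 0 <= d -> exp (- (d * INR j ^ 2)) <= exp (- d) ^ j.
Proof.
  intros Hd; rewrite <- exp_pow; apply exp_le_exp.
  assert (INR j <= INR j ^ 2); [|nra].
  destruct j as [|j]; [simpl; lra|].
  rewrite S_INR; pose proof (pos_INR j); nra.
Qed.

Lemma exp_opp_lt_1 (d : R) : 0 < d -> 0 <= exp (- d) < 1.
Proof.
  intros Hd; split; [left; apply exp_pos|]; rewrite <- exp_0; apply exp_increasing; lra.
Qed.

Lemma cratio_lim (c : R) (q : nat) : 0 < c ->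
  is_lim_seq (fun k => cratio (S k) (pol_l c k * q)) (exp (- (c * INR q ^ 2))).
Proof.
  intros Hc.
  pose proof (pol_lambda_lim c Hc) as Hl.
  set (la := pol_lambda c) in *; set (t := fun k => / sqrt (INR (S k))).
  assert (Ht : is_lim_seq t 0) by apply inv_sqrt_lim.
  assert (Hr : is_lim_seq (fun k => la k * t k * INR q) 0).
  { replace (Finite 0) with (Finite (sqrt c * 0 * INR q)) by (f_equal; ring).
    apply is_lim_seq_mult'; [apply is_lim_seq_mult'; auto|apply is_lim_seq_const]. }
  assert (Hn : is_lim_seq (fun k => la k * la k * INR q ^ 2) (c * INR q ^ 2)).
  { replace (Finite (c * INR q ^ 2)) with (Finite (sqrt c * sqrt c * INR q ^ 2)) by (rewrite sqrt_sqrt; auto; lra).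
    apply is_lim_seq_mult'; [apply is_lim_seq_mult'; auto|apply is_lim_seq_const]. }
  assert (EK : forall k, INR (pol_l c k * q) = INR (S k) * (la k * t k * INR q)).
  { intros k; unfold la, t, pol_lambda; pose proof (sqrt_S_pos k).
    rewrite mult_INR; replace (INR (S k)) with (sqrt (INR (S k)) * sqrt (INR (S k))) at 1
      by (apply sqrt_sqrt, pos_INR); field; lra. }
  assert (EK2 : forall k, INR (pol_l c k * q) ^ 2 = INR (S k) * (la k * la k * INR q ^ 2)).
  { intros k; unfold la, t, pol_lambda; pose proof (sqrt_S_pos k).
    rewrite mult_INR; replace (INR (S k)) with (sqrt (INR (S k)) * sqrt (INR (S k))) at 1
      by (apply sqrt_sqrt, pos_INR); field; lra. }
  (* With [K = l q = m r] and [r] tending to [0], the exponents of both bounds have the form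
     [K^2 / (m + s K) = la^2 q^2 / (1 + s r)], with [s = 1] and [s = -1]. *)
  assert (Hdiv : forall s, is_lim_seq (fun k => exp (- (la k * la k * INR q ^ 2 / (1 + s * (la k * t k * INR q))))) (exp (- (c * INR q ^ 2)))).
  { intros s; apply exp_lim_seq.
    replace (Finite (- (c * INR q ^ 2))) with (Rbar_opp (Finite (c * INR q ^ 2 / (1 + s * 0))))
      by (simpl; f_equal; field).
    apply (is_lim_seq_opp _ (Finite (c * INR q ^ 2 / (1 + s * 0)))), is_lim_seq_div'; auto; [|lra].
    apply is_lim_seq_plus'; [apply is_lim_seq_const|].
    apply (is_lim_seq_scal_l _ s (Finite 0)); auto. }
  assert (Hsmall : eventually (fun k => la k * t k * INR q < 1)) by (apply (is_lim_seq_lt_eventually _ 0); auto; lra).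
  apply (is_lim_seq_le_le_loc
    (fun k => exp (- (la k * la k * INR q ^ 2 / (1 + (- (1)) * (la k * t k * INR q))))) _
    (fun k => exp (- (la k * la k * INR q ^ 2 / (1 + 1 * (la k * t k * INR q)))))); auto.
  revert Hsmall; apply filter_imp; intros k Hk.
  assert (Hpos : 0 < INR (S k)) by (apply lt_0_INR; lia).
  assert (H0 : 0 <= la k * t k * INR q).
  { unfold la, t, pol_lambda; apply Rmult_le_pos; [|apply pos_INR].
    apply Rmult_le_pos; [apply Rdiv_le_0_compat; [apply pos_INR|apply sqrt_S_pos]|].
    left; apply Rinv_0_lt_compat, sqrt_S_pos. }
  split.
  - eapply Rle_trans; [|apply cratio_ge].
    + apply exp_le_exp, Ropp_le_contravar; rewrite EK2, EK; right; field; split; nra.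
    + apply INR_lt; rewrite EK; nra.
  - eapply Rle_trans; [apply cratio_le; lia|].
    apply exp_le_exp, Ropp_le_contravar; rewrite EK2, EK; right; field; split; nra.
Qed.

(** The binomial side of [polya_identity] divided by its central coefficient; a finite sum written
    as a series so that [tannery] applies. *)
Definition theta_rhs (c : R) (k : nat) : R :=
  Series (fun q => match q with O => 0 | S _ => cratio (S k) (pol_l c k * q) end).

Lemma theta_rhs_lim (c : R) : 0 < c -> is_lim_seq (fun k => 1 + 2 * theta_rhs c k) (Theta c).
Proof.
  intros Hc; unfold Theta.
  apply is_lim_seq_plus'; [apply is_lim_seq_const|].
  apply (is_lim_seq_scal_l _ 2 (Finite _)).
  (* The rate [c / 4] comes from [l^2 >= (c / 2) m] and, for the nonzero terms, [m + l q <= 2 m]. *)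
  assert (Hrho : 0 <= exp (- (c / 4)) < 1) by (apply exp_opp_lt_1; lra).
  apply (tannery (fun k q => match q with O => 0 | S _ => cratio (S k) (pol_l c k * q) end) _ (exp (- (c / 4)))); auto.
  - pose proof (pol_lambda_lim c Hc) as Hl.
    assert (Hl2 : is_lim_seq (fun k => pol_lambda c k * pol_lambda c k) (sqrt c * sqrt c)) by (apply is_lim_seq_mult'; auto).
    rewrite sqrt_sqrt in Hl2 by lra.
    generalize (is_lim_seq_gt_eventually _ c (c / 2) Hl2 ltac:(lra)); apply filter_imp; intros k Hk j.
    destruct j as [|q]; [simpl; lra|]; split; [apply cratio_ge_0|].
    destruct (le_lt_dec (pol_l c k * S q) (S k)) as [Hle|Hlt].
    + eapply Rle_trans; [apply cratio_le; lia|].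
      eapply Rle_trans; [|apply exp_quadratic_le_geom; lra].
      apply exp_le_exp, Ropp_le_contravar.
      apply le_INR in Hle.
      assert (Hpos : 0 < INR (S k)) by (apply lt_0_INR; lia).
      pose proof (pos_INR (pol_l c k * S q)).
      apply Rle_trans with (INR (pol_l c k * S q) ^ 2 / (2 * INR (S k))).
      * replace (INR (pol_l c k * S q) ^ 2 / (2 * INR (S k)))
          with ((pol_lambda c k * pol_lambda c k) / 2 * INR (S q) ^ 2).
        { apply Rmult_le_compat_r; [apply pow_le, pos_INR|lra]. }
        unfold pol_lambda; pose proof (sqrt_S_pos k).
        rewrite mult_INR; replace (INR (S k)) with (sqrt (INR (S k)) * sqrt (INR (S k))) at 3
          by (apply sqrt_sqrt, pos_INR); field; lra.
      * unfold Rdiv; apply Rmult_le_compat_l; [apply pow_le; auto|apply Rinv_le_contravar; lra].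
    + rewrite cratio_0 by auto; apply pow_le; lra.
  - intros [|q]; [apply is_lim_seq_const|apply (cratio_lim c (S q)); auto].
Qed.

(** The cosine side divided by [4^m], since [2 + 2 cos (2 y) = 4 (1 - sin^2 y)]. *)
Definition theta_lhs (c : R) (k : nat) : R :=
  Series (fun j => match j with
    | O => 0
    | S _ => if le_lt_dec j (pol_p c k)
             then (1 - sin (PI * INR j / INR (pol_l c k)) ^ 2) ^ (S k) else 0
    end).

Lemma pol_l_pos (c : R) (k : nat) : 0 < INR (pol_l c k).
Proof. apply lt_0_INR; unfold pol_l; lia. Qed.

Lemma pol_angle (c : R) (k j : nat) : (j <= pol_p c k)%nat ->
  0 <= PI * INR j / INR (pol_l c k) <= PI / 2.
Proof.
  intros Hj; pose proof PI_RGT_0; pose proof (pos_INR j); pose proof (pol_l_pos c k); split.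
  - apply Rdiv_le_0_compat; nra.
  - apply Rle_div_l; auto.
    apply le_INR in Hj; unfold pol_l; rewrite plus_INR, mult_INR; change (INR 2) with 2; change (INR 1) with 1; nra.
Qed.

Lemma one_minus_pow_le_exp (y : R) (n : nat) : 0 <= y <= 1 -> (1 - y) ^ n <= exp (- (INR n * y)).
Proof.
  intros Hy; replace (- (INR n * y)) with (INR n * (- y)) by ring; rewrite exp_pow.
  apply pow_incr; split; [lra|]; pose proof (exp_ineq1_le (- y)); lra.
Qed.

Lemma sin_sq_bound (y : R) : 0 <= sin y ^ 2 <= 1.
Proof. pose proof (sin2_cos2 y); unfold Rsqr in *; nra. Qed.

(** Here [y = PI j / l] tends to [0] and [m y^2] to [PI^2 j^2 / c]; the power [(1 - sin^2 y)^m] is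
    squeezed between exponentials of [m y^2] with correction factors tending to [1]. *)
Lemma theta_lhs_term_lim (c : R) (j : nat) : 0 < c ->
  is_lim_seq (fun k => if le_lt_dec j (pol_p c k)
             then (1 - sin (PI * INR j / INR (pol_l c k)) ^ 2) ^ (S k) else 0) (exp (- (PI ^ 2 / c * INR j ^ 2))).
Proof.
  intros Hc.
  pose proof (pol_lambda_lim c Hc) as Hl.
  set (la := pol_lambda c) in *; set (t := fun k => / sqrt (INR (S k))).
  assert (Ht : is_lim_seq t 0) by apply inv_sqrt_lim.
  assert (Hsc : 0 < sqrt c) by (apply sqrt_lt_R0; auto).
  set (y := fun k => PI * INR j / INR (pol_l c k)).
  set (a := fun k => PI ^ 2 * INR j ^ 2 / (la k * la k)).
  assert (Hlap : forall k, 0 < la k).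
  { intros k; apply Rdiv_lt_0_compat; [apply pol_l_pos|apply sqrt_S_pos]. }
  assert (Ha : is_lim_seq a (PI ^ 2 / c * INR j ^ 2)).
  { replace (Finite (PI ^ 2 / c * INR j ^ 2)) with (Finite (PI ^ 2 * INR j ^ 2 / (sqrt c * sqrt c))).
    - apply is_lim_seq_div'; [apply is_lim_seq_const|apply is_lim_seq_mult'; auto|nra].
    - rewrite sqrt_sqrt by lra; f_equal; field; lra. }
  assert (Ey : forall k, y k = PI * INR j * (t k / la k)).
  { intros k; unfold y, t, la, pol_lambda; pose proof (sqrt_S_pos k); pose proof (pol_l_pos c k); field; lra. }
  assert (Ey2 : forall k, INR (S k) * (y k) ^ 2 = a k).
  { intros k; unfold a; rewrite Ey; unfold t, la, pol_lambda; pose proof (sqrt_S_pos k); pose proof (pol_l_pos c k).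
    replace (INR (S k)) with (sqrt (INR (S k)) * sqrt (INR (S k))) at 1
      by (apply sqrt_sqrt, pos_INR); field; lra. }
  assert (Hy : is_lim_seq y 0).
  { apply (is_lim_seq_ext (fun k => PI * INR j * (t k / la k))); [intros k; auto|].
    replace (Finite 0) with (Finite (PI * INR j * (0 / sqrt c))) by (f_equal; field; lra).
    apply is_lim_seq_mult'; [apply is_lim_seq_const|apply is_lim_seq_div'; auto; lra]. }
  clearbody a.
  assert (Hup : is_lim_seq (fun k => exp (- (a k * (1 - y k ^ 2 / 6) ^ 2))) (exp (- (PI ^ 2 / c * INR j ^ 2)))).
  { apply exp_lim_seq.
    replace (Finite (- (PI ^ 2 / c * INR j ^ 2))) with (Rbar_opp (Finite (PI ^ 2 / c * INR j ^ 2 * (1 - 0 * 0 * / 6) * (1 - 0 * 0 * / 6))))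
      by (simpl; f_equal; field; lra).
    apply (is_lim_seq_opp _ (Finite (PI ^ 2 / c * INR j ^ 2 * (1 - 0 * 0 * / 6) * (1 - 0 * 0 * / 6)))).
    apply (is_lim_seq_ext (fun k => a k * (1 - y k * y k * / 6) * (1 - y k * y k * / 6))); [intros k; field|].
    repeat first [apply is_lim_seq_mult' | apply is_lim_seq_minus' | apply is_lim_seq_const | assumption]. }
  assert (Hlo : is_lim_seq (fun k => exp (- (a k / (1 - y k ^ 2)))) (exp (- (PI ^ 2 / c * INR j ^ 2)))).
  { apply exp_lim_seq.
    replace (Finite (- (PI ^ 2 / c * INR j ^ 2))) with (Rbar_opp (Finite (PI ^ 2 / c * INR j ^ 2 / (1 - 0 * 0))))
      by (simpl; f_equal; field; lra).
    apply (is_lim_seq_opp _ (Finite (PI ^ 2 / c * INR j ^ 2 / (1 - 0 * 0)))).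
    apply (is_lim_seq_ext (fun k => a k / (1 - y k * y k))); [intros k; f_equal; ring|].
    apply is_lim_seq_div'; auto; [|lra].
    repeat first [apply is_lim_seq_mult' | apply is_lim_seq_minus' | apply is_lim_seq_const | assumption]. }
  apply (is_lim_seq_le_le_loc (fun k => exp (- (a k / (1 - y k ^ 2)))) _ (fun k => exp (- (a k * (1 - y k ^ 2 / 6) ^ 2)))); auto.
  assert (Hy1 : eventually (fun k => y k < 1)) by (apply (is_lim_seq_lt_eventually _ 0); auto; lra).
  revert Hy1; apply filter_imp; intros k Hk.
  assert (Hy0 : 0 <= y k).
  { unfold y; pose proof PI_RGT_0; apply Rdiv_le_0_compat; [apply Rmult_le_pos; [lra|apply pos_INR]|apply pol_l_pos]. }
  (* If [j > p] then [l = 2 p + 1 < 2 j], so [y > PI / 2 > 1]. *)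
  assert (Hj : (j <= pol_p c k)%nat).
  { apply Nat.nlt_ge; intros Hlt.
    unfold y in Hk; apply Rlt_div_l in Hk; [|apply pol_l_pos].
    assert (INR (pol_l c k) < 2 * INR j).
    { replace 2 with (INR 2) by reflexivity; rewrite <- mult_INR; apply lt_INR; unfold pol_l; lia. }
    pose proof PI2_1; pose proof (pos_INR j); nra. }
  destruct (le_lt_dec j (pol_p c k)) as [_|Hn]; [|lia].
  fold (y k).
  pose proof (sin_sq_bound (y k)) as Hs.
  assert (HP : y k <= PI) by (pose proof PI2_1; lra).
  pose proof (sin_ge_cubic (y k) (conj Hy0 HP)) as Hs1.
  assert (Hs2 : sin (y k) <= y k).
  { destruct Hy0 as [H| <-]; [left; apply sin_lt_x; auto|rewrite sin_0; lra]. }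
  assert (Hs0 : 0 <= sin (y k)) by (apply sin_ge_0; lra).
  assert (Hsy : sin (y k) ^ 2 <= y k ^ 2) by (apply pow_incr; lra).
  assert (Hm : 0 < INR (S k)) by (apply lt_0_INR; lia).
  split.
  - eapply Rle_trans; [|apply pow_incr; split; [left; apply exp_pos|apply (one_minus_ge_exp (sin (y k) ^ 2)); nra]].
    rewrite <- exp_pow; apply exp_le_exp.
    rewrite <- Ey2.
    assert (sin (y k) ^ 2 / (1 - sin (y k) ^ 2) <= y k ^ 2 / (1 - y k ^ 2)).
    { apply Rmult_le_compat; [apply Hs|left; apply Rinv_0_lt_compat; nra|auto|apply Rinv_le_contravar; nra]. }
    replace (INR (S k) * y k ^ 2 / (1 - y k ^ 2)) with (INR (S k) * (y k ^ 2 / (1 - y k ^ 2))) by (field; nra).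
    nra.
  - eapply Rle_trans; [apply one_minus_pow_le_exp; auto|].
    apply exp_le_exp, Ropp_le_contravar; rewrite <- Ey2, Rmult_assoc; apply Rmult_le_compat_l; [lra|].
    rewrite <- Rpow_mult_distr; apply pow_incr; split; [nra|].
    eapply Rle_trans; [|exact Hs1]; right; field.
Qed.

Lemma theta_lhs_lim (c : R) : 0 < c -> is_lim_seq (fun k => 1 + 2 * theta_lhs c k) (Theta (PI ^ 2 / c)).
Proof.
  intros Hc; unfold Theta.
  apply is_lim_seq_plus'; [apply is_lim_seq_const|].
  apply (is_lim_seq_scal_l _ 2 (Finite _)).
  (* From [sin y >= y / 3] on [[0, 2]], where [m (y / 3)^2 = PI^2 j^2 / (9 lambda^2)], and
     [lambda^2 < 2 c] eventually. *)
  set (d := PI ^ 2 / (18 * c)).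
  pose proof PI_RGT_0 as HPI.
  assert (Hd : 0 < d) by (apply Rdiv_lt_0_compat; [apply pow_lt; auto|lra]).
  assert (Hrho : 0 <= exp (- d) < 1) by (apply exp_opp_lt_1; lra).
  apply (tannery (fun k j => match j with
    | O => 0
    | S _ => if le_lt_dec j (pol_p c k)
             then (1 - sin (PI * INR j / INR (pol_l c k)) ^ 2) ^ (S k) else 0
    end) _ (exp (- d))); auto.
  - pose proof (pol_lambda_lim c Hc) as Hl.
    assert (Hl2 : is_lim_seq (fun k => pol_lambda c k * pol_lambda c k) (sqrt c * sqrt c)) by (apply is_lim_seq_mult'; auto).
    rewrite sqrt_sqrt in Hl2 by lra.
    generalize (is_lim_seq_lt_eventually _ c (2 * c) Hl2 ltac:(lra)); apply filter_imp; intros k Hk j.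
    destruct j as [|j]; [simpl; lra|].
    destruct (le_lt_dec (S j) (pol_p c k)) as [Hle|Hlt]; [|split; [lra|apply pow_le; lra]].
    pose proof (pol_angle c k (S j) Hle) as Hang.
    set (y := PI * INR (S j) / INR (pol_l c k)) in *.
    pose proof (sin_sq_bound y) as Hs.
    split; [apply pow_le; lra|].
    eapply Rle_trans; [apply one_minus_pow_le_exp; auto|].
    eapply Rle_trans; [|apply exp_quadratic_le_geom; lra].
    apply exp_le_exp, Ropp_le_contravar.
    assert (Hy2 : y <= 2) by (pose proof PI_4; lra).
    assert (Hsy : y / 3 <= sin y).
    { eapply Rle_trans; [|apply sin_ge_cubic; lra]; nra. }
    assert (Hsq : (y / 3) ^ 2 <= sin y ^ 2) by (apply pow_incr; lra).
    assert (Hm : 0 < INR (S k)) by (apply lt_0_INR; lia).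
    apply Rle_trans with (INR (S k) * (y / 3) ^ 2); [|apply Rmult_le_compat_l; lra].
    pose proof (sqrt_S_pos k); pose proof (pol_l_pos c k) as Hlp.
    assert (Hla : 0 < pol_lambda c k) by (apply Rdiv_lt_0_compat; auto).
    replace (INR (S k) * (y / 3) ^ 2) with (PI ^ 2 / 9 * / (pol_lambda c k * pol_lambda c k) * INR (S j) ^ 2).
    + apply Rmult_le_compat_r; [apply pow_le, pos_INR|].
      unfold d; replace (PI ^ 2 / (18 * c)) with (PI ^ 2 / 9 * / (2 * c)) by (field; lra).
      apply Rmult_le_compat_l; [apply Rdiv_le_0_compat; [apply pow_le|]; lra|].
      apply Rinv_le_contravar; [nra|lra].
    + unfold y, pol_lambda.
      replace (INR (S k)) with (sqrt (INR (S k)) * sqrt (INR (S k))) at 3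
        by (apply sqrt_sqrt, pos_INR); field; lra.
  - intros [|j]; [apply is_lim_seq_const|apply (theta_lhs_term_lim c (S j)); auto].
Qed.

Lemma theta_prelimit (c : R) (k : nat) :
  1 + 2 * theta_lhs c k = INR (pol_l c k) * (cbin (S k) 0 / 4 ^ (S k)) * (1 + 2 * theta_rhs c k).
Proof.
  pose proof (polya_identity (S k) (pol_p c k)) as H; cbv zeta in H; fold (pol_l c k) in H.
  assert (H4 : 0 < 4 ^ (S k)) by (apply pow_lt; lra).
  pose proof (cbin_central_pos (S k)) as Hb.
  assert (E1 : theta_lhs c k = / 4 ^ (S k) *
    sum_n (fun j => match j with O => 0 | S _ => (2 + 2 * cos (2 * PI * INR j / INR (pol_l c k))) ^ S k end) (pol_p c k)).
  { unfold theta_lhs; rewrite (Series_finite _ (pol_p c k)).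
    - rewrite <- sum_n_Rmult.
      apply (sum_n_ext_loc (G := R_AbelianMonoid)); intros [|j] Hj; [rewrite Rmult_0_r; reflexivity|].
      destruct (le_lt_dec (S j) (pol_p c k)) as [_|Hn]; [|lia].
      replace (2 * PI * INR (S j) / INR (pol_l c k)) with (2 * (PI * INR (S j) / INR (pol_l c k)))
        by (field; apply Rgt_not_eq, pol_l_pos).
      rewrite cos_2a_sin.
      set (x := sin _).
      replace (2 + 2 * (1 - 2 * x * x)) with (4 * (1 - x ^ 2)) by ring.
      rewrite Rpow_mult_distr, <- Rmult_assoc, Rinv_l by lra; rewrite Rmult_1_l; reflexivity.
    - intros [|j] Hj; [lia|destruct (le_lt_dec (S j) (pol_p c k)); [lia|auto]]. }
  assert (E2 : theta_rhs c k = / cbin (S k) 0 *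
    sum_n (fun q => match q with O => 0 | S _ => cbin (S k) (pol_l c k * q) end) (S k)).
  { unfold theta_rhs; rewrite (Series_finite _ (S k)).
    - rewrite <- sum_n_Rmult; apply sum_n_ext_R; intros [|q]; [ring|].
      unfold cratio; field; lra.
    - intros [|q] Hq; [lia|apply cratio_0; unfold pol_l; nia]. }
  rewrite E1, E2.
  apply Rmult_eq_reg_l with (4 ^ S k); [|lra].
  match type of H with ?a + 2 * ?s = ?l * (?b + 2 * ?t) =>
    replace (a * (1 + 2 * (/ a * s))) with (a + 2 * s) by (field; lra);
    replace (a * (l * (b / a) * (1 + 2 * (/ b * t)))) with (l * (b + 2 * t)) by (field; lra) end.
  exact H.
Qed.

Lemma Theta_ge_1 (c : R) : 0 < c -> 1 <= Theta c.
Proof.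
  intros Hc; apply (is_lim_seq_le (fun _ => 1) (fun k => 1 + 2 * theta_rhs c k) 1 (Theta c)).
  - intros k; unfold theta_rhs.
    assert (0 <= Series (fun q => match q with O => 0 | S _ => cratio (S k) (pol_l c k * q) end)); [|lra].
    rewrite (Series_finite _ (S k)).
    + induction (S k) as [|n IH] at 2; [rewrite sum_O; lra|].
      rewrite sum_n_SR; pose proof (cratio_ge_0 (S k) (pol_l c k * S n)); lra.
    + intros [|q] Hq; [lia|apply cratio_0; unfold pol_l; nia].
  - apply is_lim_seq_const.
  - apply theta_rhs_lim; auto.
Qed.

(* The unknown prefactor [C(2m,m) / 4^m] cancels against the self-dual case [c = PI]. *)
Lemma Theta_functional (c : R) : 0 < c -> Theta (PI ^ 2 / c) * sqrt PI = sqrt c * Theta c.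
Proof.
  intros Hc; pose proof PI_RGT_0 as HPI.
  assert (HT : Theta (PI ^ 2 / PI) = Theta PI) by (f_equal; field; lra).
  pose proof (theta_lhs_lim PI HPI) as L1; rewrite HT in L1.
  assert (Hlim : Theta (PI ^ 2 / c) * Theta PI * sqrt PI = Theta PI * Theta c * sqrt c).
  { assert (H1 : is_lim_seq (fun k => (1 + 2 * theta_lhs c k) * (1 + 2 * theta_rhs PI k) * pol_lambda PI k)
      (Theta (PI ^ 2 / c) * Theta PI * sqrt PI)).
    { apply is_lim_seq_mult'; [apply is_lim_seq_mult'; [apply theta_lhs_lim|apply theta_rhs_lim]|apply pol_lambda_lim]; auto. }
    assert (H2 : is_lim_seq (fun k => (1 + 2 * theta_lhs PI k) * (1 + 2 * theta_rhs c k) * pol_lambda c k)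
      (Theta PI * Theta c * sqrt c)).
    { apply is_lim_seq_mult'; [apply is_lim_seq_mult'; [auto|apply theta_rhs_lim]|apply pol_lambda_lim]; auto. }
    apply is_lim_seq_unique in H1; apply is_lim_seq_unique in H2.
    assert (E : Lim_seq (fun k => (1 + 2 * theta_lhs c k) * (1 + 2 * theta_rhs PI k) * pol_lambda PI k)
      = Lim_seq (fun k => (1 + 2 * theta_lhs PI k) * (1 + 2 * theta_rhs c k) * pol_lambda c k)).
    { apply Lim_seq_ext; intros k; rewrite !theta_prelimit; unfold pol_lambda, Rdiv; ring. }
    rewrite H1, H2 in E; injection E; auto. }
  pose proof (Theta_ge_1 PI HPI).
  apply Rmult_eq_reg_l with (Theta PI); lra.
Qed.

(** * The functional equation *)

Definition gauss_int (v : R) : R := RInt (fun y => exp (- (PI * y ^ 2))) 0 v.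

Lemma continuous_gauss (y : R) : continuous (fun y => exp (- (PI * y ^ 2))) y.
Proof. continuous_by_derive; auto. Qed.

Lemma is_derive_gauss_int (v : R) : is_derive gauss_int v (exp (- (PI * v ^ 2))).
Proof.
  apply (is_derive_RInt (V := R_NormedModule) (fun y => exp (- (PI * y ^ 2))) gauss_int 0 v); [|apply continuous_gauss].
  apply filter_forall; intros y; apply (RInt_correct (V := R_CompleteNormedModule)).
  apply (ex_RInt_continuous (V := R_CompleteNormedModule)); intros; apply continuous_gauss.
Qed.

Lemma gauss_int_0 : gauss_int 0 = 0.
Proof. apply (RInt_point (V := R_CompleteNormedModule)). Qed.

Lemma gauss_int_increment (u v : R) : 0 <= u <= v ->
  (v - u) * exp (- (PI * v ^ 2)) <= gauss_int v - gauss_int u <= (v - u) * exp (- (PI * u ^ 2)).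
Proof.
  intros Huv; pose proof PI_RGT_0.
  destruct (MVT_gen gauss_int u v (fun y => exp (- (PI * y ^ 2)))) as (c & Hc & E).
  - intros x _; apply is_derive_gauss_int.
  - intros x _; apply continuity_pt_filterlim.
    apply (ex_derive_continuous (K := R_AbsRing) (V := R_NormedModule)); eexists; apply is_derive_gauss_int.
  - rewrite Rmin_left, Rmax_right in Hc by lra.
    rewrite E, (Rmult_comm (exp _)); split; apply Rmult_le_compat_l; try lra;
      apply exp_le_exp, Ropp_le_contravar, Rmult_le_compat_l; try lra; apply pow_incr; lra.
Qed.

Lemma gauss_int_nonneg (v : R) : 0 <= v -> 0 <= gauss_int v <= v.
Proof.
  intros Hv; pose proof (gauss_int_increment 0 v ltac:(lra)) as H.
  rewrite gauss_int_0 in H.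
  replace (exp (- (PI * 0 ^ 2))) with 1 in H by (replace (- (PI * 0 ^ 2)) with 0 by ring; rewrite exp_0; auto).
  pose proof (exp_pos (- (PI * v ^ 2))); split; [|lra]; apply Rle_trans with ((v - 0) * exp (- (PI * v ^ 2))); [|lra].
  apply Rmult_le_pos; lra.
Qed.

Lemma gauss_int_incr (u v : R) : 0 <= u <= v -> gauss_int u <= gauss_int v.
Proof.
  intros H; pose proof (gauss_int_increment u v H).
  pose proof (exp_pos (- (PI * v ^ 2))); nra.
Qed.

Lemma gauss_int_bounded : exists B, forall v, 0 <= v -> gauss_int v <= B.
Proof.
  pose proof PI_RGT_0 as HPI.
  (* As [v^2 >= 2 v - 1], the integrand is at most [e^(PI - 2 PI v)]; the added term has minus this
     function as derivative, so [g] is nonincreasing for [v >= 0]. *)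
  set (g := fun v => gauss_int v + exp PI / (2 * PI) * exp (- (2 * PI * v))).
  exists (g 0); intros v Hv.
  assert (g v <= g 0).
  { destruct (MVT_gen g 0 v (fun v => exp (- (PI * v ^ 2)) - exp (PI + - (2 * PI * v)))) as (c & Hc & E).
    - intros x _.
      replace (exp (- (PI * x ^ 2)) - exp (PI + - (2 * PI * x)))
        with (exp (- (PI * x ^ 2)) + - exp (PI + - (2 * PI * x))) by ring.
      apply (is_derive_plus (K := R_AbsRing) (V := R_NormedModule)); [apply is_derive_gauss_int|].
      auto_derive; auto; rewrite exp_plus; field; lra.
    - intros x _; apply continuity_pt_filterlim, (continuous_plus (V := R_NormedModule)).
      + apply (ex_derive_continuous (K := R_AbsRing) (V := R_NormedModule)); eexists; apply is_derive_gauss_int.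
      + continuous_by_derive; auto.
    - assert (exp (- (PI * c ^ 2)) <= exp (PI + - (2 * PI * c))) by (apply exp_le_exp; pose proof (pow2_ge_0 (c - 1)); nra).
      rewrite Rminus_0_r in E; nra. }
  assert (gauss_int v <= g v); [|lra].
  unfold g; assert (0 <= exp PI / (2 * PI) * exp (- (2 * PI * v))); [|lra].
  apply Rmult_le_pos; [apply Rdiv_le_0_compat; [left; apply exp_pos|lra]|left; apply exp_pos].
Qed.

Lemma gauss_int_lim : exists I, 0 <= I /\ (forall v, 0 <= v -> gauss_int v <= I) /\
  filterlim gauss_int p_oo (locally I).
Proof.
  destruct gauss_int_bounded as [B HB].
  destruct (completeness (fun y => exists v, 0 <= v /\ y = gauss_int v)) as [I [HI1 HI2]].
  - exists B; intros y (v & Hv & ->); auto.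
  - exists (gauss_int 0), 0; split; auto; lra.
  - exists I; assert (Hle : forall v, 0 <= v -> gauss_int v <= I) by (intros v Hv; apply HI1; exists v; auto).
    split; [|split; auto].
    + rewrite <- gauss_int_0; apply Hle; lra.
    + apply filterlim_R_iff; [typeclasses eauto|]; intros eps He.
      assert (Hex : exists v, 0 <= v /\ I - eps < gauss_int v).
      { apply NNPP; intros Hn; assert (I <= I - eps); [|lra].
        apply HI2; intros y (v & Hv & ->); apply Rnot_lt_le; intros Hlt; apply Hn; exists v; auto. }
      destruct Hex as (v0 & Hv0 & Hlt).
      apply (p_oo_intro _ v0); intros v Hv.
      pose proof (gauss_int_incr v0 v ltac:(lra)); pose proof (Hle v ltac:(lra)).
      apply Rabs_lt_between; lra.
Qed.

(** * Comparison of the Gaussian sum with its integral *)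

Fixpoint gauss_psum (x : R) (N : nat) : R :=
  match N with
  | O => 0
  | S n => gauss_psum x n + exp (- (PI * x * INR (S n) ^ 2))
  end.

(** The subtracted quotient is the integral of [exp (- PI y^2 x)] over [[0, N]], rescaled by
    [y -> y sqrt x]. *)
Definition gauss_defect (x : R) (N : nat) : R := gauss_psum x N - gauss_int (INR N * sqrt x) / sqrt x.

Lemma gauss_defect_0 (x : R) : gauss_defect x 0 = 0.
Proof. unfold gauss_defect; simpl; rewrite Rmult_0_l, gauss_int_0; unfold Rdiv; ring. Qed.

Lemma gauss_step (x : R) (N : nat) : 0 < x ->
  exp (- (PI * x * INR (S N) ^ 2)) <=
    gauss_int (INR (S N) * sqrt x) / sqrt x - gauss_int (INR N * sqrt x) / sqrt x
  <= exp (- (PI * x * INR N ^ 2)).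
Proof.
  intros Hx; pose proof (sqrt_lt_R0 x Hx) as Hs; pose proof (pos_INR N).
  assert (Hsq : forall n, exp (- (PI * (INR n * sqrt x) ^ 2)) = exp (- (PI * x * INR n ^ 2))).
  { intros n; f_equal; f_equal; rewrite Rpow_mult_distr.
    replace (sqrt x ^ 2) with x by (simpl; rewrite Rmult_1_r, sqrt_sqrt; lra); ring. }
  pose proof (gauss_int_increment (INR N * sqrt x) (INR (S N) * sqrt x)) as Hi.
  rewrite !Hsq in Hi.
  replace (INR (S N) * sqrt x - INR N * sqrt x) with (sqrt x) in Hi by (rewrite S_INR; ring).
  destruct Hi as [H1 H2]; [rewrite S_INR; split; nra|].
  replace (gauss_int (INR (S N) * sqrt x) / sqrt x - gauss_int (INR N * sqrt x) / sqrt x)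
    with ((gauss_int (INR (S N) * sqrt x) - gauss_int (INR N * sqrt x)) / sqrt x) by (field; lra).
  split; [apply Rle_div_r; auto; lra|apply Rle_div_l; auto; lra].
Qed.

(** On each unit interval the integral lies between the values of the decreasing Gaussian at the two
    ends; the differences of these values telescope. *)
Lemma gauss_defect_decr (x : R) (N k : nat) : 0 < x ->
  - (exp (- (PI * x * INR N ^ 2)) - exp (- (PI * x * INR (N + k) ^ 2)))
    <= gauss_defect x (N + k) - gauss_defect x N <= 0.
Proof.
  intros Hx; induction k as [|k IH]; [rewrite Nat.add_0_r; lra|].
  rewrite Nat.add_succ_r; pose proof (gauss_step x (N + k) Hx).
  assert (E : gauss_defect x (S (N + k)) - gauss_defect x (N + k) =
    exp (- (PI * x * INR (S (N + k)) ^ 2)) -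
     (gauss_int (INR (S (N + k)) * sqrt x) / sqrt x - gauss_int (INR (N + k) * sqrt x) / sqrt x)).
  { unfold gauss_defect; change (gauss_psum x (S (N + k))) with (gauss_psum x (N + k) + exp (- (PI * x * INR (S (N + k)) ^ 2))); ring. }
  lra.
Qed.

(** The sum of [exp (- PI n^2 x)] over [n >= 1]. *)
Definition theta_psi (x : R) : R := (Theta (PI * x) - 1) / 2.

Lemma gauss_psum_lim (x : R) : 0 < x -> is_lim_seq (gauss_psum x) (theta_psi x).
Proof.
  intros Hx; pose proof PI_RGT_0.
  set (u := fun q => match q with O => 0 | S _ => exp (- (PI * x * INR q ^ 2)) end).
  assert (Hex : ex_series u).
  { apply (ex_series_geom_bound u (exp (- (PI * x))) 1); [apply exp_opp_lt_1; nra|].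
    intros [|q]; rewrite Rmult_1_l.
    - simpl; rewrite Rabs_R0; lra.
    - unfold u; rewrite Rabs_right by (left; apply exp_pos); apply exp_quadratic_le_geom; nra. }
  assert (E : theta_psi x = Series u) by (unfold theta_psi, Theta; fold u; field).
  rewrite E; apply (is_lim_seq_ext (fun n => sum_n u n)); [|exact (Series_correct u Hex)].
  intros n; induction n as [|n IH]; [rewrite sum_O; reflexivity|].
  rewrite sum_n_SR, IH; reflexivity.
Qed.

Lemma gauss_int_scaled_lim (x I : R) : 0 < x -> filterlim gauss_int p_oo (locally I) ->
  is_lim_seq (fun N => gauss_int (INR N * sqrt x) / sqrt x) (I / sqrt x).
Proof.
  intros Hx HI; pose proof (sqrt_lt_R0 x Hx) as Hs.
  apply is_lim_seq_div'; [|apply is_lim_seq_const|lra].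
  apply (filterlim_comp _ _ _ (fun N => INR N * sqrt x) gauss_int eventually p_oo); auto.
  intros P [M HM].
  destruct (nfloor_ex (Rmax (M / sqrt x) 0)) as [n [Hn1 Hn2]]; [apply Rmax_r|].
  exists (S n); intros k Hk; apply HM; pose proof (Rmax_l (M / sqrt x) 0) as Hm.
  apply le_INR in Hk; rewrite S_INR in Hk; apply Rlt_div_l; auto; lra.
Qed.

(* Comparing the sum with the integral gives [sqrt x * theta_psi x -> I] as [x -> 0];
   the functional equation of theta forces the limit to be [1 / 2]. *)
Lemma gauss_int_total (I : R) : 0 <= I -> (forall v, 0 <= v -> gauss_int v <= I) ->
  filterlim gauss_int p_oo (locally I) -> I = 1 / 2.
Proof.
  intros HI0 HI1 HI; pose proof PI_RGT_0 as HPI.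
  assert (Hpsi : forall x, 0 < x -> I / sqrt x - 1 <= theta_psi x <= I / sqrt x /\ 0 <= theta_psi x).
  { intros x Hx; pose proof (sqrt_lt_R0 x Hx) as Hs.
    pose proof (is_lim_seq_minus' _ _ _ _ (gauss_psum_lim x Hx) (gauss_int_scaled_lim x I Hx HI)) as HL.
    assert (Hd : forall N, -1 <= gauss_defect x N <= 0).
    { intros N; pose proof (gauss_defect_decr x 0 N Hx) as H; rewrite gauss_defect_0 in H.
      simpl Nat.add in H; replace (exp (- (PI * x * INR 0 ^ 2))) with 1 in H.
      - pose proof (exp_pos (- (PI * x * INR N ^ 2))); lra.
      - simpl; rewrite Rmult_0_l, Rmult_0_r, Ropp_0, exp_0; auto. }
    assert (H1 : -1 <= theta_psi x - I / sqrt x).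
    { apply (is_lim_seq_le (fun _ => -1) (gauss_defect x) (-1) (theta_psi x - I / sqrt x));
        [apply Hd|apply is_lim_seq_const|exact HL]. }
    assert (H2 : theta_psi x - I / sqrt x <= 0).
    { apply (is_lim_seq_le (gauss_defect x) (fun _ => 0) (theta_psi x - I / sqrt x) 0);
        [apply Hd|exact HL|apply is_lim_seq_const]. }
    pose proof (Theta_ge_1 (PI * x) ltac:(nra)); unfold theta_psi in *; lra. }
  (* With [x = r^2], the number [r * Theta (PI r^2)] is within [O(r)] of [2 I] by comparison with
     the integral, and of [1] by the functional equation. *)
  assert (Hall : forall r, 0 < r -> Rabs (1 - 2 * I) <= (3 + 2 * I) * r).
  { intros r Hr.
    assert (Hx : 0 < r ^ 2) by nra.
    assert (Hsq : sqrt (r ^ 2) = r) by (apply sqrt_pow2; lra).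
    pose proof (Theta_functional (PI * r ^ 2) ltac:(nra)) as HF.
    replace (PI ^ 2 / (PI * r ^ 2)) with (PI * (/ r ^ 2)) in HF by (field; nra).
    rewrite sqrt_mult, Hsq in HF by nra.
    pose proof (sqrt_lt_R0 PI HPI) as Hsp.
    assert (HF' : Theta (PI * / r ^ 2) = r * Theta (PI * r ^ 2)).
    { apply Rmult_eq_reg_r with (sqrt PI); lra. }
    destruct (Hpsi (r ^ 2) Hx) as [P1 _].
    destruct (Hpsi (/ r ^ 2) (Rinv_0_lt_compat _ Hx)) as [P2 P3].
    rewrite sqrt_inv, Hsq in P2; rewrite Hsq in P1.
    unfold theta_psi in *; rewrite HF' in *.
    set (T := Theta (PI * r ^ 2)) in *.
    replace (I / / r) with (I * r) in P2 by (field; lra).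
    assert (Q1 : 2 * I - 2 * r <= r * T - r <= 2 * I).
    { split.
      - apply Rle_trans with (r * (2 * (I / r - 1))); [right; field; lra|].
        replace (r * T - r) with (r * (2 * ((T - 1) / 2))) by field; apply Rmult_le_compat_l; lra.
      - apply Rle_trans with (r * (2 * (I / r))); [|right; field; lra].
        replace (r * T - r) with (r * (2 * ((T - 1) / 2))) by field; apply Rmult_le_compat_l; lra. }
    apply Rabs_le; nra. }
  assert (H0 : Rabs (1 - 2 * I) <= 0).
  { apply Rnot_lt_le; intros Hlt.
    specialize (Hall (Rabs (1 - 2 * I) / (2 * (3 + 2 * I))) ltac:(apply Rdiv_lt_0_compat; lra)).
    replace ((3 + 2 * I) * (Rabs (1 - 2 * I) / (2 * (3 + 2 * I)))) with (Rabs (1 - 2 * I) / 2) in Hall by (field; lra).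
    lra. }
  pose proof (Rabs_pos (1 - 2 * I)).
  assert (E : Rabs (1 - 2 * I) = 0) by lra.
  apply Rabs_eq_0 in E; lra.
Qed.

Definition omega (x : R) : R := theta_psi x - / (2 * sqrt x).

Lemma gauss_defect_lim (x : R) : 0 < x -> is_lim_seq (gauss_defect x) (omega x).
Proof.
  intros Hx; destruct gauss_int_lim as (I & HI0 & HI1 & HI).
  pose proof (gauss_int_total I HI0 HI1 HI) as ->.
  unfold omega; replace (/ (2 * sqrt x)) with (1 / 2 / sqrt x) by (field; apply Rgt_not_eq, sqrt_lt_R0; auto).
  apply is_lim_seq_minus'; [apply gauss_psum_lim|apply gauss_int_scaled_lim]; auto.
Qed.

Lemma omega_defect (x : R) (N : nat) : 0 < x ->
  Rabs (omega x - gauss_defect x N) <= exp (- (PI * x * INR N ^ 2)).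
Proof.
  intros Hx.
  assert (HL : is_lim_seq (fun k => gauss_defect x (N + k) - gauss_defect x N) (omega x - gauss_defect x N)).
  { apply is_lim_seq_minus'; [|apply is_lim_seq_const].
    apply (is_lim_seq_ext (fun k => gauss_defect x (k + N))); [intros k; f_equal; lia|].
    apply (is_lim_seq_incr_n (gauss_defect x) N (omega x)), gauss_defect_lim; auto. }
  apply Rabs_le; split.
  - apply (is_lim_seq_le (fun _ => - exp (- (PI * x * INR N ^ 2)))
      (fun k => gauss_defect x (N + k) - gauss_defect x N)
      (- exp (- (PI * x * INR N ^ 2))) (omega x - gauss_defect x N)); [|apply is_lim_seq_const|exact HL].
    intros k; pose proof (gauss_defect_decr x N k Hx); pose proof (exp_pos (- (PI * x * INR (N + k) ^ 2))); lra.
  - assert (omega x - gauss_defect x N <= 0).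
    { apply (is_lim_seq_le (fun k => gauss_defect x (N + k) - gauss_defect x N) (fun _ => 0) (omega x - gauss_defect x N) 0);
        [intros k; apply gauss_defect_decr; auto|exact HL|apply is_lim_seq_const]. }
    pose proof (exp_pos (- (PI * x * INR N ^ 2))); lra.
Qed.

Lemma omega_bound_1 (x : R) : 0 < x -> Rabs (omega x) <= 1.
Proof.
  intros Hx; pose proof (omega_defect x 0 Hx) as H.
  rewrite gauss_defect_0, Rminus_0_r in H.
  replace (exp (- (PI * x * INR 0 ^ 2))) with 1 in H; auto.
  simpl; rewrite Rmult_0_l, Rmult_0_r, Ropp_0, exp_0; auto.
Qed.

(** Used for large [x]; together with [omega_bound_1] near [0] it makes the Mellin integral of
    [omega] converge absolutely throughout [0 < Re s < 1]. *)
Lemma omega_bound_sqrt (x : R) : 0 < x -> Rabs (omega x) <= / sqrt x.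
Proof.
  intros Hx; pose proof (sqrt_lt_R0 x Hx) as Hs; pose proof PI_RGT_0.
  assert (H2 : omega x <= 0).
  { apply (is_lim_seq_le (gauss_defect x) (fun _ => 0) (omega x) 0);
      [|apply gauss_defect_lim; auto|apply is_lim_seq_const].
    intros N; pose proof (gauss_defect_decr x 0 N Hx) as H1; rewrite gauss_defect_0 in H1.
    simpl Nat.add in H1; lra. }
  pose proof (Theta_ge_1 (PI * x) ltac:(nra)) as HT.
  unfold omega, theta_psi in *.
  assert (/ (2 * sqrt x) = / sqrt x / 2) as E by (field; lra).
  assert (0 < / sqrt x) by (apply Rinv_0_lt_compat; auto).
  rewrite E in *; apply Rabs_le; lra.
Qed.

Lemma omega_inv (x : R) : 0 < x -> omega (/ x) = sqrt x * omega x.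
Proof.
  intros Hx; pose proof (sqrt_lt_R0 x Hx) as Hs; pose proof PI_RGT_0 as HPI.
  pose proof (Theta_functional (PI * x) ltac:(nra)) as HF.
  replace (PI ^ 2 / (PI * x)) with (PI * / x) in HF by (field; lra).
  rewrite sqrt_mult in HF by lra.
  pose proof (sqrt_lt_R0 PI HPI) as Hsp.
  assert (HF' : Theta (PI * / x) = sqrt x * Theta (PI * x)).
  { apply Rmult_eq_reg_r with (sqrt PI); lra. }
  unfold omega, theta_psi; rewrite HF', sqrt_inv; field; lra.
Qed.

Lemma continuous_gauss_defect (x : R) (N : nat) : 0 < x -> continuous (fun x => gauss_defect x N) x.
Proof.
  intros Hx; pose proof (sqrt_lt_R0 x Hx) as Hs.
  apply (continuous_minus (V := R_NormedModule)).
  - induction N as [|N IH]; [apply continuous_const|].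
    apply (continuous_plus (V := R_NormedModule)); auto.
    continuous_by_derive; auto.
  - apply (continuous_mult (K := R_AbsRing)).
    + apply (continuous_comp (fun x => INR N * sqrt x) gauss_int).
      * continuous_by_derive; auto.
      * apply (ex_derive_continuous (K := R_AbsRing) (V := R_NormedModule)); eexists; apply is_derive_gauss_int.
    + continuous_by_derive; split; [auto|lra].
Qed.

(** By [omega_defect] the continuous functions [gauss_defect] converge to [omega] uniformly on
    [[x / 2, oo)]. *)
Lemma continuous_omega (x : R) : 0 < x -> continuous omega x.
Proof.
  intros Hx; pose proof PI_RGT_0 as HPI.
  apply (proj2 (filterlim_R_iff (locally x) omega (omega x))); intros eps He.
  assert (Hd : 0 < PI * x / 2) by nra.
  pose proof (exp_opp_lt_1 _ Hd) as Hrho.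
  pose proof (is_lim_seq_geom (exp (- (PI * x / 2))) ltac:(rewrite Rabs_right; lra)) as Hg.
  destruct (proj1 (filterlim_R_iff eventually _ 0) Hg (eps / 3) ltac:(lra)) as [N HN].
  specialize (HN N (Nat.le_refl _)); rewrite Rminus_0_r, Rabs_right in HN by (apply Rle_ge, pow_le; lra).
  assert (HN' : forall y, x / 2 <= y -> Rabs (omega y - gauss_defect y N) < eps / 3).
  { intros y Hy; eapply Rle_lt_trans; [apply omega_defect; lra|].
    eapply Rle_lt_trans; [apply (exp_quadratic_le_geom (PI * y)); nra|].
    eapply Rle_lt_trans; [|exact HN]; apply pow_incr; split; [left; apply exp_pos|].
    apply exp_le_exp, Ropp_le_contravar; nra. }
  pose proof (proj1 (filterlim_R_iff (locally x) _ _) (continuous_gauss_defect x N Hx) (eps / 3) ltac:(lra)) as Hc.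
  assert (Hloc : locally x (fun y => x / 2 < y)) by (apply (open_gt (x / 2) x); lra).
  generalize (filter_and _ _ Hc Hloc); apply filter_imp; intros y [H1 H2].
  pose proof (HN' y ltac:(lra)) as H3; pose proof (HN' x ltac:(lra)) as H4.
  apply Rabs_lt_between in H1; apply Rabs_lt_between in H3; apply Rabs_lt_between in H4.
  apply Rabs_lt_between; lra.
Qed.

(** * Mellin transforms and the completed zeta function *)

Definition gamma_factor (s : C) : C := (Rcpow PI (- (s / 2)) * CGamma (s / 2))%C.

Definition omega_mellin (s : C) : C :=
  @RInt_gen CV (fun x => Rcpow x (s / 2 - 1) * RtoC (omega x))%C (at_right 0) p_oo.

Lemma Re_half (s : C) : Re (s / 2) = Re s / 2.
Proof. destruct s as [a b]; unfold Re, Cdiv, Cinv; simpl; field. Qed.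

Lemma Re_half_minus_1 (s : C) : Re (s / 2 - 1) = Re s / 2 - 1.
Proof. rewrite <- Re_half; unfold Re; simpl; ring. Qed.

Lemma Rcpow_sqr (x : R) (s : C) : 0 < x -> Rcpow (x ^ 2) s = Rcpow x (s + s).
Proof.
  intros Hx; replace (x ^ 2) with (x * x) by ring; rewrite Rcpow_mult_l, Rcpow_plus; auto.
Qed.

Lemma is_CInt_gauss_mellin (s : C) (n : R) : 0 < n -> 0 < Re s ->
  is_CInt_0_oo (fun x => Rcpow x (s / 2 - 1) * RtoC (exp (- (PI * x * n ^ 2))))%C
    (gamma_factor s * Rcpow n (- s))%C.
Proof.
  intros Hn Hs; pose proof PI_RGT_0 as HPI.
  assert (Hc : 0 < PI * n ^ 2) by (apply Rmult_lt_0_compat; [lra|apply pow_lt; auto]).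
  pose proof (is_CInt_CGamma_scale (s / 2) (PI * n ^ 2) Hc ltac:(rewrite Re_half; lra)) as H.
  rewrite Rcpow_mult_l, Rcpow_sqr in H by (auto; apply pow_lt; auto).
  replace (- (s / 2) + - (s / 2))%C with (- s)%C in H by field.
  replace (gamma_factor s * Rcpow n (- s))%C with (Rcpow PI (- (s / 2)) * Rcpow n (- s) * CGamma (s / 2))%C
    by (unfold gamma_factor; ring).
  revert H; apply is_CInt_0_oo_ext; intros x Hx; f_equal; f_equal; f_equal; ring.
Qed.

Lemma Cmod_power_bound (s : C) (x y : R) (r : R) : Rabs y <= r ->
  Cmod (Rcpow x s * RtoC y) <= Rpower x (Re s) * r.
Proof.
  intros H; rewrite Cmod_mult, Cmod_Rcpow, Cmod_R; apply Rmult_le_compat_l; auto; left; apply Rpower_pos.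
Qed.

Lemma continuous_gauss_int (v : R) : continuous gauss_int v.
Proof.
  apply (ex_derive_continuous (K := R_AbsRing) (V := R_NormedModule)); eexists; apply is_derive_gauss_int.
Qed.

(** The function [x^((s-1)/2) gauss_int (n sqrt x)] is [O(x^(Re s / 2))] at [0] and
    [O(x^((Re s - 1) / 2))] at infinity, so in the strip its derivative has integral [0]. This
    reduces the claim to [is_CInt_gauss_mellin]. *)
Lemma is_CInt_gauss_int_mellin (s : C) (n : R) : 0 < n -> 0 < Re s < 1 ->
  is_CInt_0_oo (fun x => Rcpow x (s / 2 - 1) * RtoC (gauss_int (n * sqrt x) / sqrt x))%C
    (gamma_factor s * (Rcpow n (1 - s) / (1 - s)))%C.
Proof.
  intros Hn Hs.
  assert (Hs1 : (1 - s)%C <> 0%C).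
  { apply Cminus_neq_0; intros E; rewrite <- E in Hs; simpl in Hs; lra. }
  set (h := fun x => (Rcpow x (s / 2 - 1) * RtoC (gauss_int (n * sqrt x) / sqrt x))%C).
  set (g := fun x => (Rcpow x (s / 2 - 1) * RtoC (exp (- (PI * x * n ^ 2))))%C).
  pose proof (is_CInt_gauss_mellin s n Hn ltac:(lra)) as Hg; fold g in Hg.
  assert (Hsx : forall x, 0 < x -> Rcpow x ((s - 1) / 2) = (RtoC (sqrt x) * Rcpow x (s / 2 - 1))%C).
  { intros x Hx; rewrite <- Rpower_sqrt, <- Rcpow_RtoC, <- Rcpow_plus by auto; f_equal.
    rewrite RtoC_inv by lra; field. }
  assert (HF : is_CInt_0_oo (fun x => (s - 1) / 2 * h x + RtoC n / 2 * g x)%C (0 - 0)%C).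
  { apply (is_CInt_0_oo_primitive _ (fun x => Rcpow x ((s - 1) / 2) * RtoC (gauss_int (n * sqrt x)))%C).
    - intros x Hx; pose proof (sqrt_lt_R0 x Hx) as Hq.
      replace ((s - 1) / 2 * h x + RtoC n / 2 * g x)%C
        with ((s - 1) / 2 * Rcpow x ((s - 1) / 2 - 1) * RtoC (gauss_int (n * sqrt x))
              + Rcpow x ((s - 1) / 2) * RtoC (n / (2 * sqrt x) * exp (- (PI * x * n ^ 2))))%C.
      + apply (is_derive_Cmult (fun x => Rcpow x ((s - 1) / 2)) (fun x => RtoC (gauss_int (n * sqrt x)))).
        * apply is_derive_Rcpow; auto.
        * apply is_derive_RtoC.
          replace (exp (- (PI * x * n ^ 2))) with (exp (- (PI * (n * sqrt x) ^ 2))).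
          2:{ f_equal; f_equal; rewrite Rpow_mult_distr.
              replace (sqrt x ^ 2) with x by (simpl; rewrite Rmult_1_r, sqrt_sqrt; lra); ring. }
          apply (is_derive_comp gauss_int (fun x => n * sqrt x)); [apply is_derive_gauss_int|].
          auto_derive; auto; field; lra.
      + rewrite Rcpow_minus_1, Hsx by auto; unfold h, g.
        assert (Hq0 : RtoC (sqrt x) <> 0%C) by (apply RtoC_neq_0; lra).
        assert (Hx0 : RtoC x <> 0%C) by (apply RtoC_neq_0; lra).
        replace (/ x) with (/ sqrt x * / sqrt x) by (rewrite <- Rinv_mult, sqrt_sqrt; lra).
        rewrite !RtoC_mult, !RtoC_div, !RtoC_mult, !RtoC_inv by lra.
        field; auto.
    - intros x Hx; pose proof (sqrt_lt_R0 x Hx) as Hq.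
      apply continuous_RC_plus.
      + apply (continuous_Cmult (fun _ => (s - 1) / 2)%C h); [apply continuous_RC_const|].
        apply (continuous_Cmult (fun x => Rcpow x (s / 2 - 1)) (fun x => RtoC (gauss_int (n * sqrt x) / sqrt x)));
          [apply continuous_Rcpow; auto|apply continuous_RtoC].
        apply (continuous_mult (K := R_AbsRing)).
        * apply (continuous_comp (fun x => n * sqrt x) gauss_int); [|apply continuous_gauss_int].
          continuous_by_derive; auto.
        * continuous_by_derive; split; [auto|lra].
      + apply (continuous_Cmult (fun _ => RtoC n / 2)%C g); [apply continuous_RC_const|].
        apply (continuous_Cmult (fun x => Rcpow x (s / 2 - 1)) (fun x => RtoC (exp (- (PI * x * n ^ 2)))));
          [apply continuous_Rcpow; auto|apply continuous_RtoC].
        continuous_by_derive; auto.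
    - apply (filterlim_C_0_bound (at_right 0) _ (fun x => n * Rpower x (Re s / 2))).
      + generalize at_right_0_pos; apply filter_imp; intros x Hx.
        pose proof (sqrt_lt_R0 x Hx) as Hq.
        rewrite Hsx by auto.
        pose proof (gauss_int_nonneg (n * sqrt x) ltac:(nra)) as [G1 G2].
        replace (RtoC (sqrt x) * Rcpow x (s / 2 - 1) * RtoC (gauss_int (n * sqrt x)))%C
          with (Rcpow x (s / 2 - 1) * RtoC (sqrt x * gauss_int (n * sqrt x)))%C by (rewrite RtoC_mult; ring).
        eapply Rle_trans; [apply (Cmod_power_bound _ _ _ (n * x))|].
        * rewrite Rabs_right by (apply Rle_ge, Rmult_le_pos; lra).
          replace (n * x) with (sqrt x * (n * sqrt x)) by (rewrite <- (sqrt_sqrt x) at 3 by lra; ring).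
          apply Rmult_le_compat_l; lra.
        * rewrite Re_half_minus_1; right.
          replace (Re s / 2) with (Re s / 2 - 1 + 1) at 2 by ring; rewrite Rpower_plus, Rpower_1 by auto; ring.
      + apply filterlim_R_scal_0; [typeclasses eauto|]; apply Rpower_lim_0; lra.
    - destruct gauss_int_bounded as [B HB].
      apply (filterlim_C_0_bound p_oo _ (fun x => B * Rpower x ((Re s - 1) / 2))).
      + apply (p_oo_intro _ 0); intros x Hx.
        pose proof (sqrt_lt_R0 x Hx) as Hq.
        pose proof (gauss_int_nonneg (n * sqrt x) ltac:(nra)) as [G1 G2].
        eapply Rle_trans; [apply (Cmod_power_bound _ _ _ B)|].
        * rewrite Rabs_right by lra; apply HB; nra.
        * right; rewrite Re_half; rewrite Rmult_comm; f_equal; f_equal; f_equal; unfold Re; simpl; ring.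
      + apply filterlim_R_scal_0; [typeclasses eauto|]; apply Rpower_lim_p_oo; lra. }
  pose proof (is_CInt_gen_scal (at_right 0) p_oo (2 / (s - 1))%C _ _
    (is_CInt_0_oo_minus _ _ _ _ HF (is_CInt_gen_scal (at_right 0) p_oo (RtoC n / 2)%C _ _ Hg))) as H.
  assert (Hs2 : (s - 1)%C <> 0%C).
  { replace (s - 1)%C with (- (1 - s))%C by ring; intros E; apply Hs1.
    replace (1 - s)%C with (- (- (1 - s)))%C by ring; rewrite E; ring. }
  replace (gamma_factor s * (Rcpow n (1 - s) / (1 - s)))%C
    with (2 / (s - 1) * (0 - 0 - RtoC n / 2 * (gamma_factor s * Rcpow n (- s))))%C.
  - revert H; apply is_CInt_0_oo_ext; intros x Hx; fold (h x); field; auto.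
  - replace (Rcpow n (1 - s)) with (RtoC n * Rcpow n (- s))%C.
    + field; auto.
    + rewrite <- (Rcpow_1_r n) at 1 by auto; rewrite <- Rcpow_plus; reflexivity.
Qed.

Lemma is_CInt_gauss_defect (s : C) (n : nat) : 0 < Re s < 1 ->
  is_CInt_0_oo (fun x => Rcpow x (s / 2 - 1) * RtoC (gauss_defect x (S n)))%C
    (gamma_factor s * (zeta_psum s n - Rcpow (INR (S n)) (1 - s) / (1 - s)))%C.
Proof.
  intros Hs.
  assert (H : forall m, is_CInt_0_oo (fun x => Rcpow x (s / 2 - 1) * RtoC (gauss_psum x (S m)))%C
    (gamma_factor s * zeta_psum s m)%C).
  { intros m; induction m as [|m IH].
    - generalize (is_CInt_gauss_mellin s (INR 1) (INR_S_pos 0) ltac:(lra)).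
      unfold zeta_psum at 1; rewrite sum_O; apply is_CInt_0_oo_ext; intros x Hx.
      change (gauss_psum x 1) with (0 + exp (- (PI * x * INR 1 ^ 2))); rewrite Rplus_0_l; auto.
    - rewrite zeta_psum_S, Cmult_plus_distr_l.
      generalize (is_CInt_0_oo_plus _ _ _ _ IH (is_CInt_gauss_mellin s (INR (S (S m))) (INR_S_pos _) ltac:(lra))).
      apply is_CInt_0_oo_ext; intros x Hx.
      change (gauss_psum x (S (S m))) with (gauss_psum x (S m) + exp (- (PI * x * INR (S (S m)) ^ 2))).
      rewrite RtoC_plus; ring. }
  replace (gamma_factor s * (zeta_psum s n - Rcpow (INR (S n)) (1 - s) / (1 - s)))%C
    with (gamma_factor s * zeta_psum s n - gamma_factor s * (Rcpow (INR (S n)) (1 - s) / (1 - s)))%C by ring.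
  generalize (is_CInt_0_oo_minus _ _ _ _ (H n) (is_CInt_gauss_int_mellin s (INR (S n)) (INR_S_pos n) Hs)).
  apply is_CInt_0_oo_ext; intros x Hx; unfold gauss_defect.
  rewrite RtoC_minus; ring.
Qed.

Lemma continuous_omega_mellin_integrand (s : C) (x : R) : 0 < x ->
  continuous_RC (fun x => Rcpow x (s / 2 - 1) * RtoC (omega x))%C x.
Proof.
  intros Hx; apply (continuous_Cmult (fun x => Rcpow x (s / 2 - 1)) (fun x => RtoC (omega x))).
  - apply continuous_Rcpow; auto.
  - apply continuous_RtoC, continuous_omega; auto.
Qed.

Lemma is_CInt_omega_mellin (s : C) : 0 < Re s < 1 ->
  is_CInt_0_oo (fun x => Rcpow x (s / 2 - 1) * RtoC (omega x))%C (omega_mellin s).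
Proof.
  intros Hs.
  set (a := Rmin (Re s / 2) ((1 - Re s) / 2)).
  assert (Ha : 0 < a) by (apply Rmin_glb_lt; lra).
  assert (Ha1 : a <= Re s / 2) by apply Rmin_l.
  assert (Ha2 : a <= (1 - Re s) / 2) by apply Rmin_r.
  destruct (ex_CInt_0_oo (fun x => Rcpow x (s / 2 - 1) * RtoC (omega x))%C a 1) as (l & Hl & _); auto; try lra.
  - intros x Hx; apply continuous_omega_mellin_integrand; auto.
  - intros x Hx; eapply Rle_trans; [apply Cmod_power_bound, omega_bound_1; lra|].
    rewrite Rmult_1_r, Rmult_1_l, Re_half_minus_1.
    apply Rpower_le_exponent_small; lra.
  - intros x Hx; eapply Rle_trans; [apply Cmod_power_bound, omega_bound_sqrt; lra|].
    rewrite Rmult_1_l, Re_half_minus_1, <- Rpower_sqrt, <- Rpower_Ropp, <- Rpower_plus by lra.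
    apply Rle_Rpower; lra.
  - unfold omega_mellin; rewrite (is_RInt_gen_unique (V := CV) _ l Hl); auto.
Qed.

Lemma omega_mellin_symm (s : C) : 0 < Re s < 1 -> omega_mellin (1 - s) = omega_mellin s.
Proof.
  intros Hs.
  assert (Hs' : 0 < Re (1 - s) < 1) by (destruct s; unfold Re in *; simpl in *; lra).
  apply (is_CInt_0_oo_unique (fun x => Rcpow x ((1 - s) / 2 - 1) * RtoC (omega x))%C).
  - apply is_CInt_omega_mellin; auto.
  - generalize (is_CInt_0_oo_inv _ _ (fun x Hx => continuous_omega_mellin_integrand s x Hx) (is_CInt_omega_mellin s Hs)).
    apply is_CInt_0_oo_ext; intros x Hx.
    rewrite Rcpow_inv_l, omega_inv, RtoC_mult by auto.
    replace (RtoC (/ x ^ 2)) with (Rcpow x (- (2))).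
    2:{ rewrite <- RtoC_opp, Rcpow_RtoC, Rpower_Ropp; f_equal; f_equal.
        change 2 with (INR 2); rewrite Rpower_pow by auto; reflexivity. }
    replace (RtoC (sqrt x)) with (Rcpow x (/ 2)).
    2:{ rewrite <- Rpower_sqrt, <- Rcpow_RtoC, RtoC_inv by (auto; lra); auto. }
    rewrite (Cmult_assoc (Rcpow x (- (s / 2 - 1)))), <- Rcpow_plus, Cmult_assoc, <- Rcpow_plus.
    f_equal; f_equal; field.
Qed.

Lemma completed_zeta (s : C) : 0 < Re s < 1 -> (gamma_factor s * zeta s)%C = omega_mellin s.
Proof.
  intros Hs; pose proof PI_RGT_0 as HPI.
  assert (Hs1 : s <> 1%C) by (intros ->; simpl in Hs; lra).
  pose proof (zeta_psum_lim_zeta s ltac:(lra) Hs1) as HZ.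
  apply (eventually_C_lim_unique
    (fun n => gamma_factor s * (zeta_psum s n - Rcpow (INR (S n)) (1 - s) / (1 - s)))%C).
  - apply (filterlim_C_iff eventually); intros eps He.
    rewrite (filterlim_C_iff eventually) in HZ.
    pose proof (Cmod_ge_0 (gamma_factor s)).
    assert (Hp : 0 < eps / (Cmod (gamma_factor s) + 1)) by (apply Rdiv_lt_0_compat; lra).
    generalize (HZ _ Hp); apply filter_imp; intros n Hn.
    replace (gamma_factor s * (zeta_psum s n - Rcpow (INR (S n)) (1 - s) / (1 - s)) - gamma_factor s * zeta s)%C
      with (gamma_factor s * (zeta_psum s n - Rcpow (INR (S n)) (1 - s) / (1 - s) - zeta s))%C by ring.
    rewrite Cmod_mult.
    set (d := Cmod (_ - zeta s)) in *.
    assert (0 <= d) by apply Cmod_ge_0.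
    apply Rlt_div_r in Hn; [|lra]; nra.
  (* The error is dominated by the integral of [x^(Re s / 2 - 1) exp (- PI N^2 x)], itself a Gamma
     integral at a real argument, equal to [gamma_factor sig] times [N^(- Re s)]. *)
  - set (sig := RtoC (Re s)).
    assert (Hsig : 0 < Re sig) by (simpl; lra).
    assert (Hb : forall n, Cmod (gamma_factor s * (zeta_psum s n - Rcpow (INR (S n)) (1 - s) / (1 - s)) - omega_mellin s)
       <= Cmod (gamma_factor sig) * Rpower (INR (S n)) (- Re s)).
    { intros n.
      pose proof (is_CInt_gen_Re (at_right 0) p_oo _ _ (is_CInt_gauss_mellin sig (INR (S n)) (INR_S_pos n) Hsig)) as Hg.
      destruct (ex_CInt_gen_dominated (fun x => 0 < x) (at_right 0) p_oo
        (fun x => Rcpow x (s / 2 - 1) * RtoC (gauss_defect x (S n)) - Rcpow x (s / 2 - 1) * RtoC (omega x))%C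
        (fun x => Re (Rcpow x (sig / 2 - 1) * RtoC (exp (- (PI * x * INR (S n) ^ 2)))))
        (Re (gamma_factor sig * Rcpow (INR (S n)) (- sig)))) as (l & Hl & Hlb); auto.
      - apply interval_pred_pos.
      - apply at_right_0_pos.
      - apply p_oo_pos.
      - generalize (prod_0_oo_ordered 1 1 ltac:(lra)); apply filter_imp; intros [u v]; simpl; lra.
      - intros x Hx; apply continuous_RC_minus; [|apply continuous_omega_mellin_integrand; auto].
        apply (continuous_Cmult (fun x => Rcpow x (s / 2 - 1)) (fun x => RtoC (gauss_defect x (S n)))).
        + apply continuous_Rcpow; auto.
        + apply continuous_RtoC, continuous_gauss_defect; auto.
      - intros x Hx; apply continuous_C_fst.
        apply (continuous_Cmult (fun x => Rcpow x (sig / 2 - 1)) (fun x => RtoC (exp (- (PI * x * INR (S n) ^ 2)))));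
          [apply continuous_Rcpow; auto|apply continuous_RtoC].
        continuous_by_derive; auto.
      - intros x Hx.
        replace (Rcpow x (s / 2 - 1) * RtoC (gauss_defect x (S n)) - Rcpow x (s / 2 - 1) * RtoC (omega x))%C
          with (Rcpow x (s / 2 - 1) * RtoC (gauss_defect x (S n) - omega x))%C by (rewrite RtoC_minus; ring).
        eapply Rle_trans; [apply (Cmod_power_bound _ _ _ (exp (- (PI * x * INR (S n) ^ 2))))|].
        + rewrite Rabs_minus_sym; apply omega_defect; auto.
        + right; rewrite Re_half_minus_1.
          replace (sig / 2 - 1)%C with (RtoC (Re s / 2 - 1)).
          * rewrite Rcpow_RtoC, <- RtoC_mult; reflexivity.
          * unfold sig; rewrite RtoC_minus, RtoC_div by lra; auto.
      - rewrite (is_CInt_0_oo_unique _ _ _ (is_CInt_0_oo_minus _ _ _ _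
          (is_CInt_gauss_defect s n Hs) (is_CInt_omega_mellin s Hs)) Hl).
        eapply Rle_trans; [exact Hlb|].
        eapply Rle_trans; [apply Rle_abs|].
        eapply Rle_trans; [apply re_le_Cmod|].
        rewrite Cmod_mult, Cmod_Rcpow; right; reflexivity. }
    assert (Hpow : filterlim (fun n => Rpower (INR (S n)) (- Re s)) eventually (locally 0)).
    { apply (filterlim_comp _ _ _ (fun n => INR (S n)) (fun x => Rpower x (- Re s)) eventually p_oo).
      - apply INR_S_lim_p_oo.
      - apply Rpower_lim_p_oo; lra. }
    apply (filterlim_R_scal_0 eventually _ (Cmod (gamma_factor sig))) in Hpow.
    apply (filterlim_C_iff eventually); intros eps He.
    generalize (proj1 (filterlim_R_iff eventually _ 0) Hpow eps He); apply filter_imp; intros n Hn.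
    eapply Rle_lt_trans; [apply Hb|].
    rewrite Rminus_0_r in Hn; eapply Rle_lt_trans; [apply Rle_abs|exact Hn].
Qed.

Lemma zeta_functional_equation (s : C) : 0 < Re s < 1 ->
  (gamma_factor (1 - s) * zeta (1 - s) = gamma_factor s * zeta s)%C.
Proof.
  intros Hs; rewrite !completed_zeta by (auto; destruct s; unfold Re in *; simpl in *; lra).
  apply omega_mellin_symm; auto.
Qed.

(** * Zeros in the critical strip *)

Lemma Clim_at_mult (f g : C -> C) (z a b : C) :
  Clim_at f z a -> Clim_at g z b -> Clim_at (fun w => f w * g w)%C z (a * b)%C.
Proof.
  intros Hf Hg eps He.
  pose proof (Cmod_ge_0 a); pose proof (Cmod_ge_0 b).
  set (A := Cmod a + 1); set (B := Cmod b + 1).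
  set (e := Rmin 1 (eps / (A + B))).
  assert (He1 : e <= 1) by apply Rmin_l.
  assert (He2 : e <= eps / (A + B)) by apply Rmin_r.
  assert (He0 : 0 < e) by (apply Rmin_glb_lt; [lra|apply Rdiv_lt_0_compat; unfold A, B; lra]).
  assert (He3 : e * (A + B) <= eps) by (apply Rle_div_r in He2; auto; unfold A, B; lra).
  destruct (Hf e He0) as (d1 & Hd1 & H1); destruct (Hg e He0) as (d2 & Hd2 & H2).
  exists (Rmin d1 d2); split; [apply Rmin_glb_lt; auto|]; intros w Hw.
  specialize (H1 w (Rlt_le_trans _ _ _ Hw (Rmin_l _ _))).
  specialize (H2 w (Rlt_le_trans _ _ _ Hw (Rmin_r _ _))).
  replace (f w * g w - a * b)%C with ((f w - a) * g w + a * (g w - b))%C by ring.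
  eapply Rle_lt_trans; [apply Cmod_triangle|]; rewrite !Cmod_mult.
  assert (Hgw : Cmod (g w) <= B).
  { pose proof (Cmod_ge_sub (g w) b); unfold B; lra. }
  pose proof (Cmod_ge_0 (f w - a)); pose proof (Cmod_ge_0 (g w - b)); pose proof (Cmod_ge_0 (g w)).
  assert (Cmod (f w - a) * Cmod (g w) <= e * B) by (apply Rmult_le_compat; lra).
  assert (Cmod a * Cmod (g w - b) <= Cmod a * e) by (apply Rmult_le_compat_l; lra).
  unfold A in He3; nra.
Qed.

Lemma Clim_at_bounds (f : C -> C) (z a : C) : Clim_at f z a -> a <> 0%C ->
  exists d, 0 < d /\ forall w, Cmod (w - z) < d -> Cmod a / 2 <= Cmod (f w) <= 2 * Cmod a.
Proof.
  intros Hf Ha; assert (Hp : 0 < Cmod a) by (apply Cmod_gt_0; auto).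
  destruct (Hf (Cmod a / 2) ltac:(lra)) as (d & Hd & H).
  exists d; split; auto; intros w Hw; specialize (H w Hw).
  pose proof (Cmod_ge_sub (f w) a); pose proof (Cmod_ge_sub a (f w)) as H1.
  rewrite Cmod_sub_comm in H1; lra.
Qed.

Lemma Clim_at_Rcpow (x : R) (k z : C) : 0 < x ->
  Clim_at (fun w => Rcpow x (k * w)) z (Rcpow x (k * z)).
Proof.
  intros Hx eps He.
  set (r := Cmod k + 1); assert (Hr : 0 < r) by (unfold r; pose proof (Cmod_ge_0 k); lra).
  set (K := Rpower x (Re (k * z)) * exp (2 * r * Rabs (ln x))).
  assert (HK : 0 < K) by (apply Rmult_lt_0_compat; [apply Rpower_pos|apply exp_pos]).
  exists (Rmin 1 (eps / K)); split; [apply Rmin_glb_lt; [lra|apply Rdiv_lt_0_compat; auto]|].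
  intros w Hw.
  assert (H1 := Rlt_le_trans _ _ _ Hw (Rmin_l _ _)); assert (H2 := Rlt_le_trans _ _ _ Hw (Rmin_r _ _)).
  pose proof (Cmod_ge_0 (w - z)); pose proof (Cmod_ge_0 k).
  assert (E : Cmod (k * w - k * z) <= r * Cmod (w - z)).
  { replace (k * w - k * z)%C with (k * (w - z))%C by ring; rewrite Cmod_mult; unfold r; nra. }
  eapply Rle_lt_trans; [apply (Rcpow_diff_bound x r); auto; nra|]; fold K.
  apply Rlt_div_r in H2; auto.
  eapply Rle_lt_trans; [|exact H2]; apply Rmult_le_compat_r; [lra|].
  apply Rle_div_l; auto; lra.
Qed.

Lemma Cmod_half_diff (w s : C) : Cmod (w / 2 - s / 2) = Cmod (w - s) / 2.
Proof.
  replace (w / 2 - s / 2)%C with ((w - s) / 2)%C by field.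
  rewrite Cmod_div, Cmod_R, Rabs_right by (try apply RtoC_neq_0; lra); auto.
Qed.

Lemma gamma_factor_cont (s : C) : 0 < Re s -> Clim_at gamma_factor s (gamma_factor s).
Proof.
  intros Hs; pose proof PI_RGT_0 as HPI.
  apply (Clim_at_mult (fun w => Rcpow PI (- (w / 2))) (fun w => CGamma (w / 2))).
  - replace (- (s / 2))%C with ((- / 2) * s)%C by field.
    intros eps He; destruct (Clim_at_Rcpow PI (- / 2) s HPI eps He) as (d & Hd & H).
    exists d; split; auto; intros w Hw.
    replace (- (w / 2))%C with ((- / 2) * w)%C by field; auto.
  - intros eps He; destruct (CGamma_cont (s / 2) ltac:(rewrite Re_half; lra) eps He) as (d & Hd & H).
    exists d; split; auto; intros w Hw; apply H; rewrite Cmod_half_diff.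
    pose proof (Cmod_ge_0 (w - s)); lra.
Qed.

Lemma gamma_factor_neq_0 (s : C) : 0 < Re s -> gamma_factor s <> 0%C.
Proof.
  intros Hs; apply Cmult_neq_0; [apply Rcpow_neq_0|apply CGamma_neq_0; rewrite Re_half; lra].
Qed.

Lemma Cconj_half (s : C) : Cconj (s / 2) = (Cconj s / 2)%C.
Proof. destruct s as [a b]; apply Ceq; unfold Cdiv, Cinv; simpl; field. Qed.

Lemma gamma_factor_conj (s : C) : 0 < Re s -> gamma_factor (Cconj s) = Cconj (gamma_factor s).
Proof.
  intros Hs; unfold gamma_factor; rewrite Cmult_conj, <- Rcpow_conj, <- Cconj_half.
  rewrite CGamma_conj by (rewrite Re_half; lra); f_equal; f_equal.
Qed.

Lemma Cconj_neq_1 (s : C) : s <> 1%C -> Cconj s <> 1%C.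
Proof.
  intros H E; apply H; destruct s; injection E; intros E1 E2; apply Ceq; simpl in *; lra.
Qed.

Lemma zeta_psum_conj (s : C) (n : nat) : zeta_psum (Cconj s) n = Cconj (zeta_psum s n).
Proof.
  assert (E : forall x, Rcpow x (- Cconj s) = Cconj (Rcpow x (- s))).
  { intros x; rewrite <- Rcpow_conj; f_equal; apply Ceq; simpl; ring. }
  induction n as [|n IH].
  - unfold zeta_psum; rewrite !sum_O; apply E.
  - rewrite !zeta_psum_S, IH, Cplus_conj, E; auto.
Qed.

Lemma zeta_conj (s : C) : 0 < Re s -> s <> 1%C -> zeta (Cconj s) = Cconj (zeta s).
Proof.
  intros Hs Hs1.
  apply (eventually_C_lim_unique
    (fun n => zeta_psum (Cconj s) n - Rcpow (INR (S n)) (1 - Cconj s) / (1 - Cconj s))%C).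
  - apply zeta_psum_lim_zeta; auto; apply Cconj_neq_1; auto.
  - apply (filterlim_C_iff eventually); intros eps He.
    pose proof (zeta_psum_lim_zeta s Hs Hs1) as HZ; rewrite (filterlim_C_iff eventually) in HZ.
    generalize (HZ eps He); apply filter_imp; intros n Hn.
    assert (H1 : (1 - s)%C <> 0%C) by (apply Cminus_neq_0; auto).
    replace (1 - Cconj s)%C with (Cconj (1 - s)) by (apply Ceq; simpl; ring).
    rewrite Rcpow_conj, zeta_psum_conj.
    replace (Cconj (Rcpow (INR (S n)) (1 - s)) / Cconj (1 - s))%C
      with (Cconj (Rcpow (INR (S n)) (1 - s) / (1 - s))) by (rewrite Cdiv_conj; auto).
    rewrite <- !Cminus_conj, Cmod_conj; auto.
Qed.

Lemma strip_neq_1 (s : C) : 0 < Re s < 1 -> s <> 1%C.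
Proof. intros Hs ->; simpl in Hs; lra. Qed.

(** Reflection in the line [Re s = 1/2]. It keeps the height, which [s -> 1 - s] alone would
    negate. *)
Definition reflect (s : C) : C := (1 - Cconj s)%C.

Lemma Re_reflect (s : C) : Re (reflect s) = 1 - Re s.
Proof. unfold Re; simpl; ring. Qed.

Lemma Im_reflect (s : C) : Im (reflect s) = Im s.
Proof. unfold Im; simpl; ring. Qed.

Lemma reflect_involutive (s : C) : reflect (reflect s) = s.
Proof. apply Ceq; simpl; ring. Qed.

Lemma Cmod_zeta_reflect (s : C) : 0 < Re s < 1 ->
  Cmod (gamma_factor (1 - s)) * Cmod (zeta (reflect s)) = Cmod (gamma_factor s) * Cmod (zeta s).
Proof.
  intros Hs.
  assert (Hs' : 0 < Re (1 - s) < 1) by (destruct s; unfold Re in *; simpl in *; lra).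
  replace (reflect s) with (Cconj (1 - s)) by (apply Ceq; simpl; ring).
  rewrite zeta_conj, Cmod_conj by (try apply strip_neq_1; auto; lra).
  rewrite <- !Cmod_mult; f_equal; apply zeta_functional_equation; auto.
Qed.

Lemma zeta_reflect_zero (s : C) : 0 < Re s < 1 -> zeta s = 0%C -> zeta (reflect s) = 0%C.
Proof.
  intros Hs Hz; apply Cmod_eq_0.
  pose proof (Cmod_zeta_reflect s Hs) as H; rewrite Hz, Cmod_0, Rmult_0_r in H.
  apply Rmult_integral in H; destruct H as [H|H]; auto.
  apply Cmod_eq_0 in H; exfalso; revert H; apply gamma_factor_neq_0.
  destruct s; unfold Re in *; simpl in *; lra.
Qed.

(** The two gamma factors are continuous and nonzero, so the moduli of [zeta] at [w] and at
    [reflect w] are comparable near [s]. *)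
Lemma zeta_reflect_order (s : C) (m n : nat) : 0 < Re s < 1 ->
  zero_of_order zeta s m -> zero_of_order zeta (reflect s) n -> m = n.
Proof.
  intros Hs.
  assert (Hs' : 0 < Re (1 - s) < 1) by (destruct s; unfold Re in *; simpl in *; lra).
  destruct (Clim_at_bounds _ _ _ (gamma_factor_cont s ltac:(lra)) (gamma_factor_neq_0 s ltac:(lra))) as (d1 & Hd1 & H1).
  destruct (Clim_at_bounds _ _ _ (gamma_factor_cont (1 - s) ltac:(lra)) (gamma_factor_neq_0 (1 - s) ltac:(lra))) as (d2 & Hd2 & H2).
  set (A := Cmod (gamma_factor s)) in *; set (B := Cmod (gamma_factor (1 - s))) in *.
  assert (HA : 0 < A) by (apply Cmod_gt_0, gamma_factor_neq_0; lra).
  assert (HB : 0 < B) by (apply Cmod_gt_0, gamma_factor_neq_0; lra).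
  (* The last two radii keep [w] inside the strip. Each gamma factor is known up to a factor [2],
     whence the constants [A / (4 B)] and [4 A / B]. *)
  set (d := Rmin (Rmin d1 d2) (Rmin (Re s) (1 - Re s))).
  assert (Hd : 0 < d) by (repeat apply Rmin_glb_lt; lra).
  apply (zero_of_order_transfer zeta zeta s (reflect s) reflect m n (A / (4 * B)) d (4 * A / B)); auto.
  - apply Rdiv_lt_0_compat; lra.
  - intros w; unfold reflect.
    replace (1 - Cconj w - (1 - Cconj s))%C with (- (Cconj w - Cconj s))%C by ring.
    rewrite Cmod_opp, <- Cminus_conj, Cmod_conj; auto.
  - intros w Hw.
    assert (Hw1 : Cmod (w - s) < d1).
    { eapply Rlt_le_trans; [exact Hw|]; eapply Rle_trans; [apply Rmin_l|apply Rmin_l]. }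
    assert (Hw2 : Cmod (w - s) < d2).
    { eapply Rlt_le_trans; [exact Hw|]; eapply Rle_trans; [apply Rmin_l|apply Rmin_r]. }
    assert (Hw3 : Cmod (w - s) < Re s).
    { eapply Rlt_le_trans; [exact Hw|]; eapply Rle_trans; [apply Rmin_r|apply Rmin_l]. }
    assert (Hw4 : Cmod (w - s) < 1 - Re s).
    { eapply Rlt_le_trans; [exact Hw|]; eapply Rle_trans; [apply Rmin_r|apply Rmin_r]. }
    assert (Hwr : 0 < Re w < 1).
    { pose proof (re_le_Cmod (w - s)) as H; apply Rabs_le_between in H.
      destruct w, s; unfold Re in *; simpl in *; lra. }
    pose proof (Cmod_zeta_reflect w Hwr) as E.
    specialize (H1 w Hw1); specialize (H2 (1 - w)%C).
    replace (1 - w - (1 - s))%C with (- (w - s))%C in H2 by ring; rewrite Cmod_opp in H2; specialize (H2 Hw2).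
    pose proof (Cmod_ge_0 (zeta w)); pose proof (Cmod_ge_0 (zeta (reflect w))).
    set (a := Cmod (gamma_factor w)) in *; set (b := Cmod (gamma_factor (1 - w))) in *.
    set (x := Cmod (zeta w)) in *; set (y := Cmod (zeta (reflect w))) in *.
    split.
    + replace (A / (4 * B) * x) with ((A / 2 * x) / (2 * B)) by (field; lra).
      apply Rle_div_l; [lra|]; nra.
    + replace (4 * A / B * x) with ((2 * A * x) / (B / 2)) by (field; lra).
      apply Rle_div_r; [lra|]; nra.
Qed.

(** Local vanishing would spread along a segment to a point near the pole, where [zeta] is nonzero.
    With [0 <= Im s] the segment to [u], which lies above the real axis, avoids [1]. *)
Lemma zeta_order_exists (s : C) : 0 <= Im s -> s <> 1%C -> exists m, zero_of_order zeta s m.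
Proof.
  intros Him Hs.
  destruct (analytic_dichotomy zeta s (zeta_analytic s Hs)) as [H0|H0]; auto.
  exfalso; destruct zeta_neq_0_near_1 as (d & Hd & Hz).
  set (u := ((1, d / 2) : C)).
  assert (Hu : u <> 1%C) by (intros E; injection E; intros; lra).
  assert (Hloc : locally_zero zeta u).
  { apply (locally_zero_segment zeta s u); auto.
    intros tau Ht; apply zeta_analytic; intros E.
    pose proof (f_equal snd E) as E2; simpl in E2; unfold Im in Him.
    assert (tau = 0) by nra.
    subst tau; apply Hs; rewrite <- E; ring. }
  destruct Hloc as (r & Hr & Hr0).
  apply (Hz u Hu).
  - replace (u - 1)%C with (Ci * RtoC (d / 2))%C by (apply Ceq; simpl; ring).
    rewrite Cmod_mult, Cmod_Ci, Cmod_R, Rabs_right; lra.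
  - apply Hr0; replace (u - u)%C with (RtoC 0) by ring; rewrite Cmod_0; auto.
Qed.

Lemma zero_of_order_value (f : C -> C) (z : C) (m : nat) : zero_of_order f z m -> m <> O -> f z = 0%C.
Proof.
  intros (g & _ & _ & r & Hr & H) Hm.
  rewrite H by (replace (z - z)%C with (RtoC 0) by ring; rewrite Cmod_0; auto).
  destruct m as [|m]; [congruence|]; simpl; ring.
Qed.

Lemma zeta_zeros_isolated (z : C) : 0 <= Im z ->
  exists d, 0 < d /\ forall w : C, w <> 1%C -> w <> z -> Cmod (w - z) < d -> zeta w <> 0%C.
Proof.
  intros Hz; destruct (classic (z = 1%C)) as [->|Hz1].
  - destruct zeta_neq_0_near_1 as (d & Hd & H); exists d; split; auto.
  - destruct (zeta_order_exists z Hz Hz1) as [m Hm].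
    destruct (zero_of_order_isolated _ _ _ Hm) as (d & Hd & H); exists d; split; auto.
Qed.

(** * Finiteness of the zeros up to a given height *)

Lemma zeta_zeros_finite (T : R) : exists l : list C, forall rho,
  nontrivial_zero rho /\ 0 < Im rho <= T -> In rho l.
Proof.
  set (toC := fun x : Compactness.Tn 2 R => ((fst x, fst (snd x)) : C)).
  (* Around [x] only [x] itself, or the pole, may fail to have [zeta] nonzero. The cells of the
     covering are squares of half-side [delta x], contained in the disc of radius [2 * delta x];
     hence every zero is the centre of its cell. *)
  assert (Hd : forall x, exists d : posreal, 0 <= Im (toC x) ->
    forall w : C, w <> 1%C -> w <> toC x -> Cmod (w - toC x) < 2 * d -> zeta w <> 0%C).
  { intros x; destruct (classic (0 <= Im (toC x))) as [H|H].
    - destruct (zeta_zeros_isolated (toC x) H) as (d & Hd & Hw).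
      assert (Hd2 : 0 < d / 2) by lra.
      exists (mkposreal _ Hd2); intros _ w H1 H2 H3; apply Hw; auto; simpl in H3; lra.
    - exists (mkposreal 1 Rlt_0_1); tauto. }
  set (delta := fun x => proj1_sig (constructive_indefinite_description _ (Hd x))).
  assert (Hdelta : forall x, 0 <= Im (toC x) ->
    forall w : C, w <> 1%C -> w <> toC x -> Cmod (w - toC x) < 2 * delta x -> zeta w <> 0%C).
  { intros x; unfold delta; destruct (constructive_indefinite_description _ (Hd x)); auto. }
  (* The covering of [[0, 1] x [0, T]] is provided under a double negation. *)
  destruct (NNPP _ (compactness_list 2 (0, (0, tt)) (1, (T, tt)) delta)) as [l Hl].
  exists (map toC l); intros rho [[Hre Hz] Him].
  destruct (Hl (Re rho, (Im rho, tt))) as (x & Hx & Hb & Hc).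
  { simpl; split; [lra|split; [lra|auto]]. }
  apply in_map_iff; exists x; split; auto.
  destruct x as [x1 [x2 []]]; simpl in Hb, Hc.
  destruct Hc as [Hc1 [Hc2 _]].
  apply NNPP; intros Hne; apply (Hdelta (x1, (x2, tt)) ltac:(simpl; lra) rho); auto.
  - apply strip_neq_1; auto.
  - eapply Rle_lt_trans; [apply Cmod_le_abs|].
    replace (Re (rho - toC (x1, (x2, tt)))) with (Re rho - x1) by reflexivity.
    replace (Im (rho - toC (x1, (x2, tt)))) with (Im rho - x2) by reflexivity.
    lra.
Qed.

Lemma is_zero_count_exists (T : R) : exists n, is_zero_count T n.
Proof.
  destruct (zeta_zeros_finite T) as [l Hl].
  set (P := fun rho => nontrivial_zero rho /\ 0 < Im rho <= T).
  set (l' := nodup (fun a b : C => excluded_middle_informative (a = b))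
    (filter (fun rho => if excluded_middle_informative (P rho) then true else false) l)).
  assert (Hin : forall rho, In rho l' <-> P rho).
  { intros rho; unfold l'; rewrite nodup_In, filter_In.
    destruct (excluded_middle_informative (P rho)) as [H|H]; split; try tauto.
    - intros _; split; auto.
    - intros [_ E]; discriminate. }
  assert (Hm : forall rho, exists m, P rho -> zero_of_order zeta rho m).
  { intros rho; destruct (classic (P rho)) as [H|H]; [|exists O; tauto].
    destruct H as [[Hre Hz] Him].
    destruct (zeta_order_exists rho ltac:(lra) (strip_neq_1 rho Hre)) as [m Hm].
    exists m; auto. }
  set (m := fun rho => proj1_sig (constructive_indefinite_description _ (Hm rho))).
  exists (list_sum (map m l')), l', m; split; [apply NoDup_nodup|split; [exact Hin|split; auto]].
  intros rho H; unfold m; destruct (constructive_indefinite_description _ (Hm rho)) as [k Hk]; simpl.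
  apply Hk, Hin; auto.
Qed.

Lemma zeroN_is_zero_count (T : R) : is_zero_count T (zeroN T).
Proof. unfold zeroN; apply epsilon_spec, is_zero_count_exists. Qed.

(** * Sign changes on the critical line *)

(** Continuity of the cofactor at the single point [c] suffices for signs, and it is what the
    continuity of [gamma_factor] provides. *)
Definition real_order (h : R -> R) (c : R) (m : nat) : Prop :=
  exists (k : R -> R) (d : R), continuous k c /\ k c <> 0 /\ 0 < d /\
    forall u, Rabs (u - c) < d -> h u = (u - c) ^ m * k u.

Lemma locally_Rabs (c d : R) : 0 < d -> locally c (fun u => Rabs (u - c) < d).
Proof. intros Hd; exists (mkposreal d Hd); intros u Hu; exact Hu. Qed.

Lemma locally_neq (c c' : R) : c <> c' -> locally c (fun u => u <> c').
Proof.
  intros H; assert (Hp : 0 < Rabs (c - c')) by (apply Rabs_pos_lt; lra).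
  generalize (locally_Rabs c _ Hp); apply filter_imp; intros u Hu E; subst u.
  rewrite Rabs_minus_sym in Hu; lra.
Qed.

Lemma real_order_intro (h k : R -> R) (c : R) (m : nat) : continuous k c -> k c <> 0 ->
  locally c (fun u => h u = (u - c) ^ m * k u) -> real_order h c m.
Proof. intros Hc Hk [d Hd]; exists k, d; split; [auto|split; [auto|split; [apply cond_pos|]]]; intros u Hu; apply Hd; exact Hu. Qed.

Lemma real_order_elim (h : R -> R) (c : R) (m : nat) : real_order h c m ->
  exists k : R -> R, continuous k c /\ k c <> 0 /\ locally c (fun u => h u = (u - c) ^ m * k u).
Proof.
  intros (k & d & Hc & Hk & Hd & H); exists k; split; [auto|split; [auto|]].
  generalize (locally_Rabs c d Hd); apply filter_imp; auto.
Qed.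

Lemma real_order_0 (h : R -> R) (c : R) : real_order h c 0 -> continuity_pt h c /\ h c <> 0.
Proof.
  intros H; destruct (real_order_elim h c 0 H) as (k & Hc & Hk & He).
  assert (Ec : h c = k c) by (rewrite (locally_singleton _ _ He); simpl; ring).
  split; [|rewrite Ec; auto].
  apply continuity_pt_filterlim; rewrite Ec.
  apply (filterlim_ext_loc k); auto.
  revert He; apply filter_imp; intros u Hu; rewrite Hu; simpl; symmetry; apply Rmult_1_l.
Qed.

Lemma nonvanishing_same_sign (h : R -> R) (a b : R) : a < b ->
  (forall c, a <= c <= b -> continuity_pt h c /\ h c <> 0) -> 0 < h a * h b.
Proof.
  intros Hab H.
  assert (Ha := proj2 (H a ltac:(lra))); assert (Hb := proj2 (H b ltac:(lra))).
  destruct (Rtotal_order (h a) 0) as [Ha'|[Ha'|Ha']]; [|lra|];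
    destruct (Rtotal_order (h b) 0) as [Hb'|[Hb'|Hb']]; try lra; try nra; exfalso.
  - destruct (Ranalysis5.IVT_interv h a b) as (z & Hz & E); auto; [intros; apply H; auto|].
    apply (proj2 (H z Hz)); auto.
  - destruct (Ranalysis5.IVT_interv (fun x => - h x) a b) as (z & Hz & E); auto; try lra.
    + intros x Hx; apply continuity_pt_opp, H; auto.
    + apply (proj2 (H z Hz)); lra.
Qed.

(* Dividing out the factor [(u - c)^m] at each zero [c] leaves a nonvanishing function. *)
Lemma sign_change_count (L : list R) (a b : R) : a < b -> NoDup L ->
  (forall c, In c L -> a < c < b) ->
  forall (h : R -> R) (mu : R -> nat),
  (forall c, a <= c <= b -> real_order h c (mu c)) ->
  (forall c, a <= c <= b -> mu c <> O -> In c L) ->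
  0 < h a * h b * (-1) ^ (list_sum (map mu L)).
Proof.
  intros Hab; induction L as [|c0 L IH]; intros HN HL h mu Hord Hmu.
  - simpl; rewrite Rmult_1_r; apply nonvanishing_same_sign; auto.
    intros c Hc; apply real_order_0.
    replace O with (mu c); auto; destruct (mu c) eqn:E; auto; exfalso; apply (Hmu c); auto; lia.
  - inversion HN as [|x l Hn HN' E]; subst.
    assert (Hc0 : a < c0 < b) by (apply HL; left; auto).
    destruct (real_order_elim _ _ _ (Hord c0 ltac:(lra))) as (k0 & Hk0 & Hk0' & He0).
    set (m0 := mu c0) in *.
    (* The quotient, completed at [c0], has order [0] there and unchanged orders elsewhere, so the
       remaining list accounts for all its zeros. *)
    set (h1 := fun u => if Req_dec_T u c0 then k0 c0 else h u / (u - c0) ^ m0).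
    set (mu1 := fun c => if Req_dec_T c c0 then O else mu c).
    assert (Hpow : forall u, u <> c0 -> (u - c0) ^ m0 <> 0) by (intros u Hu; apply pow_nonzero; lra).
    assert (H1 : 0 < h1 a * h1 b * (-1) ^ (list_sum (map mu1 L))).
    { apply IH; auto.
      - intros c Hc; apply HL; right; auto.
      - intros c Hc; unfold mu1; destruct (Req_dec_T c c0) as [->|Hne].
        + apply (real_order_intro h1 k0); auto.
          revert He0; apply filter_imp; intros u Hu; unfold h1.
          destruct (Req_dec_T u c0) as [->|Hu0]; [simpl; ring|].
          rewrite Hu; simpl; field; auto.
        + destruct (real_order_elim _ _ _ (Hord c Hc)) as (k & Hk & Hk' & He).
          apply (real_order_intro h1 (fun u => k u / (u - c0) ^ m0)).
          * apply (continuous_mult (K := R_AbsRing)); auto.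
            continuous_by_derive; apply Hpow; auto.
          * apply Rmult_integral_contrapositive; split; auto; apply Rinv_neq_0_compat; auto.
          * generalize (filter_and _ _ He (locally_neq c c0 Hne)); apply filter_imp; intros u [Hu Hu0].
            unfold h1; destruct (Req_dec_T u c0) as [E|_]; [congruence|].
            rewrite Hu; field; auto.
      - intros c Hc; unfold mu1; destruct (Req_dec_T c c0) as [->|Hne]; [congruence|].
        intros Hm; destruct (Hmu c Hc Hm) as [E|Hin]; [congruence|auto]. }
    assert (Emu : map mu1 L = map mu L).
    { apply map_ext_in; intros c Hc; unfold mu1; destruct (Req_dec_T c c0) as [->|]; auto; contradiction. }
    rewrite Emu in H1; unfold h1 in H1.
    destruct (Req_dec_T a c0) as [E|_]; [lra|]; destruct (Req_dec_T b c0) as [E|_]; [lra|].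
    simpl list_sum; fold m0; rewrite pow_add.
    set (S := (-1) ^ list_sum (map mu L)) in *.
    assert (P1 : 0 < (c0 - a) ^ m0) by (apply pow_lt; lra).
    assert (P2 : 0 < (b - c0) ^ m0) by (apply pow_lt; lra).
    (* The sign [(-1)^m0] enters at the left end, where [u - c0] is negative; at the right end the
       divided power is positive. *)
    assert (E1 : (a - c0) ^ m0 = (-1) ^ m0 * (c0 - a) ^ m0) by (rewrite <- Rpow_mult_distr; f_equal; ring).
    assert (E2 : (-1) ^ m0 * (-1) ^ m0 = 1) by (rewrite <- Rpow_mult_distr; replace (-1 * -1) with 1 by ring; apply pow1).
    assert (E3 : (-1) ^ m0 <> 0) by (apply pow_nonzero; lra).
    rewrite E1 in H1.
    replace (h a * h b * ((-1) ^ m0 * S)) with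
      (h a / ((-1) ^ m0 * (c0 - a) ^ m0) * (h b / (b - c0) ^ m0) * S
        * (((-1) ^ m0 * (-1) ^ m0) * ((c0 - a) ^ m0 * (b - c0) ^ m0))) by (field; lra).
    rewrite E2, Rmult_1_l; apply Rmult_lt_0_compat; [exact H1|apply Rmult_lt_0_compat; auto].
Qed.

(** * The real function [xi_crit] and its relation to [hardyZ] *)

Definition crit (u : R) : C := (1 / 2, u).

Lemma Re_crit (u : R) : Re (crit u) = 1 / 2.
Proof. reflexivity. Qed.

Lemma crit_strip (u : R) : 0 < Re (crit u) < 1.
Proof. rewrite Re_crit; lra. Qed.

Definition xi_crit (u : R) : C := (gamma_factor (crit u) * zeta (crit u))%C.

(** On the critical line [1 - s] is the conjugate of [s], so the functional equation equates
    [xi_crit u] with its own conjugate. *)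
Lemma xi_crit_real (u : R) : xi_crit u = RtoC (Re (xi_crit u)).
Proof.
  assert (H : Cconj (xi_crit u) = xi_crit u).
  { unfold xi_crit; rewrite Cmult_conj.
    rewrite <- gamma_factor_conj, <- zeta_conj by (try apply strip_neq_1; rewrite ?Re_crit; lra).
    replace (Cconj (crit u)) with (1 - crit u)%C by (apply Ceq; simpl; field).
    apply zeta_functional_equation, crit_strip. }
  apply (f_equal snd) in H; simpl in H; apply Ceq; [reflexivity|].
  unfold xi_crit; simpl; simpl in H; lra.
Qed.

(** The two differ by the modulus [PI^(-1/4)] of [PI^(-s/2)], which cancels in the normalisation. *)
Lemma exp_i_theta_gamma_factor (u : R) :
  exp_i_theta u = (gamma_factor (crit u) / RtoC (Cmod (gamma_factor (crit u))))%C.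
Proof.
  unfold exp_i_theta, gamma_factor.
  set (z := (((1 / 4)%R, (u / 2)%R) : C)).
  assert (Ez : (crit u / 2)%C = z) by (unfold crit, z, Cdiv, Cinv; apply Ceq; simpl; field).
  rewrite Ez.
  assert (Hz : 0 < Re z) by (unfold z, Re; simpl; lra).
  pose proof (CGamma_neq_0 z Hz) as HG.
  assert (HGm : 0 < Cmod (CGamma z)) by (apply Cmod_gt_0; auto).
  rewrite Cmod_mult, Cmod_Rcpow.
  replace (Re (- z)) with (- (1 / 4)) by (unfold z, Re; simpl; ring).
  replace (- z)%C with (RtoC (- (1 / 4)) + - (Ci * RtoC u / 2))%C.
  2:{ unfold z, Cdiv, Cinv; apply Ceq; simpl; field. }
  rewrite Rcpow_plus, Rcpow_RtoC, RtoC_mult.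
  pose proof (Rpower_pos PI (- (1 / 4))).
  field; split; apply RtoC_neq_0; lra.
Qed.

Lemma hardyZ_xi (u : R) :
  hardyZ u = RtoC (Re (xi_crit u) / Cmod (gamma_factor (crit u))).
Proof.
  assert (Hg : 0 < Cmod (gamma_factor (crit u))) by (apply Cmod_gt_0, gamma_factor_neq_0; rewrite Re_crit; lra).
  rewrite RtoC_div, <- xi_crit_real by lra.
  unfold hardyZ; rewrite exp_i_theta_gamma_factor; unfold xi_crit; fold (crit u).
  field; apply RtoC_neq_0; lra.
Qed.

Lemma Cmod_xi_crit (u : R) :
  Rabs (Re (xi_crit u)) = Cmod (gamma_factor (crit u)) * Cmod (zeta (crit u)).
Proof. rewrite <- Cmod_R, <- xi_crit_real; apply Cmod_mult. Qed.

Lemma crit_diff (u v : R) : (crit u - crit v)%C = (Ci * RtoC (u - v))%C.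
Proof. apply Ceq; simpl; ring. Qed.

Lemma Cmod_crit_diff (u v : R) : Cmod (crit u - crit v) = Rabs (u - v).
Proof. rewrite crit_diff, Cmod_mult, Cmod_Ci, Cmod_R; ring. Qed.

Lemma Im_RtoC_mult (a : R) (z : C) : Im (RtoC a * z) = a * Im z.
Proof. unfold Im; simpl; ring. Qed.

Lemma Re_RtoC_mult (a : R) (z : C) : Re (RtoC a * z) = a * Re z.
Proof. unfold Re; simpl; ring. Qed.

(** Since [crit u - crit c = i (u - c)], the factor [i^m] joins the cofactor [K]. Both [xi_crit] and
    [(u - c)^m] are real, so [K] is real for [u <> c], and at [c] by continuity; hence its real part
    at [c] is nonzero. *)
Lemma xi_crit_order (c : R) (m : nat) : zero_of_order zeta (crit c) m ->
  real_order (fun u => Re (xi_crit u)) c m.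
Proof.
  intros (g & Hg & Hgc & r & Hr & H).
  set (K := fun w => (Ci ^ m * (g w * gamma_factor w))%C).
  assert (HK : Clim_at K (crit c) (K (crit c))).
  { apply (Clim_at_mult (fun _ => Ci ^ m)%C (fun w => g w * gamma_factor w)%C).
    - intros eps He; exists 1; split; [lra|]; intros w _.
      replace (Ci ^ m - Ci ^ m)%C with (RtoC 0) by ring; rewrite Cmod_0; auto.
    - apply Clim_at_mult; [apply analytic_at_cont; auto|apply gamma_factor_cont; rewrite Re_crit; lra]. }
  assert (HK0 : K (crit c) <> 0%C).
  { unfold K; apply Cmult_neq_0; [apply Cpow_nz|apply Cmult_neq_0; auto; apply gamma_factor_neq_0; rewrite Re_crit; lra].
    intros E; apply (f_equal snd) in E; simpl in E; lra. }
  assert (Hxi : forall u, Rabs (u - c) < r -> xi_crit u = (RtoC ((u - c) ^ m) * K (crit u))%C).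
  { intros u Hu; unfold xi_crit; rewrite H by (rewrite Cmod_crit_diff; auto).
    rewrite crit_diff, Cpow_mult_l, RtoC_pow; unfold K; ring. }
  assert (HIm : forall u, Rabs (u - c) < r -> u <> c -> Im (K (crit u)) = 0).
  { intros u Hu Hne.
    assert (E : (u - c) ^ m * Im (K (crit u)) = 0).
    { rewrite <- Im_RtoC_mult, <- (Hxi u Hu), xi_crit_real; reflexivity. }
    apply Rmult_integral in E; destruct E as [E|E]; auto.
    exfalso; revert E; apply pow_nonzero; lra. }
  assert (HIm0 : Im (K (crit c)) = 0).
  { apply NNPP; intros Hne.
    destruct (HK (Rabs (Im (K (crit c)))) (Rabs_pos_lt _ Hne)) as (d & Hd & Hc).
    set (e := Rmin d r / 2).
    assert (He : 0 < e) by (assert (0 < Rmin d r) by (apply Rmin_glb_lt; auto); unfold e; lra).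
    assert (Hed : e < d) by (pose proof (Rmin_l d r); unfold e in *; lra).
    assert (Her : e < r) by (pose proof (Rmin_r d r); unfold e in *; lra).
    assert (Ee : Rabs (c + e - c) = e) by (rewrite Rabs_right; lra).
    specialize (Hc (crit (c + e)) ltac:(rewrite Cmod_crit_diff, Ee; auto)).
    specialize (HIm (c + e) ltac:(rewrite Ee; auto) ltac:(lra)).
    pose proof (Cmod_Im_le (K (crit (c + e)) - K (crit c))) as Hi.
    replace (Im (K (crit (c + e)) - K (crit c))) with (Im (K (crit (c + e))) - Im (K (crit c))) in Hi by reflexivity.
    rewrite HIm in Hi; unfold Rminus in Hi; rewrite Rplus_0_l, Rabs_Ropp in Hi; lra. }
  exists (fun u => Re (K (crit u))), r; split; [|split; [|split; [auto|]]].
  - apply (proj2 (filterlim_R_iff (locally c) _ _)); intros eps He.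
    destruct (HK eps He) as (d & Hd & Hc).
    generalize (locally_Rabs c d Hd); apply filter_imp; intros u Hu.
    eapply Rle_lt_trans; [apply (re_le_Cmod (K (crit u) - K (crit c)))|].
    apply Hc; rewrite Cmod_crit_diff; auto.
  - intros E; apply HK0, Ceq; auto.
  - intros u Hu; rewrite (Hxi u Hu); apply Re_RtoC_mult.
Qed.

(** The approximants decrease because [1 / sqrt (n + 1) <= 2 (sqrt (n + 1) - sqrt n)], and the first
    one is [1 - 2 = -1]. *)
Lemma zeta_half_neg : Re (zeta (crit 0)) <= -1.
Proof.
  assert (Hs1 : crit 0 <> 1%C) by (apply strip_neq_1, crit_strip).
  pose proof (zeta_psum_lim_zeta (crit 0) ltac:(rewrite Re_crit; lra) Hs1) as HZ.
  replace (crit 0) with (RtoC (1 / 2)) in * by reflexivity.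
  assert (Hterm : forall n, Rcpow (INR (S n)) (- RtoC (1 / 2)) = RtoC (/ sqrt (INR (S n)))).
  { intros n; rewrite <- RtoC_opp, Rcpow_RtoC, Rpower_Ropp; f_equal; f_equal.
    replace (1 / 2) with (/ 2) by field; apply Rpower_sqrt, INR_S_pos. }
  assert (Hpow : forall n, (Rcpow (INR (S n)) (1 - RtoC (1 / 2)) / (1 - RtoC (1 / 2)))%C = RtoC (2 * sqrt (INR (S n)))).
  { intros n; rewrite <- !RtoC_minus, Rcpow_RtoC, <- RtoC_div by lra; f_equal.
    replace (1 - 1 / 2) with (/ 2) by field; rewrite Rpower_sqrt by apply INR_S_pos; field. }
  assert (Hle : forall n, Re (zeta_psum (RtoC (1 / 2)) n - RtoC (2 * sqrt (INR (S n)))) <= -1).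
  { intros n; induction n as [|n IH].
    - unfold zeta_psum; rewrite sum_O, Hterm; replace (INR 1) with 1 by reflexivity.
      rewrite sqrt_1, Rinv_1; simpl; lra.
    - rewrite zeta_psum_S, Hterm.
      replace (Re (zeta_psum (RtoC (1 / 2)) n + RtoC (/ sqrt (INR (S (S n)))) - RtoC (2 * sqrt (INR (S (S n))))))
        with (Re (zeta_psum (RtoC (1 / 2)) n - RtoC (2 * sqrt (INR (S n))))
              + (/ sqrt (INR (S (S n))) - 2 * (sqrt (INR (S (S n))) - sqrt (INR (S n))))) by (unfold Re; simpl; ring).
      pose proof (sqrt_lt_R0 _ (INR_S_pos n)) as Ha; pose proof (sqrt_lt_R0 _ (INR_S_pos (S n))) as Hb.
      pose proof (sqrt_sqrt (INR (S n)) (pos_INR _)) as Ea; pose proof (sqrt_sqrt (INR (S (S n))) (pos_INR _)) as Eb.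
      rewrite (S_INR (S n)) in Eb at 3.
      set (x := sqrt (INR (S n))) in *; set (y := sqrt (INR (S (S n)))) in *.
      assert (/ y - 2 * (y - x) <= 0); [|lra].
      assert (Hxy : x <= y) by nra.
      apply Rmult_le_reg_l with y; auto.
      replace (y * (/ y - 2 * (y - x))) with (1 - 2 * y * (y - x)) by (field; lra); nra. }
  apply Rnot_lt_le; intros Hlt.
  rewrite (filterlim_C_iff eventually) in HZ.
  destruct (HZ (Re (zeta (RtoC (1 / 2))) + 1) ltac:(lra)) as [N HN].
  specialize (HN N (Nat.le_refl _)); rewrite Hpow in HN.
  specialize (Hle N).
  set (w := (zeta_psum (RtoC (1 / 2)) N - RtoC (2 * sqrt (INR (S N))))%C) in *.
  pose proof (re_le_Cmod (w - zeta (RtoC (1 / 2)))) as H.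
  replace (Re (w - zeta (RtoC (1 / 2)))) with (Re w - Re (zeta (RtoC (1 / 2)))) in H by reflexivity.
  apply Rabs_le_between in H; lra.
Qed.

Lemma gamma_factor_half_pos : exists g, 0 < g /\ gamma_factor (crit 0) = RtoC g.
Proof.
  unfold gamma_factor.
  replace (crit 0 / 2)%C with (RtoC (1 / 4)) by (unfold crit, Cdiv, Cinv; apply Ceq; simpl; field).
  rewrite (CGamma_real (1 / 4)), <- RtoC_opp, Rcpow_RtoC, <- RtoC_mult by lra.
  eexists; split; [|reflexivity].
  apply Rmult_lt_0_compat; [apply Rpower_pos|apply CGamma_real_pos; lra].
Qed.

Lemma xi_crit_0_neg : Re (xi_crit 0) < 0.
Proof.
  destruct gamma_factor_half_pos as (g & Hg & E); unfold xi_crit; rewrite E.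
  pose proof zeta_half_neg; unfold Re in *; simpl; nra.
Qed.

(** * Parity of the zero count, and the conclusion *)

Lemma list_sum_filter {A : Type} (f : A -> nat) (p : A -> bool) (l : list A) :
  list_sum (map f l) = (list_sum (map f (filter p l)) + list_sum (map f (filter (fun x => negb (p x)) l)))%nat.
Proof.
  induction l as [|x l IH]; [reflexivity|].
  simpl; destruct (p x); simpl; rewrite IH; lia.
Qed.

Lemma list_sum_perm (l l' : list nat) : Permutation l l' -> list_sum l = list_sum l'.
Proof. induction 1; simpl; lia. Qed.

Lemma pow_m1_even (n k : nat) : (-1) ^ (n + 2 * k) = (-1) ^ n.
Proof. rewrite pow_add, pow_1_even; ring. Qed.

Definition left_half (s : C) : bool := if Rlt_dec (Re s) (1 / 2) then true else false.
Definition right_half (s : C) : bool := if Rlt_dec (1 / 2) (Re s) then true else false.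

(* Zeros off the critical line come in pairs [rho], [1 - conj rho] of equal order and height. *)
Lemma zero_count_parity (l : list C) (m : C -> nat) (T : R) : NoDup l ->
  (forall rho, In rho l <-> nontrivial_zero rho /\ 0 < Im rho <= T) ->
  (forall rho, In rho l -> zero_of_order zeta rho (m rho)) ->
  (-1) ^ (list_sum (map m l)) =
    (-1) ^ (list_sum (map m (filter (fun s => negb (right_half s)) (filter (fun s => negb (left_half s)) l)))).
Proof.
  intros HN Hin Hm.
  rewrite (list_sum_filter m left_half), (list_sum_filter m right_half (filter (fun s => negb (left_half s)) l)).
  set (A := filter left_half l); set (B := filter (fun s => negb (left_half s)) l).
  assert (Hrefl : forall rho, In rho l -> In (reflect rho) l).
  { intros rho H; apply Hin in H; destruct H as [[H1 H2] H3]; apply Hin; split; [split|].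
    - rewrite Re_reflect; lra.
    - apply zeta_reflect_zero; auto.
    - rewrite Im_reflect; auto. }
  assert (HP : Permutation (filter right_half B) (map reflect A)).
  { apply NoDup_Permutation.
    - repeat apply NoDup_filter; auto.
    - apply FinFun.Injective_map_NoDup; [|apply NoDup_filter; auto].
      intros x y E; rewrite <- (reflect_involutive x), <- (reflect_involutive y), E; auto.
    - intros rho; unfold A, B; rewrite in_map_iff; split.
      + rewrite !filter_In; intros [[H1 _] H2]; exists (reflect rho); split; [apply reflect_involutive|].
        apply filter_In; split; auto.
        unfold left_half, right_half in *; rewrite Re_reflect.
        destruct (Rlt_dec (1 / 2) (Re rho)); [|discriminate].
        destruct (Rlt_dec (1 - Re rho) (1 / 2)); auto; lra.
      + intros (x & <- & Hx); apply filter_In in Hx; destruct Hx as [H1 H2].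
        rewrite !filter_In; unfold left_half, right_half in *; rewrite Re_reflect.
        destruct (Rlt_dec (Re x) (1 / 2)); [|discriminate].
        destruct (Rlt_dec (1 - Re x) (1 / 2)); [lra|].
        destruct (Rlt_dec (1 / 2) (1 - Re x)); [auto|lra]. }
  assert (E : list_sum (map m (filter right_half B)) = list_sum (map m A)).
  { rewrite (list_sum_perm _ _ (Permutation_map m HP)), map_map; f_equal.
    apply map_ext_in; intros rho H; unfold A in H; apply filter_In in H; destruct H as [H _].
    symmetry; apply (zeta_reflect_order rho); auto.
    apply Hin in H; apply H. }
  rewrite E.
  set (c := list_sum (map m (filter (fun s => negb (right_half s)) B))).
  replace (list_sum (map m A) + (list_sum (map m A) + c))%nat with (c + 2 * list_sum (map m A))%nat by lia.
  apply pow_m1_even.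
Qed.

Lemma on_line (s : C) : negb (left_half s) = true -> negb (right_half s) = true -> s = crit (Im s).
Proof.
  unfold left_half, right_half.
  destruct (Rlt_dec (Re s) (1 / 2)); [discriminate|]; destruct (Rlt_dec (1 / 2) (Re s)); [discriminate|].
  intros _ _; apply Ceq; [|reflexivity]; change (Re s = 1 / 2); lra.
Qed.

Lemma on_line_crit (u : R) : negb (left_half (crit u)) = true /\ negb (right_half (crit u)) = true.
Proof.
  unfold left_half, right_half; rewrite Re_crit.
  destruct (Rlt_dec (1 / 2) (1 / 2)); [lra|auto].
Qed.

Theorem theorem1 (t : R) (ht : (0 < t)%R)
  (hord : ~ exists rho : C, nontrivial_zero rho /\ Im rho = t) :
  hardyZ t = RtoC ((-1) ^ (zeroN t + 1) * Cmod (zeta ((1 / 2)%R, t)))%R.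
Proof.
  destruct (zeroN_is_zero_count t) as (l & m & HN & Hin & Hm & ->).
  set (l' := filter (fun s => negb (right_half s)) (filter (fun s => negb (left_half s)) l)).
  assert (Hl' : forall rho, In rho l' <-> In rho l /\ rho = crit (Im rho)).
  { intros rho; unfold l'; rewrite !filter_In; split.
    - intros [[H1 H2] H3]; split; auto; apply on_line; auto.
    - intros [H1 E]; rewrite E in *; pose proof (on_line_crit (Im rho)); tauto. }
  assert (Hmu : forall c, exists k, 0 <= c -> zero_of_order zeta (crit c) k).
  { intros c; destruct (Rle_dec 0 c) as [Hc|Hc]; [|exists O; tauto].
    destruct (zeta_order_exists (crit c) Hc (strip_neq_1 _ (crit_strip c))) as [k Hk]; exists k; auto. }
  (* The order of [zeta] at height [c] on the line, [0] where there is no zero. It is specified for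
     [c >= 0], the half-plane covered by [zeta_order_exists]. *)
  set (mu := fun c => proj1_sig (constructive_indefinite_description _ (Hmu c))).
  assert (Hmu' : forall c, 0 <= c -> zero_of_order zeta (crit c) (mu c)).
  { intros c; unfold mu; destruct (constructive_indefinite_description _ (Hmu c)); auto. }
  assert (Hsum : list_sum (map mu (map Im l')) = list_sum (map m l')).
  { rewrite map_map; f_equal; apply map_ext_in; intros rho H; apply Hl' in H; destruct H as [H E].
    apply (zero_of_order_unique zeta rho); auto.
    rewrite E at 1; apply Hmu'; apply Hin in H; lra. }
  assert (Hsign : 0 < Re (xi_crit 0) * Re (xi_crit t) * (-1) ^ (list_sum (map mu (map Im l')))).
  { apply (sign_change_count (map Im l') 0 t ht) with (h := fun u => Re (xi_crit u)).
    - apply NoDup_map_NoDup_ForallPairs; [|repeat apply NoDup_filter; auto].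
      intros x y Hx Hy E; apply Hl' in Hx; apply Hl' in Hy.
      rewrite (proj2 Hx), (proj2 Hy), E; auto.
    - intros c Hc; apply in_map_iff in Hc; destruct Hc as (rho & <- & H).
      apply Hl' in H; destruct H as [H _]; apply Hin in H; destruct H as [H1 H2].
      (* The count admits height [t]; the hypothesis on [t] makes the inequality strict, as sign
         counting on an open interval requires. *)
      split; [lra|]; destruct (Rle_lt_or_eq_dec _ _ (proj2 H2)) as [|E]; auto.
      exfalso; apply hord; exists rho; auto.
    - intros c Hc; apply xi_crit_order, Hmu'; lra.
    - intros c Hc H.
      pose proof (zero_of_order_value _ _ _ (Hmu' c ltac:(lra)) H) as Hz.
      apply in_map_iff; exists (crit c); split; [reflexivity|].
      apply Hl'; split; [|reflexivity]; apply Hin; split; [split; [apply crit_strip|auto]|].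
      change (0 < c <= t); split; [|lra].
      (* Height [0] is ruled out because [zeta(1/2)] is negative. *)
      destruct (Req_dec c 0) as [->|]; [|lra].
      pose proof zeta_half_neg as Hh; rewrite Hz in Hh; simpl in Hh; lra. }
  rewrite Hsum in Hsign; unfold l' in Hsign; rewrite <- (zero_count_parity l m t) in Hsign by auto.
  pose proof xi_crit_0_neg as H0.
  set (N := list_sum (map m l)) in *.
  assert (Hg : 0 < Cmod (gamma_factor (crit t))) by (apply Cmod_gt_0, gamma_factor_neq_0; rewrite Re_crit; lra).
  rewrite hardyZ_xi; f_equal; fold (crit t).
  apply Rmult_eq_reg_l with (Cmod (gamma_factor (crit t))); [|lra].
  transitivity ((-1) ^ (N + 1) * Rabs (Re (xi_crit t))).
  - replace (Cmod (gamma_factor (crit t)) * (Re (xi_crit t) / Cmod (gamma_factor (crit t))))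
      with (Re (xi_crit t)) by (field; lra).
    rewrite pow_add, pow_1.
    (* As [xi_crit 0] is negative, [xi_crit t] has the sign opposite to [(-1)^N]. *)
    assert (Hpm : (-1) ^ N = 1 \/ (-1) ^ N = -1).
    { clear; induction N as [|n [IH|IH]]; simpl; [auto|rewrite IH; right; ring|rewrite IH; left; ring]. }
    destruct Hpm as [E|E]; rewrite E in *.
    + rewrite Rabs_left by nra; ring.
    + rewrite Rabs_right by nra; ring.
  - rewrite Cmod_xi_crit; ring.
Qed.
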